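(* Let $\mathcal T=(T,A,B)$ be a signed tree model of a graph $G$ on vertex set $[n]$ and $m=|A|+|B|$. Then $G$ admits an interval biclique partition with $O(m)$ bicliques, and such a partition can be constructed in time $O(m\log m)$.
   Context: A transversal pair of a rooted tree $T$ is an unordered pair $uv$ of distinct nodes neither of which is an ancestor of the other ($\preceq_T$ is the ancestor relation). Two pairs $u_1v_1,u_2v_2$ cross if one of $u_1,v_1$ is a strict ancestor of one of $u_2,v_2$ and vice versa. A signed tree model is $(T,A,B)$ with $T$ a full binary rooted tree and $A,B$ disjoint sets of pairwise non-crossing transversal pairs. A pair $u'v'\in A\cup B$ covers nodes $u,v$ if $u'\preceq_T u$, $v'\preceq_T v$ and no other pair $u''v''\in A\cup B$ has $u'\preceq_T u''\preceq_T u$, $v'\preceq_T v''\preceq_T v$. It is a signed tree model of $G$ if $G$ is the graph on the leaves of $T$ in which two leaves are adjacent iff covered by a pair of $B$. An interval biclique partition of $G$ is a linear order $<$ on $V(G)$ with a partition $\mathcal B$ of $E(G)$ into bicliques $\{xy:x\in X,y\in Y\}$ with $X,Y$ disjoint intervals of $<$. *)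

(* Defs.v *)
From mathcomp Require Import all_boot.

Set Implicit Arguments.
Unset Strict Implicit.
Unset Printing Implicit Defensive.

(** * Full binary trees *)

Inductive bintree (V : Type) : Type :=
  | Leaf of V
  | Node of bintree V & bintree V.

Section Tree.
Variable V : Type.
Implicit Types T : bintree V.

Fixpoint leaves T : seq V :=
  match T with
  | Leaf x => [:: x]
  | Node l r => leaves l ++ leaves r
  end.

(* A node is identified with the path from the root to it
   ([false]: left child, [true]: right child). *)
Fixpoint nodes T : seq (seq bool) :=
  match T with
  | Leaf _ => [:: [::]]
  | Node l r => [::] :: map (cons false) (nodes l) ++ map (cons true) (nodes r)
  end.

Definition node T : finType := seq_sub (nodes T).

(* Only meaningful for [p \in nodes T]. *)
Fixpoint subtree T (p : seq bool) : bintree V :=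
  match T, p with
  | Node l r, b :: p' => subtree (if b then r else l) p'
  | _, _ => T
  end.

Fixpoint leftmost T : V :=
  match T with Leaf x => x | Node l _ => leftmost l end.

Fixpoint rightmost T : V :=
  match T with Leaf x => x | Node _ r => rightmost r end.

Definition is_leaf T (u : node T) (x : V) : Prop :=
  subtree T (val u) = Leaf x.

End Tree.

(** * Signed tree models *)

Section SignedTreeModel.
Variables (V : finType) (T : bintree V).
Implicit Types (u v : node T) (P Q : {set node T}) (A B S : {set {set node T}}).

Definition anc u v : bool := prefix (val u) (val v).
Definition sanc u v : bool := (u != v) && anc u v.

Definition transversal P : Prop :=
  exists u v, [/\ P = [set u; v], u != v, ~~ anc u v & ~~ anc v u].

Definition cross P Q : Prop :=
  (exists2 u, u \in P & exists2 v, v \in Q & sanc u v) /\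
  (exists2 v, v \in Q & exists2 u, u \in P & sanc v u).

Definition signed_tree_model A B : Prop :=
  [/\ [disjoint A & B],
      forall P, P \in A :|: B -> transversal P
    & forall P Q, P \in A :|: B -> Q \in A :|: B -> ~ cross P Q].

(* [S] plays the role of the union of the two sets of signed pairs. *)
Definition covers S P u v : Prop :=
  P \in S /\
  exists u' v',
    [/\ P = [set u'; v'], anc u' u, anc v' v
      & ~ exists u'' v'',
            [/\ [set u''; v''] \in S, [set u''; v''] <> P,
                anc u' u'' && anc u'' u & anc v' v'' && anc v'' v]].

(* The leaves of [T] are labelled bijectively by the vertices of the graph. *)
Definition signed_tree_model_of A B (adj : rel V) : Prop :=
  [/\ signed_tree_model A B,
      uniq (leaves T),
      forall x, x \in leaves T
    & forall u v x y, is_leaf u x -> is_leaf v y ->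
        (adj x y <-> exists2 P, P \in B & covers (A :|: B) P u v)].

End SignedTreeModel.

(** * Interval biclique partitions *)

Section IntervalBiclique.
Variable V : finType.
Implicit Types (adj lt : rel V) (X Y : {set V}).

Definition simple_graph adj : Prop := symmetric adj /\ irreflexive adj.

Definition edges adj : {set {set V}} :=
  [set e : {set V} | [exists x, exists y, adj x y && (e == [set x; y])]].

Definition linear_order lt : Prop :=
  [/\ irreflexive lt, transitive lt & forall x y, x != y -> lt x y || lt y x].

Definition interval lt X : Prop :=
  forall x y z, x \in X -> z \in X -> lt x y -> lt y z -> y \in X.

Definition biclique X Y : {set {set V}} :=
  [set [set x; y] | x in X, y in Y].

Definition interval_biclique_partition
    adj lt (BB : {set {set {set V}}}) : Prop :=
  [/\ linear_order lt,
      partition BB (edges adj)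
    & forall b, b \in BB -> exists X Y,
        [/\ interval lt X, interval lt Y, [disjoint X & Y] & b = biclique X Y]].

End IntervalBiclique.

(** * Word RAM

  A structured word RAM: finitely many registers (those occurring in the
  program) and a memory addressed by words.  Words have [w] bits and every
  elementary operation on words costs one unit of time. *)

Inductive binop := Add | Sub | Mul | Div | Mod | Lt | Eq.

Inductive expr :=
  | Const of nat
  | Reg of nat
  | Fetch of expr
  | Bin of binop & expr & expr.

Inductive cmd :=
  | Skip
  | Assign of nat & expr
  | Store of expr & expr
  | Seq of cmd & cmd
  | If of expr & cmd & cmd
  | While of expr & cmd.

Record state := State { reg : nat -> nat; mem : nat -> nat }.

Definition upd (f : nat -> nat) (i v : nat) : nat -> nat :=
  fun j => if j == i then v else f j.

(* Subtraction is truncated at 0; comparisons return 0 or 1. *)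
Definition binop_sem (o : binop) (a b : nat) : nat :=
  match o with
  | Add => a + b
  | Sub => a - b
  | Mul => a * b
  | Div => a %/ b
  | Mod => a %% b
  | Lt => a < b
  | Eq => a == b
  end.

Fixpoint eval (w : nat) (s : state) (e : expr) : nat :=
  match e with
  | Const k => k %% 2 ^ w
  | Reg r => reg s r
  | Fetch a => mem s (eval w s a)
  | Bin o e1 e2 => binop_sem o (eval w s e1) (eval w s e2) %% 2 ^ w
  end.

Fixpoint ecost (e : expr) : nat :=
  match e with
  | Const _ | Reg _ => 1
  | Fetch a => (ecost a).+1
  | Bin _ e1 e2 => (ecost e1 + ecost e2).+1
  end.

(* [exec w c s t s']: started in [s], [c] halts in [s'] after [t] time units. *)
Inductive exec (w : nat) : cmd -> state -> nat -> state -> Prop :=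
  | ExecSkip s : exec w Skip s 1 s
  | ExecAssign s r e :
      exec w (Assign r e) s (ecost e).+1
        (State (upd (reg s) r (eval w s e)) (mem s))
  | ExecStore s a e :
      exec w (Store a e) s (ecost a + ecost e).+1
        (State (reg s) (upd (mem s) (eval w s a) (eval w s e)))
  | ExecSeq c1 c2 s1 s2 s3 t1 t2 :
      exec w c1 s1 t1 s2 -> exec w c2 s2 t2 s3 ->
      exec w (Seq c1 c2) s1 (t1 + t2) s3
  | ExecIf e c1 c2 s s' t :
      exec w (if eval w s e != 0 then c1 else c2) s t s' ->
      exec w (If e c1 c2) s ((ecost e).+1 + t) s'
  | ExecWhileEnd e c s :
      eval w s e = 0 -> exec w (While e c) s (ecost e).+1 s
  | ExecWhileStep e c s1 s2 s3 t1 t2 :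
      eval w s1 e != 0 ->
      exec w c s1 t1 s2 -> exec w (While e c) s2 t2 s3 ->
      exec w (While e c) s1 ((ecost e).+1 + t1 + t2) s3.

Definition init_state (inp : seq nat) : state :=
  State (fun _ => 0) (fun i => nth 0 inp i).

(** * Input and output formats *)

Section Input.
Variables (n : nat) (T : bintree 'I_n).

Definition parent_path (p : seq bool) : seq bool := take (size p).-1 p.

Definition child_path (b : bool) (p : seq bool) : seq bool :=
  if rcons p b \in nodes T then rcons p b else p.

(* Given an enumeration [ns] of the nodes, a node is referred to by its rank in
   [ns].  Its record consists of the parent, the left child, the right child
   (the node itself stands for a missing parent or child), and the ranks, in
   the left-to-right sequence of leaves, of its first and last descendant
   leaves. *)
Definition node_record (ns : seq (seq bool)) (p : seq bool) : seq nat :=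
  [:: index (parent_path p) ns;
      index (child_path false p) ns;
      index (child_path true p) ns;
      index (leftmost (subtree T p)) (leaves T);
      index (rightmost (subtree T p)) (leaves T)].

Definition pair_record (ns : seq (seq bool)) (e : node T * node T) : seq nat :=
  [:: index (val e.1) ns; index (val e.2) ns].

Definition lists_pairs (s : seq (node T * node T)) (A : {set {set node T}}) :
    Prop :=
  perm_eq [seq [set e.1; e.2] | e <- s] (enum A).

(* The nodes, the elements of [A] and [B], and the two ends of each pair may be
   listed in any order. *)
Definition encodes_model (A B : {set {set node T}}) (inp : seq nat) : Prop :=
  exists ns sA sB,
    [/\ perm_eq ns (nodes T), lists_pairs sA A, lists_pairs sB B
      & inp = [:: n; size ns; size sA; size sB]
              ++ [seq val x | x <- leaves T]
              ++ flatten [seq node_record ns p | p <- ns]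
              ++ flatten [seq pair_record ns e | e <- sA]
              ++ flatten [seq pair_record ns e | e <- sB]].

End Input.

Section Output.
Variable n : nat.

(* The vertices whose rank in [o] lies between [a] and [b] (inclusive). *)
Definition rank_interval (o : seq 'I_n) (a b : nat) : {set 'I_n} :=
  [set x | a <= index x o <= b].

(* On halting, register 0 holds the address of an array listing the [n] vertices
   in increasing order, register 1 the number of bicliques, and register 2 the
   address of an array of quadruples [a, b, c, d], one for each biclique, that
   give the first and last ranks of its two sides. *)
Definition encodes_partition (s : state)
    (lt : rel 'I_n) (BB : {set {set {set 'I_n}}}) : Prop :=
  exists o : seq 'I_n,
    let k := reg s 1 in
    let q j i := mem s (reg s 2 + 4 * j + i) in
    let b j := biclique (rank_interval o (q j 0) (q j 1))
                        (rank_interval o (q j 2) (q j 3)) in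
    [/\ perm_eq o (enum 'I_n),
        [seq val x | x <- o] = [seq mem s (reg s 0 + i) | i <- iota 0 n],
        forall x y, lt x y = (index x o < index y o)
      & perm_eq [seq b j | j <- iota 0 k] (enum BB)].

End Output.

(* Main.v *)
(** Number the leaves from left to right. A signed pair [uv], with the leaves
    below [u] to the left of those below [v], is a rectangle of pairs of leaf
    ranks, and two leaves are adjacent iff the innermost rectangle containing
    the corresponding point comes from [B]. As the pairs do not cross, two
    rectangles are nested or disjoint whenever their sides are comparable in
    both directions.

    The rectangles are inserted one by one, sorted by left end, then by
    decreasing right end, then by decreasing height. The inserted rectangles cut
    the grid into rectangular regions with a colour each, and a new rectangle is
    always contained in a single region, which it splits into five. The final
    regions with the colour of [B] are thus at most [4 m] interval bicliques that
    partition the edges.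

    To find the region in time [O(log m)], sweep a vertical line from left to
    right: as the horizontal sides are laminar, rectangles leave the sweep line
    in the reverse order of their insertion, so a stack allows each insertion to
    be undone, and a tournament tree over the sorted ordinates gives the region
    start just below the new rectangle. The same tree is used for sorting. *)

Require Import Defs.
From mathcomp Require Import all_boot.
From mathcomp Require Import zify.

Set Implicit Arguments.
Unset Strict Implicit.
Unset Printing Implicit Defensive.

(** * Arrays on the word RAM *)

(** The five-way split lets the part to the right of the new rectangle keep the number of the old
    region. When the sweep line passes the rectangle, the region to be reinstated is thus already
    the correct one, with a moved left end, and undoing an insertion only restores a few ordinates.
    The vertical extent of a numbered region never changes, so the rectangle and its home region
    determine what has to be undone.

    The obstacle is to show that a single region contains the new rectangle. A region on the sweep
    line ends above at [n] or at a side of a rectangle on the stack. Such a rectangle is still open,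
    so it contains the new one or is vertically apart from it, and its sides do not cut the new one.

    The time bound is amortized: the budget of an item pays for its later removal as well. Programs
    are verified over arrays of length [W], twenty times the input length, with a weakest
    precondition that carries the remaining time, so that correctness, termination and cost have one
    proof. The existence statement is obtained by running the program with long enough words. *)

Record ast := ASt { ar : nat -> nat; aa : nat -> nat -> nat }.

(** Names of registers and arrays are compared by [Nat.eqb], which [cbn] evaluates on numerals, so
    reads after writes simplify by computation; indices inside an array stay symbolic. *)
Definition setr (s : ast) (r v : nat) : ast :=
  ASt (fun r' => if Nat.eqb r' r then v else ar s r') (aa s).

Definition seta (s : ast) (j i v : nat) : ast :=
  ASt (ar s)
      (fun j' i' => if Nat.eqb j' j then if i' == i then v else aa s j i'
                    else aa s j' i').

Inductive aexpr :=
  | AK of nat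
  | AR of nat
  | AA of nat & aexpr
  | AB of binop & aexpr & aexpr.

Fixpoint ev (s : ast) (e : aexpr) : nat :=
  match e with
  | AK k => k
  | AR r => ar s r
  | AA j e => aa s j (ev s e)
  | AB o e1 e2 => binop_sem o (ev s e1) (ev s e2)
  end.

Inductive acmd :=
  | ASet of nat & aexpr
  | ASto of nat & aexpr & aexpr
  | ASeq of acmd & acmd
  | AIf of aexpr & acmd & acmd
  | AWhile of aexpr & acmd
  | ASkip.

(* Array [j] occupies the addresses from [j * W] to [j * W + W - 1], where
   register 3 holds [W]. *)
Fixpoint cexpr (e : aexpr) : expr :=
  match e with
  | AK k => Const k
  | AR r => Reg r
  | AA j e => Fetch (Bin Add (Bin Mul (Const j) (Reg 3)) (cexpr e))
  | AB o e1 e2 => Bin o (cexpr e1) (cexpr e2)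
  end.

Definition caddr (j : nat) (e : aexpr) : expr :=
  Bin Add (Bin Mul (Const j) (Reg 3)) (cexpr e).

Fixpoint ccmd (c : acmd) : cmd :=
  match c with
  | ASet r e => Assign r (cexpr e)
  | ASto j e1 e2 => Store (caddr j e1) (cexpr e2)
  | ASeq c1 c2 => Seq (ccmd c1) (ccmd c2)
  | AIf e c1 c2 => If (cexpr e) (ccmd c1) (ccmd c2)
  | AWhile e c => While (cexpr e) (ccmd c)
  | ASkip => Skip
  end.

(** The [5] of an array access is the fetch, a sum, a product, the array number and the register
    holding [W]. *)
Fixpoint acost (e : aexpr) : nat :=
  match e with
  | AK _ | AR _ => 1
  | AA _ e => 5 + acost e
  | AB _ e1 e2 => (acost e1 + acost e2).+1
  end.

Lemma ecost_cexpr e : ecost (cexpr e) = acost e.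
Proof. by elim: e => //= [j e ->|o e1 -> e2 ->]; lia. Qed.

Definition num_arrays := 20.

Lemma nat_eqbP a b : reflect (a = b) (Nat.eqb a b).
Proof.
apply: (iffP idP); elim: a b => [|a IH] [|b] //=; first by move/IH->.
by case=> /IH.
Qed.

Section Machine.
Variables (w W : nat).
Hypothesis hW : num_arrays * W <= 2 ^ w.
Hypothesis hW100 : 100 < W.

(* Only additions and multiplications can leave the range below [W]. *)
Fixpoint safe (s : ast) (e : aexpr) : Prop :=
  match e with
  | AK k => k <= 100
  | AR r => r != 3
  | AA j e => j < num_arrays /\ safe s e
  | AB o e1 e2 =>
      [/\ safe s e1, safe s e2
        & match o with
          | Add => ev s e1 + ev s e2 < W
          | Mul => ev s e1 * ev s e2 < W
          | _ => True
          end]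
  end.

(** The bounds by [W] make every stored value a valid index of an array, and leave no wrap-around in
    expressions that are [safe]. *)
Definition represents (st : state) (s : ast) : Prop :=
  [/\ reg st 3 = W,
      forall r, r != 3 -> reg st r = ar s r,
      forall j i, j < num_arrays -> i < W -> Defs.mem st (j * W + i) = aa s j i,
      forall r, r != 3 -> ar s r < W
    & forall j i, j < num_arrays -> i < W -> aa s j i < W].

Lemma leqW2w : W < 2 ^ w.
Proof. by move: hW hW100; rewrite /num_arrays; lia. Qed.

Lemma addr_eval st j e i :
  reg st 3 = W -> j < num_arrays -> i < W -> eval w st e = i ->
  eval w st (Bin Add (Bin Mul (Const j) (Reg 3)) e) = j * W + i.
Proof.
move=> h3 hj hi /= ->; rewrite h3.
have hj2 : j < 2 ^ w by move: hj hW hW100; rewrite /num_arrays; lia.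
have hjW : j * W + i < 2 ^ w.
  apply: leq_trans hW; apply: (@leq_trans (j.+1 * W)); first by rewrite mulSn; lia.
  by rewrite leq_mul2r hj orbT.
by rewrite (modn_small hj2) (@modn_small (j * W)) ?modn_small //; lia.
Qed.

Lemma ev_safe st s e : represents st s -> safe s e ->
  eval w st (cexpr e) = ev s e /\ ev s e < W.
Proof.
move=> [h3 hr hm br bm]; have hWw := leqW2w.
elim: e => [k|r|j e IH|o e1 IH1 e2 IH2].
- by move=> /= hk; rewrite modn_small; lia.
- by move=> /= hk; rewrite hr //; split=> //; apply: br.
- move=> /= [hj /IH[IHe hb]]; split; last exact: bm.
  by rewrite -hm // -(addr_eval h3 hj hb IHe).
- move=> [/IH1[E1 b1] /IH2[E2 b2] ho].
  have hb : binop_sem o (ev s e1) (ev s e2) < W.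
    case: o ho => //= _.
    + exact: leq_ltn_trans (leq_subr _ _) b1.
    + exact: leq_ltn_trans (leq_div _ _) b1.
    + exact: leq_ltn_trans (leq_mod _ _) b1.
    + by apply: leq_ltn_trans (leq_b1 _) _; lia.
    + by apply: leq_ltn_trans (leq_b1 _) _; lia.
  split; last exact: hb.
  by rewrite [LHS]/= E1 E2 modn_small //; apply: ltn_trans hWw.
Qed.

(** Total correctness with a time budget: [r] is what is left of [t]. As [Q] sees [r], running time
    becomes a part of invariants. *)
Definition wp (c : acmd) (s : ast) (t : nat) (Q : nat -> ast -> Prop) : Prop :=
  forall st, represents st s -> exists t' st' r s',
    [/\ exec w (ccmd c) st t' st', t' + r <= t, represents st' s' & Q r s'].

Lemma wp_set r e s t (Q : nat -> ast -> Prop) :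
  r != 3 -> safe s e -> (acost e).+1 <= t ->
  Q (t - (acost e).+1) (setr s r (ev s e)) -> wp (ASet r e) s t Q.
Proof.
move=> hr hs ht hQ st hrep.
have [E b] := ev_safe hrep hs.
do 4!eexists; split; [exact: ExecAssign| |  |exact: hQ].
  by rewrite ecost_cexpr; lia.
case: hrep => h3 hrg hm br bm; rewrite E; split=> //=.
- by rewrite /upd eq_sym (negbTE hr).
- move=> r' hr'; rewrite /upd; case: (nat_eqbP r' r) => [->|ne].
    by rewrite eqxx.
  by case: eqP ne => // _ _; apply: hrg.
- by move=> r' hr'; case: (nat_eqbP r' r) => // _; apply: br.
Qed.

Lemma addr_inj j i j' i' : i < W -> i' < W ->
  (j * W + i == j' * W + i') = (j == j') && (i == i').
Proof.
move=> hi hi'; apply/eqP/andP => [E|[/eqP-> /eqP->] //].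
have ej : j = j'.
  have := congr1 (divn^~ W) E.
  by rewrite !divnMDl ?(divn_small hi) ?(divn_small hi') ?addn0 //; lia.
by subst j'; split=> //; apply/eqP; lia.
Qed.

Lemma wp_sto j e1 e2 s t (Q : nat -> ast -> Prop) :
  j < num_arrays -> safe s e1 -> safe s e2 ->
  acost e1 + acost e2 + 5 <= t ->
  Q (t - (acost e1 + acost e2 + 5)) (seta s j (ev s e1) (ev s e2)) ->
  wp (ASto j e1 e2) s t Q.
Proof.
move=> hj hs1 hs2 ht hQ st hrep.
have [E1 b1] := ev_safe hrep hs1; have [E2 b2] := ev_safe hrep hs2.
do 4!eexists; split; [exact: ExecStore| |  |exact: hQ].
  by rewrite /= !ecost_cexpr; lia.
case: hrep => h3 hrg hm br bm.
rewrite (addr_eval h3 hj b1 E1) E2; split=> //=.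
- move=> j' i' hj' hi'; rewrite /upd addr_inj //.
  case: (nat_eqbP j' j) => [->|ne]; first by rewrite eqxx /= hm.
  by case: eqP ne => //= _ _; apply: hm.
- move=> j' i' hj' hi'; case: (nat_eqbP j' j) => [_|_]; last exact: bm.
  by case: eqP => // _; apply: bm.
Qed.

Lemma wp_seq c1 c2 s t Q :
  wp c1 s t (fun r s' => wp c2 s' r Q) -> wp (ASeq c1 c2) s t Q.
Proof.
clear hW hW100.
move=> h st /h[t1 [st1 [r1 [s1 [h1 ht1 hr1 /(_ _ hr1)]]]]].
case=> t2 [st2 [r2 [s2 [h2 ht2 hr2 hQ]]]].
by exists (t1 + t2), st2, r2, s2; split=> //; [exact: ExecSeq h1 h2|lia].
Qed.

Lemma wp_skip s t (Q : nat -> ast -> Prop) :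
  0 < t -> Q t.-1 s -> wp ASkip s t Q.
Proof.
clear hW hW100.
by move=> ht hQ st hrep; exists 1, st, t.-1, s; split=> //; [exact: ExecSkip|lia].
Qed.

Lemma wp_if e c1 c2 s t Q :
  safe s e -> (acost e).+1 <= t ->
  (ev s e != 0 -> wp c1 s (t - (acost e).+1) Q) ->
  (ev s e = 0 -> wp c2 s (t - (acost e).+1) Q) -> wp (AIf e c1 c2) s t Q.
Proof.
move=> hs ht h1 h2 st hrep; have [E b] := ev_safe hrep hs.
have : wp (if ev s e != 0 then c1 else c2) s (t - (acost e).+1) Q.
  by case: (boolP (ev s e != 0)) => [/h1 //|/negPn/eqP/h2].
case/(_ _ hrep) => t' [st' [r [s' [hx ht' hr' hQ]]]].
exists ((acost e).+1 + t'), st', r, s'; split=> //; last by lia.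
rewrite -ecost_cexpr; apply: ExecIf; rewrite E; move: hx.
by case: (_ != 0).
Qed.

Lemma wp_while (I : nat -> ast -> Prop) e c s t (Q : nat -> ast -> Prop) :
  (forall t s, I t s ->
     [/\ safe s e, (acost e).+1 <= t,
         ev s e = 0 -> Q (t - (acost e).+1) s
       & ev s e != 0 -> wp c s (t - (acost e).+1) I]) ->
  I t s -> wp (AWhile e c) s t Q.
Proof.
move=> h; elim/ltn_ind: t s => t IH s hI st hrep.
have [hs ht h0 h1] := h _ _ hI; have [E b] := ev_safe hrep hs.
have [z|nz] := eqVneq (ev s e) 0.
  exists (acost e).+1, st, (t - (acost e).+1), s; split=> //; last exact: h0.
    by rewrite -ecost_cexpr; apply: ExecWhileEnd; rewrite E.
  by lia.
have [t1 [st1 [r1 [s1 [x1 ht1 hr1 hI1]]]]] := h1 nz _ hrep.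
have [|t2 [st2 [r2 [s2 [x2 ht2 hr2 hQ]]]]] := IH r1 _ _ hI1 _ hr1.
  by lia.
exists ((acost e).+1 + t1 + t2), st2, r2, s2; split=> //; last by lia.
by rewrite -ecost_cexpr; apply: ExecWhileStep x1 x2; rewrite E.
Qed.

Lemma wp_conseq c s t t' (Q Q' : nat -> ast -> Prop) :
  wp c s t' Q' -> t' <= t ->
  (forall r s', Q' r s' -> Q (r + (t - t')) s') -> wp c s t Q.
Proof.
clear hW hW100.
move=> h ht hQ st /h[t1 [st1 [r1 [s1 [x1 ht1 hr1 /hQ hq]]]]].
by exists t1, st1, (r1 + (t - t')), s1; split=> //; lia.
Qed.

End Machine.

(* The two states differ at most in the listed registers and arrays. *)
Definition agree (rs js : seq nat) (s s' : ast) : Prop :=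
  (forall r, r \notin rs -> ar s' r = ar s r) /\
  (forall j i, j \notin js -> aa s' j i = aa s j i).

(** * Tournament trees *)

Notation rN := 4 (only parsing).
Notation rp := 5 (only parsing).
Notation rx := 6 (only parsing).
Notation ry := 7 (only parsing).
Notation ri := 8 (only parsing).
Notation rj := 9 (only parsing).
Notation rr := 10 (only parsing).
Notation rs := 22 (only parsing).
Notation aT := 8 (only parsing).
Notation aORD := 11 (only parsing).
Notation sregs := [:: rp; rx; ry; ri; rj; rr].
Notation sarrs := [:: aT; aORD].

(** Heap numbering: node [p] has the children [2 * p] and [2 * p + 1], the root is [1], and leaf [q]
    is node [N + q] with [N] in register [rN]. Only the ancestors of the changed leaf are
    recomputed. *)
Definition up (better pos v : aexpr) : acmd :=
  ASeq (ASet rp (AB Add (AR rN) pos))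
  (ASeq (ASto aT (AR rp) v)
  (AWhile (AB Lt (AK 1) (AR rp))
    (ASeq (ASet rp (AB Div (AR rp) (AK 2)))
    (ASeq (ASet rx (AA aT (AB Mul (AK 2) (AR rp))))
    (ASeq (ASet ry (AA aT (AB Add (AB Mul (AK 2) (AR rp)) (AK 1))))
      (AIf better (ASto aT (AR rp) (AR ry)) (ASto aT (AR rp) (AR rx)))))))).

Definition tourney (le : rel nat) (N : nat) (T : nat -> nat) : Prop :=
  forall p, 0 < p < N ->
    T p = if le (T (2 * p)) (T (2 * p + 1)) then T (2 * p) else T (2 * p + 1).

(** There are [h] rounds; [200] covers one round with a comparison of cost at most [100]. *)
Definition up_cost h := 200 * h.+2.

Lemma agree_refl rs js s : agree rs js s s.
Proof. by []. Qed.

Lemma agree_trans rs js s1 s2 s3 :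
  agree rs js s1 s2 -> agree rs js s2 s3 -> agree rs js s1 s3.
Proof.
move=> [h1 h2] [h3 h4]; split=> [r hr|j i hj]; first by rewrite h3 ?h1.
by rewrite h4 ?h2.
Qed.

Lemma agree_sub rs js rs' js' s s' :
  {subset rs <= rs'} -> {subset js <= js'} -> agree rs js s s' -> agree rs' js' s s'.
Proof.
move=> hr hj [h1 h2]; split=> [r h|j i h].
  by apply: h1; apply: contra h; apply: hr.
by apply: h2; apply: contra h; apply: hj.
Qed.

Lemma agree_setr rs js s s' r v :
  r \in rs -> agree rs js s s' -> agree rs js s (setr s' r v).
Proof.
move=> hr [h1 h2]; split=> [r' hr'|j i hj] /=; last exact: h2.
by case: nat_eqbP hr' => [->|_ hr']; [rewrite hr|apply: h1].
Qed.

Lemma agree_seta rs js s s' j i v :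
  j \in js -> agree rs js s s' -> agree rs js s (seta s' j i v).
Proof.
move=> hj [h1 h2]; split=> [r' hr'|j' i' hj'] /=; first exact: h1.
by case: nat_eqbP hj' => [->|_ hj']; [rewrite hj|apply: h2].
Qed.

Ltac ssimp := cbn [ev ar aa setr seta binop_sem Nat.eqb safe acost].

Ltac side := by ssimp; repeat split; try done; lia.

Section Tourney.
Variables (w W : nat).
Hypothesis hW : num_arrays * W <= 2 ^ w.
Hypothesis hW100 : 100 < W.

Section Up.
Variables (le : rel nat) (h : nat) (better pos v : aexpr) (s : ast) (V : nat).
Hypothesis hbetter : forall s', agree [:: rp; rx; ry] [:: aT] s s' ->
  safe W s' better /\ (ev s' better != 0) = ~~ le (ar s' rx) (ar s' ry).
Hypothesis hcost : acost better <= 100.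
Hypothesis hpos : safe W s pos.
Hypothesis hposcost : acost pos <= 20.
Hypothesis hposlt : ev s pos < 2 ^ h.
Hypothesis hv : forall s', agree [:: rp] [::] s s' -> safe W s' v /\ ev s' v = V.
Hypothesis hvcost : acost v <= 20.
Hypothesis hN : ar s rN = 2 ^ h.
Hypothesis hNW : 2 ^ h.+1 < W.
Hypothesis htour : tourney le (2 ^ h) (aa s aT).

Lemma wp_up t (Q : nat -> ast -> Prop) :
  up_cost h <= t ->
  (forall r s', t - up_cost h <= r -> agree [:: rp; rx; ry] [:: aT] s s' ->
     tourney le (2 ^ h) (aa s' aT) ->
     (forall q, q < 2 ^ h -> aa s' aT (2 ^ h + q) =
        if q == ev s pos then V else aa s aT (2 ^ h + q)) -> Q r s') ->
  wp w W (up better pos v) s t Q.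
Proof.
move=> ht hQ; set P := ev s pos in hQ *; have hP : P < 2 ^ h by [].
have e2 : 2 ^ h.+1 = 2 * 2 ^ h by rewrite expnS.
have hc : up_cost h = 200 * h.+2 by [].
apply: wp_seq; apply: (wp_set hW hW100) => //.
- by ssimp; split=> //; rewrite hN -/P; lia.
- by ssimp; lia.
ssimp; rewrite hN -/P.
set s1 := setr s rp _.
have a1 : agree [:: rp] [::] s s1 by apply: agree_setr => //; apply: agree_refl.
have [sv ev1] := hv a1.
apply: wp_seq; apply: (wp_sto hW hW100) => //; first by ssimp; lia.
rewrite ev1; ssimp; set s2 := seta s1 _ _ _.
have a2 : agree [:: rp; rx; ry] [:: aT] s s2.
  apply: agree_seta => //; apply: agree_sub a1 => // x; rewrite !inE.
  by move/eqP->.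
(* The equation may fail only at the proper ancestors [p %/ 2 ^ i.+1] of the current node; once [p]
   is the root, none is left. The exponent [j] bounds the remaining rounds. *)
pose I t' s' := exists j p,
  [/\ ar s' rp = p, 0 < p < 2 ^ j, p < 2 ^ h.+1,
      t - up_cost h + 180 * j + 10 <= t' &
  [/\ agree [:: rp; rx; ry] [:: aT] s s',
      forall q, q < 2 ^ h -> aa s' aT (2 ^ h + q) =
        if q == P then V else aa s aT (2 ^ h + q)
    & forall q, 0 < q < 2 ^ h -> (forall i, p %/ 2 ^ i.+1 != q) ->
      aa s' aT q = if le (aa s' aT (2 * q)) (aa s' aT (2 * q + 1))
        then aa s' aT (2 * q) else aa s' aT (2 * q + 1)]].
apply: (wp_while hW hW100 (I := I)).
  move=> {}t' s' [j [p [hp pj ph htj [ag hl ht']]]]; ssimp; rewrite hp.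
  split=> //; first by lia.
    move=> le1; apply: hQ => //; first by lia.
    move=> q hq; apply: ht' => // i.
    have -> : p = 1 by move: le1; case: ltnP => //; lia.
    by rewrite divn_small ?(ltn_exp2l 0) //; case/andP: hq; case: (q).
  move=> gt1; have {}gt1 : 1 < p by move: gt1; case: ltnP.
  have hd := divn_eq p 2; have hm : p %% 2 < 2 by rewrite ltn_mod.
  set p' := p %/ 2 in hd *.
  have p'0 : 0 < p' by lia.
  have p'h : p' < 2 ^ h by rewrite e2 in ph; lia.
  have [j' ej] : exists j', j = j'.+1.
    by case: (j) pj => [|j'] hpj; [move: hpj; rewrite expn0; lia|exists j'].
  have p'j : p' < 2 ^ j' by move: pj; rewrite ej expnS; lia.
  apply: wp_seq; apply: (wp_set hW hW100) => //; first by ssimp; lia.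
  ssimp; rewrite hp -/p'.
  apply: wp_seq; apply: (wp_set hW hW100) => //.
  - side.
  - by ssimp; lia.
  apply: wp_seq; apply: (wp_set hW hW100) => //.
  - side.
  - by ssimp; lia.
  ssimp; set X := aa s' 8 (2 * p'); set Y := aa s' 8 (2 * p' + 1).
  set s3 := setr (setr (setr s' _ _) _ _) _ _.
  have a3 : agree [:: rp; rx; ry] [:: aT] s s3 by do 3!apply: agree_setr => //.
  have [sb eb] := hbetter a3.
  have fin V' t'' : V' = (if le X Y then X else Y) ->
    t - up_cost h + 180 * j' + 10 <= t'' -> I t'' (seta s3 8 p' V').
    move=> eV htt; exists j', p'; ssimp; split=> //; first by lia.
      by rewrite e2; lia.
    split.
    - exact: agree_seta.
    - move=> q hq; case: eqP => [eq|_]; first by lia.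
      by apply: hl.
    (* The write at [p'] concerns only the equations at [p'] and at its parent, and the parent is
       excluded by [hq]. *)
    - move=> q /andP[q0 qh] hq.
      have hne : 2 * q != p' /\ 2 * q + 1 != p'.
        have := hq 0; rewrite expn1 => hq0; split; apply: contraNN hq0 => /eqP <-.
          by rewrite mulKn.
        by rewrite addn1 mulnC; apply/eqP; lia.
      case: hne => /negbTE-> /negbTE->.
      case: (eqVneq q p') => [->|ne]; first exact: eV.
      apply: ht'; first by rewrite q0.
      case=> [|i]; first by rewrite expn1 -/p' eq_sym.
      by rewrite expnS divnMA -/p'; apply: hq.
  apply: (wp_if hW hW100) => //; first by ssimp; lia.
    move=> nb; apply: (wp_sto hW hW100) => //; first by ssimp; lia.
    ssimp; apply: fin; last by lia.
    by move: nb; rewrite eb; ssimp; case: (le X Y).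
  move=> nb; apply: (wp_sto hW hW100) => //; first by ssimp; lia.
  ssimp; apply: fin; last by lia.
  by move/eqP: nb; rewrite -[_ == 0]negbK eb; ssimp; case: (le X Y).
exists h.+1, (2 ^ h + P); rewrite /s2 /s1; ssimp; split=> //.
- by rewrite e2; lia.
- by rewrite e2; lia.
- by lia.
split=> //.
  by move=> q hq; rewrite eqn_add2l.
move=> q /andP[q0 qh] hq.
have -> : (q == 2 ^ h + P) = false by apply/eqP; lia.
have := hq 0; rewrite expn1 => hq0.
have -> : (2 * q == 2 ^ h + P) = false.
  by apply/eqP => e; case/eqP: hq0; lia.
have -> : (2 * q + 1 == 2 ^ h + P) = false.
  by apply/eqP => e; case/eqP: hq0; lia.
by apply: htour; rewrite q0.
Qed.

End Up.

(** Induction on the height [j]: the leaves below a node [p] of depth [i] are numbered from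
    [p * 2 ^ j] to [p.+1 * 2 ^ j - 1]. *)
Lemma tourney_best (le : rel nat) h T : total le -> transitive le ->
  tourney le (2 ^ h) T -> forall j i p, i + j = h -> 2 ^ i <= p < 2 ^ i.+1 ->
  (forall q, p * 2 ^ j <= q < p.+1 * 2 ^ j -> le (T p) (T q)) /\
  exists2 q, p * 2 ^ j <= q < p.+1 * 2 ^ j & T p = T q.
Proof.
move=> tot tr ht; elim=> [|j IH] i p hij hp.
  have r x : le x x by have := tot x x; rewrite orbb.
  rewrite expn0 !muln1; split; last by exists p => //; lia.
  by move=> q hq; have -> : q = p by lia.
have e1 : 2 ^ i.+1 = 2 * 2 ^ i by rewrite expnS.
have e2 : 2 ^ i.+2 = 2 * 2 ^ i.+1 by rewrite expnS.
have e3 : 2 ^ j.+1 = 2 * 2 ^ j by rewrite expnS.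
have [||L1 [q1 hq1 E1]] := IH i.+1 (2 * p); [by lia|by lia|].
have [||L2 [q2 hq2 E2]] := IH i.+1 (2 * p + 1); [by lia|by lia|].
have i0 : 0 < 2 ^ i by rewrite expn_gt0.
have le2 : 2 ^ i.+1 <= 2 ^ h by rewrite leq_exp2l //; lia.
have -> := ht p; last by lia.
rewrite e3; split.
  move=> q hq; case: (ltnP q ((2 * p + 1) * 2 ^ j)) => hlt.
    have l1 : le (T (2 * p)) (T q) by apply: L1; nia.
    case: ifP => // nle; apply: tr l1.
    by have := tot (T (2 * p)) (T (2 * p + 1)); rewrite nle.
  have l2 : le (T (2 * p + 1)) (T q) by apply: L2; nia.
  by case: ifP => // hle; apply: tr l2.
by case: ifP => _; [exists q1|exists q2] => //; nia.
Qed.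

Lemma tourney_root (le : rel nat) h T : total le -> transitive le ->
  tourney le (2 ^ h) T ->
  (forall q, q < 2 ^ h -> le (T 1) (T (2 ^ h + q))) /\
  exists2 q, q < 2 ^ h & T 1 = T (2 ^ h + q).
Proof.
move=> tot tr ht; have [//|//|L [q hq E]] := @tourney_best le h T tot tr ht h 0 1.
split=> [q' hq'|]; first by apply: L; lia.
by exists (q - 2 ^ h); [lia|rewrite E; congr T; lia].
Qed.

(** Sorting ends with all leaves reset, so the same tree can be handed on to the next sort and to
    the sweep. *)
Lemma tourney_zero (le : rel nat) h T : total le -> transitive le ->
  tourney le (2 ^ h) T -> (forall q, q < 2 ^ h -> T (2 ^ h + q) = 0) ->
  forall p, 0 < p < 2 ^ h.+1 -> T p = 0.
Proof.
move=> tot tr ht hz p /andP[p0 hp].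
(* The depth of node [p] is [trunc_log 2 p]. *)
have hi := trunc_log_bounds (isT : 1 < 2) p0.
have hih : trunc_log 2 p <= h.
  by rewrite -ltnS -(ltn_exp2l (m := 2)) //; case/andP: hi => hi _; apply: leq_ltn_trans hp.
have [||_ [q hq ->]] := @tourney_best le h T tot tr ht (h - trunc_log 2 p) (trunc_log 2 p) p.
- by lia.
- by [].
have eh : 2 ^ h = 2 ^ trunc_log 2 p * 2 ^ (h - trunc_log 2 p).
  by rewrite -expnD; congr expn; lia.
have : 2 ^ h <= q < 2 ^ h + 2 ^ h.
  rewrite {}eh; case/andP: hi => h1 h2; rewrite expnS in h2.
  by case/andP: hq => h3 h4; apply/andP; split; nia.
by move=> hq'; rewrite (_ : q = 2 ^ h + (q - 2 ^ h)) ?hz; lia.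
Qed.

(** Prefix maximum over the leaves up to [pos]: on the way to the root, whenever [p] is a right
    child, its left sibling covers a block of earlier leaves. *)
Definition query (pos : aexpr) : acmd :=
  ASeq (ASet rp (AB Add (AR rN) pos))
  (ASeq (ASet rs (AA aT (AR rp)))
  (AWhile (AB Lt (AK 1) (AR rp))
    (ASeq
      (AIf (AB Mod (AR rp) (AK 2))
         (ASeq (ASet rx (AA aT (AB Defs.Sub (AR rp) (AK 1))))
               (AIf (AB Lt (AR rs) (AR rx)) (ASet rs (AR rx)) ASkip))
         ASkip)
      (ASet rp (AB Div (AR rp) (AK 2)))))).

Lemma wp_query h pos s t (Q : nat -> ast -> Prop) :
  safe W s pos -> acost pos <= 20 -> ev s pos < 2 ^ h ->
  ar s rN = 2 ^ h -> 2 ^ h.+1 < W ->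
  tourney geq (2 ^ h) (aa s aT) -> up_cost h <= t ->
  (forall r s', t - up_cost h <= r -> agree [:: rp; rx; rs] [::] s s' ->
     (forall q, q <= ev s pos -> aa s aT (2 ^ h + q) <= ar s' rs) ->
     (exists2 q, q <= ev s pos & ar s' rs = aa s aT (2 ^ h + q)) -> Q r s') ->
  wp w W (query pos) s t Q.
Proof.
move=> hpos hposcost; set P := ev s pos => hP hN hNW htour ht hQ.
have e2 : 2 ^ h.+1 = 2 * 2 ^ h by rewrite expnS.
have hc : up_cost h = 200 * h.+2 by [].
have tot : total geq by move=> x y; apply: leq_total.
have tr : transitive geq by move=> x y z h1 h2; apply: leq_trans h2 h1.
have best := tourney_best tot tr htour.
apply: wp_seq; apply: (wp_set hW hW100) => //.
- by ssimp; split=> //; rewrite hN -/P; lia.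
- side.
apply: wp_seq; apply: (wp_set hW hW100) => //; first by side.
ssimp; rewrite hN -/P.
(* Register [rs] dominates the leaves from the first one below [p] up to [P], and its value occurs
   among the leaves up to [P]. *)
pose I t' s' := exists i j p,
  [/\ ar s' rp = p, i + j = h, 2 ^ i <= p < 2 ^ i.+1,
      p * 2 ^ j <= 2 ^ h + P < p.+1 * 2 ^ j &
  [/\ t - up_cost h + 100 * i + 10 <= t',
      agree [:: rp; rx; rs] [::] s s',
      forall q, q <= P -> p * 2 ^ j <= 2 ^ h + q ->
        aa s aT (2 ^ h + q) <= ar s' rs
    & exists2 q, q <= P & ar s' rs = aa s aT (2 ^ h + q)]].
apply: (wp_while hW hW100 (I := I)); last first.
  exists h, 0, (2 ^ h + P); rewrite expn0 !muln1; ssimp; split=> //; try lia.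
  split=> //.
  - by lia.
  - by do 2!apply: agree_setr => //; apply: agree_refl.
  - by move=> q hq hq'; have -> : q = P by lia.
  - by exists P.
move=> {}t' s' [i [j [p [hp hij hpi hpj [htj ag hmax hex]]]]]; ssimp; rewrite hp.
split=> //; first by lia.
  move=> le1; apply: hQ => //; first by lia.
  move=> q hq; apply: hmax => //.
  have p1 : p = 1 by move: le1; case: ltnP => //; have := expn_gt0 2 i; lia.
  have i0 : i = 0 by case: (i) hpi => // i'; rewrite p1 expnS; have := expn_gt0 2 i'; lia.
  by rewrite p1 mul1n -hij i0 add0n; lia.
move=> gt1; have {}gt1 : 1 < p by move: gt1; case: ltnP.
have hd := divn_eq p 2; have hm : p %% 2 < 2 by rewrite ltn_mod.
set p' := p %/ 2 in hd *.
have [i' ei] : exists i', i = i'.+1.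
  by case: (i) hpi => [|i'] hpi; [move: hpi; rewrite expn0 expn1; lia|exists i'].
have aaT k : aa s' 8 k = aa s 8 k by apply ag.
have hpi' : 2 ^ i' <= p' < 2 ^ i'.+1 by move: hpi; rewrite ei !expnS; lia.
have e3 : 2 ^ j.+1 = 2 * 2 ^ j by rewrite expnS.
have hpj' : p' * 2 ^ j.+1 <= 2 ^ h + P < p'.+1 * 2 ^ j.+1 by rewrite e3; nia.
have fin t'' s'' : agree [:: rp; rx; rs] [::] s s'' -> ar s'' rp = p ->
    t - up_cost h + 100 * i' + 20 <= t'' ->
    (forall q, q <= P -> p' * 2 ^ j.+1 <= 2 ^ h + q ->
        aa s aT (2 ^ h + q) <= ar s'' rs) ->
    (exists2 q, q <= P & ar s'' rs = aa s aT (2 ^ h + q)) ->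
    wp w W (ASet rp (AB Div (AR rp) (AK 2))) s'' t'' I.
  move=> ag'' hp'' ht'' hm'' he''.
  apply: (wp_set hW hW100) => //; first by side.
  ssimp; rewrite hp'' -/p'; exists i', j.+1, p'; split=> //; first by lia.
  split=> //; first by lia.
  by apply: agree_setr.
apply: wp_seq; apply: (wp_if hW hW100) => //; first by side.
  ssimp; rewrite hp => odd_p.
  have pm : p %% 2 = 1 by move/eqP: odd_p; lia.
  apply: wp_seq; apply: (wp_set hW hW100) => //; first by side.
  ssimp; rewrite hp aaT.
  have [||L [q1 hq1 E1]] := best j i (p - 1).
  - by lia.
  - by case/andP: hpi' => h1 _; rewrite ei expnS; move: hpi; rewrite ei expnS; lia.
  have hq1' : 2 ^ h <= q1.
    have : 2 ^ h = 2 ^ i * 2 ^ j by rewrite -expnD hij.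
    have : 2 ^ i <= p - 1 by move: hpi'; rewrite ei expnS; lia.
    by nia.
  have hmax' q : q <= P -> p' * 2 ^ j.+1 <= 2 ^ h + q ->
      aa s aT (2 ^ h + q) <= maxn (ar s' rs) (aa s aT (p - 1)).
    move=> hq hle; rewrite leq_max.
    case: (leqP (p * 2 ^ j) (2 ^ h + q)) => hpq; first by rewrite hmax.
    apply/orP; right; apply: L; rewrite e3 in hle.
    by apply/andP; split; nia.
  have hex' : exists2 q, q <= P & aa s aT (p - 1) = aa s aT (2 ^ h + q).
    exists (q1 - 2 ^ h); last by rewrite E1; congr (aa s _ _); lia.
    have := hpj; have : q1 < p * 2 ^ j by nia.
    by lia.
  apply: (wp_if hW hW100) => //; first by side.
    ssimp => hlt; have {}hlt : ar s' rs < aa s aT (p - 1) by move: hlt; case: ltnP.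
    apply: (wp_set hW hW100) => //; first by side.
    ssimp; apply: fin => //; try by ssimp; lia.
    + by do 2!apply: agree_setr => //.
    + by ssimp; move=> q hq hle; have := hmax' q hq hle; lia.
  ssimp => hlt; have {}hlt : aa s aT (p - 1) <= ar s' rs by move: hlt; case: ltnP.
  apply: wp_skip; first by lia.
  apply: fin => //; try by ssimp; lia.
  + by apply: agree_setr.
  + by ssimp; move=> q hq hle; have := hmax' q hq hle; lia.
ssimp; rewrite hp => even_p.
apply: wp_skip; first by lia.
apply: fin => //; first by lia.
move=> q hq hle; apply: hmax => //; rewrite e3 in hle; nia.
Qed.

(** Tournament sort: item [i] enters at leaf [i]; then the root is read off and its leaf reset to
    [0], again and again. The value [0] marks an empty leaf and has to lose against every item,
    which is why index [0] carries sentinel keys. *)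
Definition sort_items (better cnt : aexpr) : acmd :=
  ASeq (ASet ri (AK 1))
  (ASeq (AWhile (AB Lt (AR ri) (AB Add cnt (AK 1)))
    (ASeq (up better (AR ri) (AR ri)) (ASet ri (AB Add (AR ri) (AK 1)))))
  (ASeq (ASet rj (AK 0))
  (AWhile (AB Lt (AR rj) cnt)
    (ASeq (ASet rr (AA aT (AK 1)))
    (ASeq (ASto aORD (AR rj) (AR rr))
    (ASeq (up better (AR rr) (AK 0))
      (ASet rj (AB Add (AR rj) (AK 1))))))))).

Definition sort_cost h c := (2 * c + 2) * (up_cost h + 100).

Lemma wp_sort (le : rel nat) h (better cnt : aexpr) c s t (Q : nat -> ast -> Prop) :
  total le -> transitive le -> (forall i, 0 < i <= c -> ~~ le 0 i) ->
  (forall s', agree sregs sarrs s s' ->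
    safe W s' better /\ (ev s' better != 0) = ~~ le (ar s' rx) (ar s' ry)) ->
  acost better <= 100 ->
  (forall s', agree sregs sarrs s s' -> safe W s' cnt /\ ev s' cnt = c) ->
  acost cnt <= 20 -> c < 2 ^ h -> ar s rN = 2 ^ h -> 2 ^ h.+1 + 1 < W ->
  (forall p, 0 < p < 2 ^ h.+1 -> aa s aT p = 0) ->
  sort_cost h c <= t ->
  (forall r s' o, t - sort_cost h c <= r -> agree sregs sarrs s s' ->
     (forall p, 0 < p < 2 ^ h.+1 -> aa s' aT p = 0) ->
     perm_eq o (iota 1 c) -> pairwise le o ->
     (forall j, j < c -> aa s' aORD j = nth 0 o j) -> Q r s') ->
  wp w W (sort_items better cnt) s t Q.
Proof.
move=> tot tr le0 hb hbc hcnt hcc hch hN hNW hz ht hQ.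
have e2 : 2 ^ h.+1 = 2 * 2 ^ h by rewrite expnS.
have bsub s1 s2 : agree sregs sarrs s s1 -> agree [:: rp; rx; ry] [:: aT] s1 s2 ->
    agree sregs sarrs s s2.
  move=> a1 a2; apply: agree_trans a1 _; apply: agree_sub a2 => x; rewrite !inE.
    by move/or3P => [] ->; rewrite ?orbT.
  by move=> ->.
have hNs s1 : agree sregs sarrs s s1 -> ar s1 rN = 2 ^ h.
  by case=> h1 _; rewrite h1.
set U := up_cost h in ht hQ *.
have eC : sort_cost h c = 2 * (c * U) + 200 * c + 2 * U + 200.
  by rewrite /sort_cost -/U; nia.
have U0 : 400 <= U by rewrite /U /up_cost; lia.
apply: wp_seq; apply: (wp_set hW hW100) => //; first by side.
pose I t' s' := exists i,
  [/\ 0 < i <= c.+1, ar s' ri = i, t - sort_cost h c + ((c.+1 - i) * (U + 50) + c * (U + 100) + U + 100) <= t',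
      agree sregs sarrs s s' &
      tourney le (2 ^ h) (aa s' aT) /\
      forall q, q < 2 ^ h -> aa s' aT (2 ^ h + q) = if 0 < q < i then q else 0].
(* The tree holds exactly the items not yet extracted, and each extracted item is at least as good
   as each of these. *)
pose J t' s' := exists o,
  [/\ size o <= c, ar s' rj = size o,
      t - sort_cost h c + ((c - size o) * (U + 100) + 50) <= t',
      agree sregs sarrs s s' &
  [/\ tourney le (2 ^ h) (aa s' aT),
      forall q, q < 2 ^ h -> aa s' aT (2 ^ h + q) =
        if (0 < q <= c) && (q \notin o) then q else 0,
      forall j, j < size o -> aa s' aORD j = nth 0 o j &
  [/\ uniq o, all (fun x => 0 < x <= c) o, pairwise le o
    & forall x y, x \in o -> 0 < y <= c -> y \notin o -> le x y]]].
apply: wp_seq; apply: (wp_while hW hW100 (I := I)); last first.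
  exists 1; ssimp; split=> //.
  - have -> : c.+1 - 1 = c by lia.
    by nia.
  - by apply: agree_setr => //; apply: agree_refl.
  split=> [p hp|q hq].
    have z1 : aa s 8 (2 * p) = 0 by apply: hz; lia.
    have z2 : aa s 8 (2 * p + 1) = 0 by apply: hz; lia.
    by rewrite z1 z2 if_same hz //; lia.
  by rewrite hz ?e2; [case: ifP; lia|lia].
- move=> {}t' s' [i [hi hri htt ag [htr hlf]]].
  have [sc ec] := hcnt _ ag.
  split=> //.
  + ssimp; rewrite ec; repeat split=> //; lia.
  + by ssimp; lia.
  + ssimp; rewrite hri ec => hlt.
    have ei : i = c.+1 by move: hlt; case: ltnP => //; lia.
    have zi : c.+1 - i = 0 by lia.
    rewrite zi mul0n add0n in htt; subst i.
    apply: wp_seq; apply: (wp_set hW hW100) => //; first by side.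
    apply: (wp_while hW hW100 (I := J)); last first.
      exists [::]; ssimp; split=> //; first by rewrite subn0; lia.
        by apply: agree_setr.
      by split=> // q hq; rewrite hlf // ei in_nil andbT.
    move=> {}t1 s1 [o [hsz hrj htt1 ag1 [htr1 hlf1 hord [un al pw hle]]]].
    have [sc1 ec1] := hcnt _ ag1.
    split.
    * by ssimp.
    * have : 50 <= t1 by apply: leq_trans htt1; rewrite addnA leq_addl.
      by ssimp; lia.
    * ssimp; rewrite hrj ec1 => hge.
      have eo : size o = c by move: hge; case: ltnP => //; lia.
      have po : perm_eq o (iota 1 c).
        have sub : {subset o <= iota 1 c}.
          by move=> x /(allP al); rewrite mem_iota; lia.
        have [|_ e] := uniq_min_size un sub; first by rewrite size_iota eo.
        by apply: uniq_perm => //; rewrite iota_uniq.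
      apply: (hQ _ _ o) => //.
      - by lia.
      - apply: (tourney_zero tot tr htr1) => q hq; rewrite hlf1 //.
        case: ifP => // /andP[hq1]; rewrite (perm_mem po) mem_iota; lia.
      - by move=> j hj; apply: hord; rewrite eo.
    * ssimp; rewrite hrj ec1 => hlt1.
      have {}hlt1 : size o < c by move: hlt1; case: ltnP.
      have [hroot [q0 hq0 eq0]] := tourney_root tot tr htr1.
      have [y hy yo] : exists2 y, 0 < y <= c & y \notin o.
        have [/allP sub|] := boolP (all (mem o) (iota 1 c)).
          by have := uniq_leq_size (iota_uniq 1 c) sub; rewrite size_iota; lia.
        by case/allPn => y; rewrite mem_iota => hy yo; exists y => //; lia.
      (* Some item [y] is left and beats [0], so the root is not an empty leaf. *)
      have hrem : 0 < aa s1 8 1 <= c /\ aa s1 8 1 \notin o.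
        have : le (aa s1 8 1) y.
          have := hroot y; rewrite hlf1 ?hy ?yo /=; last by lia.
          by apply; lia.
        rewrite eq0 hlf1 //; case: ifP => [/andP[h1 h2] _ //|_].
        by move=> l; have := le0 _ hy; rewrite l.
      have hbest z : 0 < z <= c -> z \notin o -> le (aa s1 8 1) z.
        move=> hz1 hz2; have := hroot z; rewrite hlf1 ?hz1 ?hz2 /=; last by lia.
        by apply; lia.
      set x := aa s1 8 1 in hrem hbest; case: hrem => hx xo.
      have htt2 : t - sort_cost h c + ((c - (size o).+1) * (U + 100) + (U + 100) + 50) <= t1.
        by move: htt1; rewrite (_ : c - size o = (c - (size o).+1).+1) ?mulSn; lia.
      set M := (c - (size o).+1) * (U + 100) in htt2.
      apply: wp_seq; apply: (wp_set hW hW100) => //; first by side.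
      apply: wp_seq; apply: (wp_sto hW hW100) => //; first by side.
      ssimp; rewrite -/x hrj; set s2 := seta _ _ _ _.
      have ag2 : agree sregs sarrs s s2.
        by apply: agree_seta => //; apply: agree_setr.
      apply: wp_seq; apply: (@wp_up le h _ _ _ s2 0) => //.
      - by move=> s3 a3; apply: hb; apply: bsub a3.
      - by rewrite /s2; ssimp; lia.
      - by apply: hNs.
      - by lia.
      - by lia.
      move=> r s3 hr a3 htr3 hlf3.
      have ag3 := bsub _ _ ag2 a3.
      apply: (wp_set hW hW100) => //.
      - ssimp; repeat split=> //.
        by rewrite (proj1 a3) // /s2; ssimp; rewrite hrj; lia.
      - by ssimp; lia.
      ssimp; rewrite (proj1 a3) // /s2; ssimp; rewrite hrj -/s2.
      exists (rcons o x); rewrite size_rcons -/M; split=> //.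
      - by ssimp; lia.
      - by ssimp; lia.
      - by apply: agree_setr.
      split=> //.
      - move=> q hq; ssimp; rewrite hlf3 // /s2; ssimp.
        rewrite mem_rcons inE negb_or; case: eqP => [->|ne] /=; first by rewrite andbF.
        by rewrite hlf1.
      - move=> j hj; ssimp; rewrite (proj2 a3) // /s2; ssimp; rewrite nth_rcons.
        have [->|ne] := eqVneq j (size o); first by rewrite ltnn.
        have hj' : j < size o by lia.
        by rewrite hj' hord.
      split.
      - by rewrite rcons_uniq xo un.
      - by rewrite all_rcons hx al.
      - rewrite pairwise_rcons pw andbT; apply/allP => z zo; exact: hle.
      - move=> u v; rewrite !mem_rcons !inE negb_or => /orP[/eqP->|uo] hv /andP[vx vo].
          exact: hbest.
        exact: hle.
  + ssimp; rewrite hri ec => hlt.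
    have {}hlt : i < c.+1 by move: hlt; case: ltnP => //; lia.
    have htt2 : t - sort_cost h c + ((c.+1 - i.+1) * (U + 50) + (U + 50) + c * (U + 100) + U + 100) <= t'.
      by move: htt; rewrite (_ : c.+1 - i = (c.+1 - i.+1).+1) ?mulSn; lia.
    set M := (c.+1 - i.+1) * (U + 50) in htt2.
    set M' := c * (U + 100) in htt2.
    apply: wp_seq; apply: (@wp_up le h _ _ _ s' i) => //.
    * by move=> s3 a3; apply: hb; apply: bsub a3.
    * by ssimp; lia.
    * by move=> s3 a3; ssimp; rewrite (proj1 a3).
    * by apply: hNs.
    * by lia.
    * by lia.
    move=> r s3 hr a3 htr3 hlf3; ssimp.
    have ag3 := bsub _ _ ag a3.
    apply: (wp_set hW hW100) => //.
    * ssimp; repeat split=> //.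
      by rewrite (proj1 a3) // hri; lia.
    * by ssimp; lia.
    ssimp; rewrite (proj1 a3) // hri.
    exists i.+1; rewrite -/M -/M'; ssimp; split=> //.
    * by lia.
    * by lia.
    * by apply: agree_setr.
    split=> // q hq; rewrite hlf3 //; ssimp; rewrite hri hlf //.
    by case: eqP => [->|ne]; repeat case: ifP; lia.
Qed.

End Tourney.

(** * Splitting the grid into regions *)

Definition setn (f : nat -> nat) (i v : nat) : nat -> nat :=
  fun j => if j == i then v else f j.

(* Region [g] is the rectangle [[x0 g, x1 g) * [y0 g, y1 g)]. *)
Record regions := Regions {
  x0 : nat -> nat; x1 : nat -> nat; y0 : nat -> nat; y1 : nat -> nat;
  rcol : nat -> nat }.

Definition in_region (rg : regions) (g x y : nat) : bool :=
  (x0 rg g <= x < x1 rg g) && (y0 rg g <= y < y1 rg g).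

(* The rectangle of item [i] is [[ra i, rb i) * [rc i, rd i)]. *)
Record rects := Rects {
  ra : nat -> nat; rb : nat -> nat; rc : nat -> nat; rd : nat -> nat;
  icol : nat -> nat }.

Section Regions.
Variables (n : nat) (R : rects).

Definition in_rect (i x y : nat) : bool :=
  (ra R i <= x < rb R i) && (rc R i <= y < rd R i).

(* [nested_or_apart i j] holds when [i] may be inserted before [j]. *)
Definition nested_or_apart (i j : nat) : bool :=
  (rb R i <= ra R j) ||
  [&& ra R i <= ra R j, rb R j <= rb R i
    & [|| rd R j <= rc R i, rd R i <= rc R j
        | (rc R i <= rc R j) && (rd R j <= rd R i)]].

(** The condition [rb R i <= rc R i] puts the rectangle above the diagonal, which makes the two
    sides of a biclique disjoint. *)
Definition proper_rect (i : nat) : bool :=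
  [&& ra R i < rb R i, rb R i <= rc R i, rc R i < rd R i & rd R i <= n].

Definition last_col (o : seq nat) (x y : nat) : nat :=
  foldl (fun col i => if in_rect i x y then icol R i else col) 0 o.

(** Regions may be empty, so uniqueness is asked for each point. The bounds by [n] ensure that a
    nonempty region contains grid points; the colour of region [0] is recorded because that region
    is never output. *)
Definition tiles (k : nat) (o : seq nat) (rg : regions) : Prop :=
  [/\ forall x y, x < n -> y < n ->
        exists g, [/\ g <= 4 * k, in_region rg g x y, rcol rg g = last_col o x y
                    & forall g', g' <= 4 * k -> in_region rg g' x y -> g' = g],
      forall g, g <= 4 * k -> x1 rg g <= n /\ y1 rg g <= n
    & rcol rg 0 = 0].

(* Item [i], processed as turn [k], lies in region [z]. *)
Definition split_at (k i z : nat) (rg : regions) : regions :=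
  let g := 4 * k in
  let a := ra R i in let b := rb R i in let c := rc R i in let d := rd R i in
  let sets f v1 v2 v3 v4 :=
    setn (setn (setn (setn f g.+1 v1) g.+2 v2) g.+3 v3) g.+4 v4 in
  Regions
    (setn (sets (x0 rg) (x0 rg z) a a a) z b)
    (sets (x1 rg) a b b b)
    (sets (y0 rg) (y0 rg z) (y0 rg z) c d)
    (sets (y1 rg) (y1 rg z) c d (y1 rg z))
    (sets (rcol rg) (rcol rg z) (rcol rg z) (icol R i) (rcol rg z)).

Arguments split_at : simpl never.

Definition root_regions : regions :=
  Regions (fun=> 0) (setn (fun=> 0) 0 n) (fun=> 0) (setn (fun=> 0) 0 n) (fun=> 0).

Lemma tiles_root : tiles 0 [::] root_regions.
Proof.
split=> //; last by move=> [|g] //= _; rewrite /setn eqxx.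
move=> x y hx hy; exists 0; split=> //; last by move=> g'; lia.
by rewrite /in_region /= /setn eqxx; lia.
Qed.

Lemma split_old k i z rg g : g <= 4 * k -> g != z ->
  [/\ x0 (split_at k i z rg) g = x0 rg g, x1 (split_at k i z rg) g = x1 rg g,
      y0 (split_at k i z rg) g = y0 rg g, y1 (split_at k i z rg) g = y1 rg g
    & rcol (split_at k i z rg) g = rcol rg g].
Proof.
move=> hg hz; rewrite /split_at /setn /= (negbTE hz).
by do 4!(case: eqP => [?|_]; first lia).
Qed.

Lemma split_z k i z rg : z <= 4 * k ->
  [/\ x0 (split_at k i z rg) z = rb R i, x1 (split_at k i z rg) z = x1 rg z,
      y0 (split_at k i z rg) z = y0 rg z, y1 (split_at k i z rg) z = y1 rg z
    & rcol (split_at k i z rg) z = rcol rg z].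
Proof.
move=> hg; rewrite /split_at /setn /= eqxx.
by do 4!(case: eqP => [?|_]; first lia).
Qed.

Lemma split_new k i z rg j : z <= 4 * k -> j < 4 ->
  let sel := nth 0 in
  [/\ x0 (split_at k i z rg) ((4 * k).+1 + j)
      = sel [:: x0 rg z; ra R i; ra R i; ra R i] j,
      x1 (split_at k i z rg) ((4 * k).+1 + j)
      = sel [:: ra R i; rb R i; rb R i; rb R i] j,
      y0 (split_at k i z rg) ((4 * k).+1 + j)
      = sel [:: y0 rg z; y0 rg z; rc R i; rd R i] j,
      y1 (split_at k i z rg) ((4 * k).+1 + j)
      = sel [:: y1 rg z; rc R i; rd R i; y1 rg z] j
    & rcol (split_at k i z rg) ((4 * k).+1 + j)
      = sel [:: rcol rg z; rcol rg z; icol R i; rcol rg z] j].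
Proof.
move=> hz; case: j => [|[|[|[|//]]]] _ /=; rewrite /split_at /setn /=.
all: by split; repeat (case: eqP => ?); lia.
Qed.

(** The four new numbers go to the parts of region [z] to the left of the rectangle and below it, to
    the rectangle, and to the part above it. The number [z] stays with the part to the right, the
    one met by the line after the rectangle has ended. *)
Lemma tiles_split k o i z rg :
  tiles k o rg -> proper_rect i -> z <= 4 * k ->
  x0 rg z <= ra R i -> rb R i <= x1 rg z ->
  y0 rg z <= rc R i -> rd R i <= y1 rg z ->
  tiles k.+1 (rcons o i) (split_at k i z rg).
Proof.
move=> [ht hb h0] /and4P[hab hbc hcd hdn] hz hx0 hx1 hy0 hy1.
have h0' : rcol (split_at k i z rg) 0 = 0.
  have [e|ne] := eqVneq 0 z; last by have [_ _ _ _ ->] := split_old i rg (leq0n (4 * k)) ne.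
  by have [_ _ _ _] := split_z i rg hz; rewrite -e h0.
split=> // [x y hx hy|g hg]; last first.
  case: (leqP g (4 * k)) => hgk.
    have [->|ne] := eqVneq g z.
      by have [_ -> _ -> _] := split_z i rg hz; apply: hb.
    by have [_ -> _ -> _] := split_old i rg hgk ne; apply: hb.
  have hj : g - (4 * k).+1 < 4 by lia.
  have := split_new i rg hz hj; rewrite subnKC // => -[_ -> _ -> _].
  have [hb1 hb2] := hb _ hz.
  by case: (g - _) hj => [|[|[|[|//]]]] _ /=; lia.
have [g [hg hin hcol huniq]] := ht _ _ hx hy.
have lc : last_col (rcons o i) x y =
    if in_rect i x y then icol R i else last_col o x y.
  by rewrite /last_col -cats1 foldl_cat.
rewrite lc -hcol.
have cases_new g' : g' <= 4 * k.+1 ->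
    g' <= 4 * k \/ exists2 j, j < 4 & g' = (4 * k).+1 + j.
  move=> h; case: (leqP g' (4 * k)) => h'; first by left.
  by right; exists (g' - (4 * k).+1); lia.
have [gz|gz] := eqVneq g z; last first.
  have [o1 o2 o3 o4 o5] := split_old i rg hg gz.
  have nz : ~~ in_region rg z x y.
    by apply/negP => /(huniq _ hz) /eqP; rewrite eq_sym (negbTE gz).
  exists g; split; first lia.
  - by move: hin; rewrite /in_region o1 o2 o3 o4.
  - rewrite o5; case: ifP => // hi; move: nz hi; rewrite /in_region /in_rect; lia.
  - move=> g' /cases_new[hg'|[j hj ->]].
      have [->|gz'] := eqVneq g' z.
        have [q1 q2 q3 q4 _] := split_z i rg hz.
        by move: nz; rewrite /in_region q1 q2 q3 q4; lia.
      have [p1 p2 p3 p4 _] := split_old i rg hg' gz'.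
      by rewrite /in_region p1 p2 p3 p4; apply: huniq.
    have [q1 q2 q3 q4 _] := split_new i rg hz hj.
    move: nz; rewrite /in_region q1 q2 q3 q4.
    by case: j hj {q1 q2 q3 q4} => [|[|[|[|//]]]] _ /=; lia.
subst g.
have uold g' : g' <= 4 * k -> g' != z -> ~~ in_region (split_at k i z rg) g' x y.
  move=> hg' gz'; have [p1 p2 p3 p4 _] := split_old i rg hg' gz'.
  rewrite /in_region p1 p2 p3 p4.
  by apply/negP => /(huniq _ hg') /eqP; rewrite (negbTE gz').
have [q1 q2 q3 q4 q5] := split_z i rg hz.
have qn j (hj : j < 4) := split_new i rg hz hj.
have fin g : g <= 4 * k.+1 -> in_region (split_at k i z rg) g x y ->
    rcol (split_at k i z rg) g = (if in_rect i x y then icol R i else rcol rg z) ->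
    (in_region (split_at k i z rg) z x y -> g = z) ->
    (forall j, j < 4 -> in_region (split_at k i z rg) ((4 * k).+1 + j) x y ->
       g = (4 * k).+1 + j) ->
    exists g : nat, [/\ g <= 4 * k.+1, in_region (split_at k i z rg) g x y,
    rcol (split_at k i z rg) g = (if in_rect i x y then icol R i else rcol rg z)
  & forall g' : nat, g' <= 4 * k.+1 ->
      in_region (split_at k i z rg) g' x y -> g' = g].
  move=> b1 b2 b3 b4 b5; exists g; split=> // g' /cases_new[hg'|[j hj ->]].
    have [-> /b4 //|gz' h] := eqVneq g' z.
    by move: (uold _ hg' gz'); rewrite h.
  by move/(b5 _ hj).
have inr j : j < 4 -> in_region (split_at k i z rg) ((4 * k).+1 + j) x y =
   (nth 0 [:: x0 rg z; ra R i; ra R i; ra R i] j <= x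
     < nth 0 [:: ra R i; rb R i; rb R i; rb R i] j)
   && (nth 0 [:: y0 rg z; y0 rg z; rc R i; rd R i] j <= y
     < nth 0 [:: y1 rg z; rc R i; rd R i; y1 rg z] j).
  by move=> hj; have [e1 e2 e3 e4 _] := qn j hj; rewrite /in_region e1 e2 e3 e4.
have inz : in_region (split_at k i z rg) z x y =
  (rb R i <= x < x1 rg z) && (y0 rg z <= y < y1 rg z).
  by rewrite /in_region q1 q2 q3 q4.
have new j : j < 4 ->
    in_region (split_at k i z rg) ((4 * k).+1 + j) x y ->
    nth 0 [:: rcol rg z; rcol rg z; icol R i; rcol rg z] j =
      (if in_rect i x y then icol R i else rcol rg z) ->
    (forall j', j' < 4 ->
       in_region (split_at k i z rg) ((4 * k).+1 + j') x y -> j' = j) ->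
    ~~ in_region (split_at k i z rg) z x y ->
    exists g : nat, [/\ g <= 4 * k.+1, in_region (split_at k i z rg) g x y,
    rcol (split_at k i z rg) g = (if in_rect i x y then icol R i else rcol rg z)
  & forall g' : nat, g' <= 4 * k.+1 ->
      in_region (split_at k i z rg) g' x y -> g' = g].
  move=> hj b1 b2 b3 b4; apply: (fin ((4 * k).+1 + j)) => //.
  - by lia.
  - by have [_ _ _ _ ->] := qn j hj.
  - by rewrite (negbTE b4).
  - by move=> j' hj' /(b3 _ hj') ->.
have : in_region rg z x y by [].
rewrite {1}/in_region => hinz.
(* The point lies to the right of the rectangle, to its left, below it, in it, or above it. *)
case: (leqP (rb R i) x) => hxb.
  apply: (fin z) => //.
  - by lia.
  - by rewrite inz; move: hinz; lia.
  - by rewrite q5 /in_rect; case: ifP => //; lia.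
  - by move=> j hj; rewrite inr //; case: j hj => [|[|[|[|//]]]] _ /=; lia.
case: (leqP (ra R i) x) => hxa; last first.
  apply: (new 0) => //.
  - by rewrite inr //=; lia.
  - by rewrite /in_rect /=; case: ifP => //; lia.
  - by move=> j hj; rewrite inr //; case: j hj => [|[|[|[|//]]]] _ /=; lia.
  - by rewrite inz; lia.
case: (ltnP y (rc R i)) => hyc.
  apply: (new 1) => //.
  - by rewrite inr //=; lia.
  - by rewrite /in_rect /=; case: ifP => //; lia.
  - by move=> j hj; rewrite inr //; case: j hj => [|[|[|[|//]]]] _ /=; lia.
  - by rewrite inz; lia.
case: (ltnP y (rd R i)) => hyd.
  apply: (new 2) => //.
  - by rewrite inr //=; lia.
  - by rewrite /in_rect /=; case: ifP => //; lia.
  - by move=> j hj; rewrite inr //; case: j hj => [|[|[|[|//]]]] _ /=; lia.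
  - by rewrite inz; lia.
apply: (new 3) => //.
- by rewrite inr //=; lia.
- by rewrite /in_rect /=; case: ifP => //; lia.
- by move=> j hj; rewrite inr //; case: j hj => [|[|[|[|//]]]] _ /=; lia.
- by rewrite inz; lia.
Qed.


(** * The sweep line and its stack *)

Variable Ys : pred nat.

(* [before y = Some z] when, just before the item was inserted, region [z] was
   met by the sweep line and started at ordinate [y]. *)
Record frame := Frame {
  item : nat; turn : nat; home : nat; before : nat -> option nat }.

(** A position of the sweep line is described by the starts of the regions it meets: a value
    [Some z] at [y] says that region [z] begins at ordinate [y]. *)
Definition sweep := nat -> option nat.

(** Here [s] and [e] are the lower and upper ends of the home region. The part to the left is
    already behind the line. If [rc R i = s] or [rd R i = e], one part is empty: the order of the
    tests and the strict inequality keep it off the line, and a region that starts at [e] is not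
    overwritten. *)
Definition insert_item (F : sweep) k i s e : sweep :=
  fun y => if (y == rd R i) && (rd R i < e) then Some (4 * k).+4
           else if y == rc R i then Some (4 * k).+3
           else if y == s then Some (4 * k).+2 else F y.

Definition stack_end (st : seq frame) : nat :=
  if st is f :: _ then rb R (item f) else n.

Definition is_cut (st : seq frame) (e : nat) : bool :=
  (e == n) ||
  has (fun i => (e == rc R i) || (e == rd R i)) [seq item f | f <- st].

Record swept k rg (F : sweep) st t : Prop := Swept {
  swept_y : forall y z, F y = Some z ->
    [/\ z <= 4 * k, y0 rg z = y, y < y1 rg z, is_cut st (y1 rg z)
      & (y == 0) || Ys y];
  swept_x : forall y z, F y = Some z -> x0 rg z <= t /\ stack_end st <= x1 rg z;
  swept_gap : forall y z y' z', F y = Some z -> F y' = Some z' -> y < y' ->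
    y1 rg z <= y';
  swept_cover : forall y, y < n ->
    exists y' z, [/\ F y' = Some z, y' <= y & y < y1 rg z] }.

(** All snapshots are read against the current regions, and [before f] has to be correct at the
    abscissa [rb R (item f)] where it is reinstated, not where it was taken. *)
Fixpoint stacked k rg (F : sweep) (st : seq frame) (t : nat) : Prop :=
  swept k rg F st t /\
  if st is f :: st' then
    [/\ F =1 insert_item (before f) (turn f) (item f)
              (y0 rg (home f)) (y1 rg (home f)),
        before f (y0 rg (home f)) = Some (home f),
        y0 rg (home f) <= rc R (item f) /\ rd R (item f) <= y1 rg (home f),
        rb R (item f) <= stack_end st'
      & stacked k rg (before f) st' (rb R (item f))]
  else True.

Lemma stacked_swept k rg F st t : stacked k rg F st t -> swept k rg F st t.
Proof. by case: st => [|f st] []. Qed.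

Lemma swept_leq k rg F st t t' : t <= t' -> swept k rg F st t -> swept k rg F st t'.
Proof.
move=> h [hy hx hg hc]; split=> // y z /hx[h1 h2]; split=> //.
exact: leq_trans h.
Qed.

Lemma stacked_leq k rg F st t t' :
  t <= t' -> stacked k rg F st t -> stacked k rg F st t'.
Proof. by move=> h; case: st => [|f st] [/(swept_leq h) h1 h2]; split. Qed.

Lemma stacked_pop k rg F f st t :
  stacked k rg F (f :: st) t -> rb R (item f) <= t ->
  stacked k rg (before f) st t.
Proof. by case=> _ [_ _ _ _ h] hb; apply: stacked_leq h. Qed.

Definition root_sweep : sweep := fun y => if y == 0 then Some 0 else None.

Lemma stacked_root : 0 < n -> stacked 0 root_regions root_sweep [::] 0.
Proof.
move=> n0; split=> //; rewrite /root_sweep; split=> [y z|y z|y z y' z'|y hy].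
- by case: eqP => // -> [<-]; rewrite /= /setn /is_cut !eqxx.
- by case: eqP => // _ [<-]; rewrite /= /setn eqxx.
- by case: eqP => // -> _; case: eqP => // ->.
- by exists 0, 0; rewrite /= /setn eqxx.
Qed.

Lemma split_le k i z rg g : z <= 4 * k -> g <= 4 * k ->
  [/\ x0 (split_at k i z rg) g = if g == z then rb R i else x0 rg g,
      x1 (split_at k i z rg) g = x1 rg g,
      y0 (split_at k i z rg) g = y0 rg g & y1 (split_at k i z rg) g = y1 rg g].
Proof.
move=> hz hg; case: eqP => [->|/eqP ne].
  by have [? ? ? ? _] := split_z i rg hz.
by have [? ? ? ? _] := split_old i rg hg ne.
Qed.

(** Of the old regions only [z] changes, and only its left end moves, to [rb R i <= t]. Hence
    snapshots due at or after [rb R i] survive the split. *)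
Lemma swept_split k rg F st t i z : z <= 4 * k -> rb R i <= t ->
  swept k rg F st t -> swept k.+1 (split_at k i z rg) F st t.
Proof.
move=> hz ht [hy hx hg hc]; split.
- move=> y u hu; have [h1 h2 h3 h4 h5] := hy _ _ hu.
  by have [_ _ -> ->] := split_le i rg hz h1; split=> //; lia.
- move=> y u hu; have [h1 _ _ _ _] := hy _ _ hu; have [h6 h7] := hx _ _ hu.
  by have [-> -> _ _] := split_le i rg hz h1; split=> //; case: ifP.
- move=> y u y' u' hu; have [h1 _ _ _ _] := hy _ _ hu.
  by have [_ _ _ ->] := split_le i rg hz h1; apply: hg.
- move=> y /hc[y' [u [hu h1 h2]]]; have [h3 _ _ _ _] := hy _ _ hu.
  by exists y', u; have [_ _ _ ->] := split_le i rg hz h3.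
Qed.

Lemma stacked_split k rg F st t i z :
  z <= 4 * k -> rb R i <= t -> rb R i <= stack_end st ->
  stacked k rg F st t -> stacked k.+1 (split_at k i z rg) F st t.
Proof.
move=> hz; have sw F' st' t' := @swept_split k rg F' st' t' i z hz.
have sl g := @split_le k i z rg g hz.
move: (split_at k i z rg) sw sl => rg' sw sl.
elim: st F t => [|f st IH] F t ht hs [hsw hst].
  by split=> //; apply: sw.
split; first exact: sw.
case: hst => h1 h2 h3 h4 h5; have /= hs' := hs.
have hh : home f <= 4 * k.
  by have [/(_ _ _ h2)[]] := stacked_swept h5.
have [_ _ -> ->] := sl _ hh; split=> //.
by apply: IH => //; apply: leq_trans h4.
Qed.

Section Push.
Variables (k : nat) (rg : regions) (F : sweep) (st : seq frame) (t i s z : nat).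
Hypotheses (hst : stacked k rg F st t) (hti : t <= ra R i).
Hypothesis (hi : proper_rect i).
Hypothesis hpop : ra R i < stack_end st.
Hypothesis hnest : forall f, f \in [seq item f | f <- st] ->
  proper_rect f && nested_or_apart f i.
Hypothesis hYs : Ys (rc R i) && Ys (rd R i).
Hypothesis hs : s <= rc R i.
Hypothesis hF : F s = Some z.
Hypothesis hmax : forall y z', F y = Some z' -> y <= rc R i -> y <= s.

(** The top rectangle is still open at [ra R i], so it is not to the left of [i]; as it precedes
    [i], it must extend at least as far to the right. *)
Lemma push_end : rb R i <= stack_end st.
Proof.
move: hnest hpop; case: st => [|f st'] /=; first by case/and4P: hi; lia.
by move=> /(_ (item f)); rewrite inE eqxx => /(_ isT) /andP[_ /orP[|/and3P[]]]; lia.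
Qed.

(** Right ends do not decrease towards the bottom of the stack, so all stacked rectangles are open
    if the top one is. *)
Lemma stack_nested r : r \in [seq item f | f <- st] -> ra R i < rb R r.
Proof.
have := stacked_swept hst; move: hst hpop => + + _.
elim: st F t => [|f st' IH] F' t' //= [_ [_ _ _ h4 h5]] hp.
by rewrite inE => /orP[/eqP->//|]; apply: (IH _ _ h5); apply: leq_trans h4.
Qed.

Lemma push_inside :
  [/\ z <= 4 * k, x0 rg z <= ra R i, rb R i <= x1 rg z,
      y0 rg z <= rc R i & rd R i <= y1 rg z].
Proof.
have [hy hx hg hc] := stacked_swept hst.
have [hz ez _ hcut _] := hy _ _ hF; have [hx0 hx1] := hx _ _ hF.
have [hab hbc hcd hdn] := and4P hi.
have [|y' [z' [hF' hy' hyc]]] := hc (rc R i); first by lia.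
(* Of two starts on the line, the region at the smaller one ends before the larger one. So the
   region covering [rc R i] has the largest start not above it, which is [s]. *)
have hz' : z' = z.
  have := hmax hF' hy'; rewrite leq_eqVlt => /orP[/eqP ye|lt].
    by move: hF'; rewrite ye hF => -[].
  by have := hg _ _ _ _ hF' hF lt; lia.
subst z'; split=> //; rewrite ?ez //.
- exact: leq_trans hti.
- exact: leq_trans push_end hx1.
(* The upper end of [z] is a side of an open rectangle [f]. As [f] contains [i] or is vertically
   apart from it, and this side lies above [rc R i], it is not below [rd R i]. *)
- case/orP: hcut => [/eqP->//|/hasP[f fi hf]].
  have := hnest fi; have := stack_nested fi.
  by rewrite /nested_or_apart /proper_rect; move: hf hyc; lia.
Qed.

(** The old line [F] becomes a snapshot due at [rb R i]: after the split, [z] denotes the part of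
    the home region from that abscissa on. *)
Lemma stacked_push :
  stacked k.+1 (split_at k i z rg) (insert_item F k i s (y1 rg z))
    (Frame i k z F :: st) (ra R i).
Proof.
have [hz hx0 hx1 hy0 hy1] := push_inside.
have [hab hbc hcd hdn] := and4P hi.
have hend := push_end.
have [hy hx hg hc] := stacked_swept hst.
have [_ ez hse hcut hss] := hy _ _ hF.
have hold y u : F y = Some u -> y != s -> u <= 4 * k /\ u != z.
  move=> hu ys; have [h1 h2 _ _ _] := hy _ _ hu; split=> //.
  by apply: contra ys => /eqP uz; rewrite -h2 uz ez.
have new j (hj : j < 4) := split_new i rg hz hj.
have N1 := new 1 isT; have N2 := new 2 isT; have N3 := new 3 isT.
rewrite addn1 in N1; rewrite addn2 in N2; rewrite addn3 in N3.
case: N1 N2 N3 => [p1 p2 p3 p4 _] [q1 q2 q3 q4 _] [r1 r2 r3 r4 _].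
have sl g := @split_le k i z rg g hz.
have hst' : stacked k.+1 (split_at k i z rg) F st (rb R i).
  by apply: stacked_split => //; apply: stacked_leq hst; lia.
move: (split_at k i z rg) {new} sl hst' p1 p2 p3 p4 q1 q2 q3 q4 r1 r2 r3 r4.
move=> rg' sl hst' p1 p2 p3 p4 q1 q2 q3 q4 r1 r2 r3 r4.
have [_ _ sy0 sy1] := sl _ hz.
(* An entry of the new line is one of the three new parts, or an old region that starts outside the
   home region. *)
have insP y u : insert_item F k i s (y1 rg z) y = Some u ->
  [\/ [/\ y = rd R i, rd R i < y1 rg z & u = (4 * k).+4],
      y = rc R i /\ u = (4 * k).+3,
      [/\ y = s, s < rc R i & u = (4 * k).+2]
    | [/\ y != s, F y = Some u & (y < s) || (y1 rg z <= y)]].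
  rewrite /insert_item; case: ifP => [/andP[/eqP-> h]|_]; first by case; constructor 1.
  case: eqP => [->|/eqP nc]; first by case; constructor 2.
  case: eqP => [e|/eqP ns]; first by subst y; case=> <-; constructor 3; split=> //; lia.
  move=> hu; constructor 4; split=> //.
  by case: (ltngtP y s) ns => //= lt _; apply: (hg _ _ _ _ hF hu).
split; last first.
  by split; rewrite /= ?sy0 ?sy1 ?ez.
split.
- move=> y u /insP[[-> h ->]|[-> ->]|[-> h ->]|[ns hu h]].
  + rewrite r3 r4; split=> //; first lia.
      by move: hcut; rewrite /is_cut /=; case: (_ == n) => //= ->; rewrite orbT.
    by case/andP: hYs => _ ->; rewrite orbT.
  + rewrite q3 q4; split=> //; first lia.
      by rewrite /is_cut /= eqxx !orbT.
    by case/andP: hYs => -> _; rewrite orbT.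
  + rewrite p3 p4 ez; split=> //; first lia.
    by rewrite /is_cut /= eqxx !orbT.
  + have [h1 h2] := hold _ _ hu ns; have [_ b2 b3 b4 b5] := hy _ _ hu.
    have [_ _ -> ->] := sl _ h1; split=> //; first lia.
    by move: b4; rewrite /is_cut /=; case: (_ == n) => //= ->; rewrite orbT.
- move=> y u /insP[[_ h ->]|[_ ->]|[_ h ->]|[ns hu h]] /=.
  + by rewrite r1 r2.
  + by rewrite q1 q2.
  + by rewrite p1 p2.
  + have [h1 h2] := hold _ _ hu ns; have [b1 b2] := hx _ _ hu.
    have [-> -> _ _] := sl _ h1; rewrite (negbTE h2); lia.
- move=> y u y' u' hu hu' lt.
  (* The second component saves the gap property of [F] for the case that both entries are old. *)
  have {hu'} hy' : [\/ y' = rd R i /\ rd R i < y1 rg z, y' = rc R i, y' = s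
                    | y' < s \/ y1 rg z <= y' ] /\
    (forall v, F y = Some v -> y < s \/ y1 rg z <= y -> 
       y' < s \/ y1 rg z <= y' -> y1 rg v <= y').
    case/insP: hu' => [[-> h _]|[-> _]|[-> h _]|[ns' hu' h']]; split.
    + by constructor 1.
    + by move=> v _ _; lia.
    + by constructor 2.
    + by move=> v _ _; lia.
    + by constructor 3.
    + by move=> v _ _; lia.
    + by constructor 4; case/orP: h'; [left|right].
    + by move=> v hv _ _; apply: (hg _ _ _ _ hv hu' lt).
  case: hy' => hy' hyF.
  case/insP: hu => [[e h ->]|[e ->]|[e h ->]|[ns hu h]]; rewrite ?r4 ?q4 ?p4 /=.
  + by case: hy'; lia.
  + by case: hy'; lia.
  + by case: hy'; lia.
  + have [h1 h2] := hold _ _ hu ns.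
    have [_ _ _ ->] := sl _ h1.
    have ys : y < s -> y1 rg u <= s by move=> l; apply: (hg _ _ _ _ hu hF l).
    case: hy' => [||| hy']; try lia.
    by apply: hyF => //; case/orP: h; [left|right].
- move=> y /hc[y' [u [hu hy' hyu]]].
  have [ys|ns] := eqVneq y' s.
    have uz : u = z by move: hu; rewrite ys hF => -[].
    subst u y'; case: (ltnP y (rc R i)) => h1.
      exists s, (4 * k).+2; rewrite p4; split=> //.
      rewrite /insert_item eqxx; case: ifP => [|_]; first lia.
      by case: eqP => // e; lia.
    case: (ltnP y (rd R i)) => h2.
      exists (rc R i), (4 * k).+3; rewrite q4; split=> //.
      by rewrite /insert_item eqxx; case: ifP => [|_]; first lia.
    exists (rd R i), (4 * k).+4; rewrite r4; split=> //.
    by rewrite /insert_item eqxx; case: ifP => //; lia.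
  exists y', u; have [h1 h2] := hold _ _ hu ns.
  have [_ _ _ ->] := sl _ h1; split=> //.
  have b1 : y' < s -> y1 rg u <= s by move=> l; apply: (hg _ _ _ _ hu hF l).
  have b2 : s < y' -> y1 rg z <= y' by move=> l; apply: (hg _ _ _ _ hF hu l).
  rewrite /insert_item (negbTE ns).
  case: ifP => [|_]; first lia.
  by case: eqP => // e; lia.
Qed.

End Push.

End Regions.

(** * Leaf intervals *)

Section LeafIntervals.
Variable V : eqType.
Implicit Types (T l r : bintree V) (p q : seq bool).

(* The leaves below [p] have the ranks from [start T p] to [stop T p - 1]. *)
Fixpoint start T p : nat :=
  match T, p with
  | Node l r, b :: p' => if b then size (leaves l) + start r p' else start l p'
  | _, _ => 0
  end.

Definition stop T p : nat := start T p + size (leaves (subtree T p)).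

Lemma leaves_gt0 T : 0 < size (leaves T).
Proof. by elim: T => //= l hl r _; rewrite size_cat; lia. Qed.

Lemma nil_nodes T : [::] \in nodes T.
Proof. by case: T => *; rewrite inE. Qed.

Lemma cons_nodes b p l r :
  (b :: p \in nodes (Node l r)) = (p \in nodes (if b then r else l)).
Proof.
have inj c : injective (cons c : seq bool -> seq bool) by move=> x y [].
rewrite /= inE /= mem_cat; case: b.
  by rewrite (mem_map (inj true)); case: mapP => // -[x _ []].
by rewrite (mem_map (inj false)); case: (X in _ || X) / mapP => [[x _ []]|_] //; rewrite orbF.
Qed.

Lemma start_lt_stop T p : start T p < stop T p.
Proof. by rewrite /stop; have := leaves_gt0 (subtree T p); lia. Qed.

Lemma stop_le T p : stop T p <= size (leaves T).
Proof.
rewrite /stop; elim: T p => [x|l hl r hr] [|b p] //=.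
rewrite size_cat; case: b => /=; first by have := hr p; lia.
by have := hl p; lia.
Qed.

Lemma stop_nil T : stop T [::] = size (leaves T).
Proof. by case: T. Qed.

Lemma stop_cons l r b p : stop (Node l r) (b :: p) =
  if b then size (leaves l) + stop r p else stop l p.
Proof. by rewrite /stop /=; case: b; lia. Qed.

Lemma start_stop_sub T p q : q \in nodes T -> prefix p q ->
  start T p <= start T q /\ stop T q <= stop T p.
Proof.
elim: T p q => [x|l hl r hr] p q; first by rewrite inE => /eqP->; case: p => [|b p] //=.
case: p q => [|b p] [|c q] //.
  by move=> _ _; split=> //; rewrite stop_nil; apply: stop_le.
rewrite cons_nodes prefix_cons !stop_cons => hq /andP[/eqP e hp] /=; subst c.
case: b hq => hq; last exact: (hl p q hq hp).
by have [] := hr p q hq hp; lia.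
Qed.

Lemma start_stop_disjoint T p q : p \in nodes T -> q \in nodes T ->
  ~~ prefix p q -> ~~ prefix q p -> stop T p <= start T q \/ stop T q <= start T p.
Proof.
elim: T p q => [x|l hl r hr] p q; first by rewrite !inE => /eqP-> /eqP->.
case: p q => [|b p] [|c q] //; rewrite !cons_nodes !prefix_cons !stop_cons /=.
case: b c => [] [] /= hp hq h1 h2.
- by case: (hr p q hp hq h1 h2); [left|right]; lia.
- by right; have := stop_le l q; lia.
- by left; have := stop_le l p; lia.
- exact: hl.
Qed.

(** Every inner node has two children, each with at least one leaf, so a proper descendant has
    strictly fewer leaves. Thus a node is determined by its interval. *)
Lemma start_stop_proper T p q : q \in nodes T -> prefix p q -> p != q ->
  stop T q - start T q < stop T p - start T p.
Proof.
elim: T p q => [x|l hl r hr] p q; first by rewrite inE => /eqP->; case: p => [|b p] //=.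
case: p q => [|b p] [|c q] //.
  move=> _ _ _; rewrite stop_cons stop_nil /= size_cat.
  case: c; first by have := leaves_gt0 l; have := stop_le r q; lia.
  by have := leaves_gt0 r; have := stop_le l q; lia.
rewrite cons_nodes prefix_cons !stop_cons => hq /andP[/eqP e hp] ne /=; subst c.
have {}ne : p != q by apply: contra ne => /eqP->.
case: b hq => hq; last exact: (hl p q hq hp ne).
by have := hr p q hq hp ne; lia.
Qed.

Lemma leftmost_leaves T : leftmost T \in leaves T.
Proof. by elim: T => [x|l hl r _] /=; rewrite ?inE // mem_cat hl. Qed.

Lemma rightmost_leaves T : rightmost T \in leaves T.
Proof. by elim: T => [x|l _ r hr] /=; rewrite ?inE // mem_cat hr orbT. Qed.

Lemma subtree_leaves T p : {subset leaves (subtree T p) <= leaves T}.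
Proof.
elim: T p => [x|l hl r hr] [|[] p] //= x; rewrite mem_cat.
  by move/hr->; rewrite orbT.
by move/hl->.
Qed.

Lemma index_leftmost T : index (leftmost T) (leaves T) = 0.
Proof.
elim: T => [x|l hl r _] /=; first by rewrite eqxx.
by rewrite index_cat leftmost_leaves hl.
Qed.

Lemma index_rightmost T : uniq (leaves T) ->
  index (rightmost T) (leaves T) = (size (leaves T)).-1.
Proof.
elim: T => [x|l _ r hr] /=; first by rewrite eqxx.
rewrite cat_uniq => /and3P[_ /hasPn hlr ur].
rewrite index_cat (negbTE (hlr _ (rightmost_leaves r))) hr // size_cat.
by have := leaves_gt0 r; lia.
Qed.

Lemma index_start T p : uniq (leaves T) -> p \in nodes T ->
  index (leftmost (subtree T p)) (leaves T) = start T p.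
Proof.
elim: T p => [x|l hl r hr] [|b p] //; try by rewrite ?inE // index_leftmost.
rewrite cons_nodes /= cat_uniq => /and3P[ul /hasPn hlr ur].
case: b => /= hp; rewrite index_cat; last first.
  by rewrite (subtree_leaves (leftmost_leaves _)) hl.
by rewrite (negbTE (hlr _ (subtree_leaves (leftmost_leaves _)))) hr.
Qed.

Lemma index_stop T p : uniq (leaves T) -> p \in nodes T ->
  (index (rightmost (subtree T p)) (leaves T)).+1 = stop T p.
Proof.
elim: T p => [x|l hl r hr] [|b p] //; try by rewrite ?inE // => u _;
  rewrite index_rightmost // prednK ?leaves_gt0 // /stop add0n.
rewrite cons_nodes /= cat_uniq stop_cons => /and3P[ul /hasPn hlr ur].
case: b => /= hp; rewrite index_cat; last first.
  by rewrite (subtree_leaves (rightmost_leaves _)) hl.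
by rewrite (negbTE (hlr _ (subtree_leaves (rightmost_leaves _)))) -addnS hr.
Qed.

Lemma leaf_node T x : x \in leaves T ->
  exists2 p, p \in nodes T & subtree T p = Leaf x.
Proof.
elim: T => [y|l hl r hr] /=; first by rewrite inE => /eqP->; exists [::].
rewrite mem_cat => /orP[/hl|/hr] [p hp e].
  by exists (false :: p); rewrite // cons_nodes.
by exists (true :: p); rewrite // cons_nodes.
Qed.

Lemma leaf_interval T p x : uniq (leaves T) -> p \in nodes T ->
  subtree T p = Leaf x -> start T p = index x (leaves T) /\ stop T p = (start T p).+1.
Proof.
move=> u hp e; split; first by rewrite -index_start // e.
by rewrite /stop e addn1.
Qed.

(** The interval of the leaf [q] has length one and meets that of [p], so [q] is neither a proper
    ancestor of [p] nor incomparable to it. *)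
Lemma prefix_leaf T p q x : p \in nodes T -> q \in nodes T -> subtree T q = Leaf x ->
  start T p <= start T q < stop T p -> prefix p q.
Proof.
move=> hp hq e hs; apply: contraT => npq.
have sq : stop T q = (start T q).+1 by rewrite /stop e addn1.
have [qp|nqp] := boolP (prefix q p).
  have ne : q != p by apply: contra npq => /eqP->; apply: prefix_refl.
  have := start_stop_proper hp qp ne; have := start_lt_stop T p; lia.
by have := start_stop_disjoint hp hq npq nqp; lia.
Qed.

End LeafIntervals.

(** * The program *)

Notation qm := 11 (only parsing).
Notation qn := 12 (only parsing).
Notation qmA := 13 (only parsing).
Notation qNB := 14 (only parsing).
Notation qPB := 15 (only parsing).
Notation qk := 16 (only parsing).
Notation qsp := 17 (only parsing).
Notation qa := 18 (only parsing).
Notation qb := 19 (only parsing).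
Notation qc := 20 (only parsing).
Notation qd := 21 (only parsing).
Notation qz := 23 (only parsing).
Notation qg := 24 (only parsing).
Notation qi := 25 (only parsing).
Notation qe := 26 (only parsing).
Notation qu := 27 (only parsing).
Notation qv := 28 (only parsing).
Notation qw := 29 (only parsing).
Notation qcnt := 1 (only parsing).

Notation aIN := 0 (only parsing).
Notation aOUT := 1 (only parsing).
Notation aKA := 2 (only parsing).
Notation aKB := 3 (only parsing).
Notation aKC := 4 (only parsing).
Notation aKD := 5 (only parsing).
Notation aCOL := 6 (only parsing).
Notation aY := 7 (only parsing).
Notation aPOS := 9 (only parsing).
Notation aAT := 10 (only parsing).
Notation aST := 12 (only parsing).
Notation aSZ := 13 (only parsing).
Notation aX0 := 14 (only parsing).
Notation aX1 := 15 (only parsing).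
Notation aY0 := 16 (only parsing).
Notation aY1 := 17 (only parsing).
Notation aRC := 18 (only parsing).

Infix ";;" := ASeq (at level 60, right associativity).
Notation "a +^ b" := (AB Add a b) (at level 50, left associativity).
Notation "a *^ b" := (AB Mul a b) (at level 40, left associativity).
Notation "a -^ b" := (AB Defs.Sub a b) (at level 50, left associativity).
Notation "a <^ b" := (AB Lt a b) (at level 70).
Notation "a =^ b" := (AB Eq a b) (at level 70).

(** Index [0] is a sentinel: its keys [n] and [n + 1] lose every comparison in the two sorts, and as
    the bottom of the stack it has right end [n]. Region [0] is set up as the whole grid. *)
Definition load_header : acmd :=
  ASet qn (AA aIN (AK 0)) ;;
  ASet qmA (AA aIN (AK 2)) ;;
  ASet qm (AR qmA +^ AA aIN (AK 3)) ;;
  ASet qNB (AK 4 +^ AR qn) ;;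
  ASet qPB (AR qNB +^ AK 5 *^ AA aIN (AK 1)) ;;
  ASto aKA (AK 0) (AR qn) ;;
  ASto aKB (AK 0) (AR qn) ;;
  ASto aY (AK 0) (AR qn +^ AK 1) ;;
  ASto aX1 (AK 0) (AR qn) ;;
  ASto aY1 (AK 0) (AR qn) ;;
  ASet ri (AK 1).

(** Fields [3] and [4] of a node record are inclusive leaf ranks; adding [1] to the latter gives
    half-open intervals. The ends of the pair are exchanged unless they are listed from left to
    right. *)
Definition load_rect : acmd :=
  ASet qu (AA aIN (AR qPB +^ AK 2 *^ (AR ri -^ AK 1))) ;;
  ASet qv (AA aIN (AR qPB +^ AK 2 *^ (AR ri -^ AK 1) +^ AK 1)) ;;
  ASet qu (AR qNB +^ AK 5 *^ AR qu) ;;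
  ASet qv (AR qNB +^ AK 5 *^ AR qv) ;;
  AIf (AA aIN (AR qu +^ AK 4) <^ AA aIN (AR qv +^ AK 3))
    ASkip
    (ASet qw (AR qu) ;; ASet qu (AR qv) ;; ASet qv (AR qw)) ;;
  ASto aKA (AR ri) (AA aIN (AR qu +^ AK 3)) ;;
  ASto aKB (AR ri) (AA aIN (AR qu +^ AK 4) +^ AK 1) ;;
  ASto aKC (AR ri) (AA aIN (AR qv +^ AK 3)) ;;
  ASto aKD (AR ri) (AA aIN (AR qv +^ AK 4) +^ AK 1) ;;
  ASto aCOL (AR ri) (AR qmA <^ AR ri) ;;
  ASto aY (AR ri) (AA aKC (AR ri)) ;;
  ASto aY (AR qm +^ AR ri) (AA aKD (AR ri)) ;;
  ASet ri (AR ri +^ AK 1).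

Definition load_rects : acmd :=
  load_header ;; AWhile (AR ri <^ AR qm +^ AK 1) load_rect.

Definition make_size : acmd :=
  ASet rN (AK 1) ;;
  AWhile (AR rN <^ AK 2 *^ AR qm +^ AK 1) (ASet rN (AK 2 *^ AR rN)).

Definition better_y : aexpr := AA aY (AR ry) <^ AA aY (AR rx).

(** Coordinate compression. Ranks are counted from [1], and for equal ordinates the last rank
    overwrites the others. *)
Definition make_positions : acmd :=
  sort_items better_y (AK 2 *^ AR qm) ;;
  ASet rj (AK 0) ;;
  AWhile (AR rj <^ AK 2 *^ AR qm)
    (ASto aPOS (AA aY (AA aORD (AR rj))) (AR rj +^ AK 1) ;;
     ASet rj (AR rj +^ AK 1)).

(* Lexicographically: [a] increasing, then [b] decreasing, then [d - c]
   decreasing, so that a rectangle comes after those that contain it. *)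
Definition better_x : aexpr :=
  (AA aKA (AR ry) <^ AA aKA (AR rx)) +^
  (AA aKA (AR ry) =^ AA aKA (AR rx)) *^
  ((AA aKB (AR rx) <^ AA aKB (AR ry)) +^
   (AA aKB (AR rx) =^ AA aKB (AR ry)) *^
   ((AA aKD (AR rx) -^ AA aKC (AR rx)) <^ (AA aKD (AR ry) -^ AA aKC (AR ry)))).

Definition lex_le (a b c d : nat -> nat) : rel nat := fun i j =>
  (a i < a j) || (a i == a j) &&
    ((b j < b i) || (b i == b j) && (d j - c j <= d i - c i)).

Lemma lex_le_total a b c d : total (lex_le a b c d).
Proof. by move=> i j; rewrite /lex_le; lia. Qed.

Lemma lex_le_trans a b c d : transitive (lex_le a b c d).
Proof. by move=> i j k; rewrite /lex_le; lia. Qed.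

(** In [better_x], sums stand for disjunctions and products for conjunctions. *)
Lemma lex_value (b1 b2 b3 b4 b5 : bool) :
  (b1 + b2 * (b3 + b4 * b5) != 0) = b1 || b2 && (b3 || b4 && b5).
Proof. by case: b1; case: b2; case: b3; case: b4; case: b5. Qed.

(** * Loading the rectangles, ranking the ordinates, ordering the items *)

Section Program.
Variables (w W : nat).
Hypothesis hW : num_arrays * W <= 2 ^ w.
Hypothesis hW100 : 100 < W.
Variables (n m mA nn : nat) (I : nat -> nat) (R : rects).
Hypothesis hWn : 20 * n + 40 * m + 80 <= W.
Hypothesis hIpb : 4 + n + 5 * nn + 2 * m < W.
Hypothesis hmA : mA <= m.

Definition leaf_bounds p q :=
  (I (4 + n + 5 * p + 3), I (4 + n + 5 * p + 4),
   I (4 + n + 5 * q + 3), I (4 + n + 5 * q + 4)).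

Definition rect_is i (b : nat * nat * nat * nat) : Prop :=
  let '(la, lb, lc, ld) := b in
  [/\ ra R i = la, rb R i = lb.+1, rc R i = lc & rd R i = ld.+1].

Definition input_rect i : Prop :=
  let p := I (4 + n + 5 * nn + 2 * (i - 1)) in
  let q := I (4 + n + 5 * nn + 2 * (i - 1) + 1) in
  [/\ 4 + n + 5 * p + 4 < W, 4 + n + 5 * q + 4 < W,
      I (4 + n + 5 * p + 4) < I (4 + n + 5 * q + 3) ->
        rect_is i (leaf_bounds p q),
      ~~ (I (4 + n + 5 * p + 4) < I (4 + n + 5 * q + 3)) ->
        rect_is i (leaf_bounds q p)
    & icol R i = (mA < i)].

Hypothesis hinput : forall i, 0 < i <= m -> input_rect i.
Hypothesis hproper : forall i, 0 < i <= m -> proper_rect n R i.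

Definition rect_keys (i : nat) s : Prop :=
  [/\ aa s aKA i = ra R i, aa s aKB i = rb R i, aa s aKC i = rc R i,
      aa s aKD i = rd R i & aa s aCOL i = icol R i].

Record keys s : Prop := Keys {
  keys_m : ar s qm = m;
  keys_n : ar s qn = n;
  keys_0 : aa s aKA 0 = n /\ aa s aKB 0 = n;
  keys_rect : forall i, 0 < i <= m -> rect_keys i s }.

Definition ykeys s : Prop :=
  aa s aY 0 = n.+1 /\
  forall i, 0 < i <= m -> aa s aY i = rc R i /\ aa s aY (m + i) = rd R i.

Definition lregs := [:: qn; qmA; qm; qNB; qPB; ri; qu; qv; qw].
Definition larrs := [:: aKA; aKB; aKC; aKD; aCOL; aY; aX1; aY1].
Definition load_cost := 500 * m.+1.

Lemma wp_load_rects s t (Q : nat -> ast -> Prop) :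
  [/\ aa s aIN 0 = n, aa s aIN 1 = nn, aa s aIN 2 = mA & aa s aIN 3 = m - mA] ->
  (forall i, aa s aIN i = I i) -> load_cost <= t ->
  (forall r s', t - load_cost <= r -> agree lregs larrs s s' ->
     keys s' -> ykeys s' ->
     (forall g, aa s' aX1 g = if g == 0 then n else aa s aX1 g) ->
     (forall g, aa s' aY1 g = if g == 0 then n else aa s aY1 g) -> Q r s') ->
  wp w W load_rects s t Q.
Proof.
move=> [h0 h1 h2 h3] hIN ht hQ.
have eC : load_cost = 500 * m.+1 by [].
rewrite /load_rects /load_header.
apply: wp_seq.
do 2!(apply: wp_seq; apply: (wp_set hW hW100) => //; first by side).
apply: wp_seq; apply: (wp_set hW hW100) => //.
- by ssimp; rewrite h2 h3; repeat split; lia.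
- by side.
apply: wp_seq; apply: (wp_set hW hW100) => //.
- by ssimp; rewrite h0; repeat split; lia.
- by side.
apply: wp_seq; apply: (wp_set hW hW100) => //.
- by ssimp; rewrite h0 h1; repeat split; lia.
- by side.
do 2!(apply: wp_seq; apply: (wp_sto hW hW100) => //; first by side).
apply: wp_seq; apply: (wp_sto hW hW100) => //.
- by ssimp; rewrite h0; repeat split; lia.
- by side.
do 2!(apply: wp_seq; apply: (wp_sto hW hW100) => //; first by side).
apply: (wp_set hW hW100) => //; first by side.
ssimp; rewrite h0 h1 h2 h3.
set s1 := setr _ ri 1.
have emm : mA + (m - mA) = m by lia.
pose J t' s' := exists i,
  [/\ 0 < i <= m.+1, ar s' ri = i,
      t - load_cost + 400 * (m.+1 - i) + 20 <= t', agree lregs larrs s s' &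
  [/\ [/\ ar s' qm = m, ar s' qn = n, ar s' qmA = mA, ar s' qNB = 4 + n
        & ar s' qPB = 4 + n + 5 * nn],
      [/\ aa s' aKA 0 = n, aa s' aKB 0 = n & aa s' aY 0 = n.+1],
      forall g, aa s' aX1 g = if g == 0 then n else aa s aX1 g,
      forall g, aa s' aY1 g = if g == 0 then n else aa s aY1 g
    & forall j, 0 < j < i -> rect_keys j s' /\
        (aa s' aY j = rc R j /\ aa s' aY (m + j) = rd R j)]].
apply: (wp_while hW hW100 (I := J)); last first.
  exists 1; rewrite /s1; ssimp; split=> //.
  - by lia.
  - by repeat first [apply: agree_setr => // | apply: agree_seta => //].
  by split=> //; [rewrite eqxx addn1|move=> j; lia].
move=> {}t' s' [i [hi hri htt ag [[em en emA eNB ePB] [e0 e0' eY] hX hY hk]]].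
split.
- by ssimp; rewrite em; repeat split; lia.
- by ssimp; lia.
- ssimp; rewrite hri em => hge.
  have ei : i = m.+1 by move: hge; case: ltnP => //; lia.
  apply: hQ => //.
  + by lia.
  + by split=> // j hj; case: (hk j) => //; lia.
  + by split=> // j hj; case: (hk j) => //; lia.
ssimp; rewrite hri em => hlt; have {}hlt : i < m.+1 by move: hlt; case: ltnP; lia.
have IN' j : aa s' 0 j = I j by rewrite (proj2 ag).
have him : 0 < i <= m by lia.
have [pW qW Hlt Hge Hcol] := hinput him.
set p := I (4 + n + 5 * nn + 2 * (i - 1)) in pW qW Hlt Hge.
set q := I (4 + n + 5 * nn + 2 * (i - 1) + 1) in pW qW Hlt Hge.
have [pr1 pr2 pr3 pr4] := and4P (hproper him).
have fin u v r s2 : agree lregs larrs s' s2 -> (forall j, j \notin [:: qu; qv; qw] -> ar s2 j = ar s' j) ->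
   (forall j k, aa s2 j k = aa s' j k) -> 4 + n + 5 * u + 4 < W -> 4 + n + 5 * v + 4 < W ->
   ar s2 qu = 4 + n + 5 * u -> ar s2 qv = 4 + n + 5 * v -> rect_is i (leaf_bounds u v) ->
   t - load_cost + 400 * (m.+1 - i.+1) + 250 <= r ->
   wp w W
  (ASto 2 (AR 8) (AA 0 (AR 27 +^ AK 3));;
   ASto 3 (AR 8) (AA 0 (AR 27 +^ AK 4) +^ AK 1);;
   ASto 4 (AR 8) (AA 0 (AR 28 +^ AK 3));;
   ASto 5 (AR 8) (AA 0 (AR 28 +^ AK 4) +^ AK 1);;
   ASto 6 (AR 8) (AR 13 <^ AR 8);;
   ASto 7 (AR 8) (AA 4 (AR 8));;
   ASto 7 (AR 11 +^ AR 8) (AA 5 (AR 8));; ASet 8 (AR 8 +^ AK 1)) s2 r J.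
  move=> ag2 r2 a2 uW vW eu evv [Ea Eb Ec Ed] htr.
  have ag2' := agree_trans ag ag2.
  have IN2 j : aa s2 0 j = I j by rewrite a2.
  apply: wp_seq; apply: (wp_sto hW hW100) => //.
  - by ssimp; rewrite eu; repeat split; lia.
  - by side.
  apply: wp_seq; apply: (wp_sto hW hW100) => //.
  - by ssimp; rewrite eu IN2; repeat split; lia.
  - by side.
  apply: wp_seq; apply: (wp_sto hW hW100) => //.
  - by ssimp; rewrite evv; repeat split; lia.
  - by side.
  apply: wp_seq; apply: (wp_sto hW hW100) => //.
  - by ssimp; rewrite evv IN2; repeat split; lia.
  - by side.
  do 2!(apply: wp_seq; apply: (wp_sto hW hW100) => //; first by side).
  apply: wp_seq; apply: (wp_sto hW hW100) => //.
  - by ssimp; rewrite !r2 // em hri; repeat split; lia.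
  - by side.
  apply: (wp_set hW hW100) => //.
  - by ssimp; rewrite r2 // hri; repeat split; lia.
  - by side.
  ssimp; rewrite eu evv !IN2 !r2 // hri em emA eqxx -Ea -Ec !addn1 -Eb -Ed.
  exists i.+1; ssimp; split=> //.
  - by lia.
  - by repeat first [apply: agree_setr => // | apply: agree_seta => //].
  have i0 : (0 == i) = false by apply/eqP; lia.
  have mi0 : (0 == m + i) = false by apply/eqP; lia.
  rewrite i0 mi0 !a2 !r2 //.
  split=> //.
  - by move=> g; rewrite a2.
  - by move=> g; rewrite a2.
  move=> j hj; rewrite /rect_keys; ssimp.
  have n1 : (j == m + i) = false by apply/eqP; lia.
  have n2 : (m + j == i) = false by apply/eqP; lia.
  rewrite n1 n2 eqn_add2l !a2 /=.
  have [->|ne] := eqVneq j i; first by split=> //; split=> //; rewrite Hcol.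
  have [|[k1 k2 k3 k4 k5] [k6 k7]] := hk j; first by lia.
  by [].
have e1 : ar s' qPB + 2 * (ar s' ri - 1) = 4 + n + 5 * nn + 2 * (i - 1).
  by rewrite ePB hri.
rewrite /load_rect.
have htt2 : t - load_cost + 400 * (m.+1 - i.+1) + 420 <= t' by lia.
apply: wp_seq; apply: (wp_set hW hW100) => //.
- by ssimp; rewrite e1 hri; repeat split; lia.
- by side.
apply: wp_seq; apply: (wp_set hW hW100) => //.
- by ssimp; rewrite e1 hri; repeat split; lia.
- by side.
ssimp; rewrite e1 !IN' -/p -/q.
apply: wp_seq; apply: (wp_set hW hW100) => //.
- by ssimp; rewrite eNB; repeat split; lia.
- by side.
ssimp; rewrite eNB.
apply: wp_seq; apply: (wp_set hW hW100) => //.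
- by ssimp; rewrite eNB; repeat split; lia.
- by side.
ssimp; rewrite eNB; set s2 := setr _ qv _.
apply: wp_seq; apply: (wp_if hW hW100) => //.
- by rewrite /s2; ssimp; repeat split; lia.
- by side.
- rewrite /s2; ssimp; rewrite !IN' => lt; apply: wp_skip; first by lia.
  apply: (fin p q) => //.
  + by repeat first [apply: agree_setr => // | apply: agree_seta => //].
  + by move=> j; rewrite !inE; ssimp; case: j => //; do 29!case=> //.
  + by apply: Hlt; move: lt; case: ltnP.
  + by lia.
rewrite /s2; ssimp; rewrite !IN' => nlt.
do 2!(apply: wp_seq; apply: (wp_set hW hW100) => //; first by side).
apply: (wp_set hW hW100) => //; first by side.
apply: (fin q p) => //.
- by repeat first [apply: agree_setr => // | apply: agree_seta => //].
- by move=> j; rewrite !inE; ssimp; case: j => //; do 29!case=> //.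
- by apply: Hge; move: nlt; case: ltnP.
- by ssimp; lia.
Qed.

(** Doubling stops at the first power of two above [2 * m]. The bound [4 * m + 1] instead of [4 * m]
    accommodates [m = 0], where the power is [1]. *)
Lemma wp_make_size s t (Q : nat -> ast -> Prop) :
  ar s qm = m -> 40 * (trunc_log 2 m + 4) <= t ->
  (forall r s' h, t - 40 * (trunc_log 2 m + 4) <= r -> agree [:: rN] [::] s s' ->
     ar s' rN = 2 ^ h -> h <= trunc_log 2 m + 2 -> 2 * m < 2 ^ h ->
     2 ^ h <= 4 * m + 1 -> Q r s') ->
  wp w W make_size s t Q.
Proof.
clear hIpb hmA hinput.
move=> em ht hQ; set L := trunc_log 2 m in ht hQ *.
apply: wp_seq; apply: (wp_set hW hW100) => //; first by side.
ssimp.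
pose J t' s' := exists j, [/\ ar s' rN = 2 ^ j, j <= L + 2, 2 ^ j <= 4 * m + 1,
   t - 40 * (L + 4) + 40 * (L + 3 - j) <= t' & agree [:: rN] [::] s s'].
apply: (wp_while hW hW100 (I := J)); last first.
  exists 0; ssimp; split=> //; try lia.
  by apply: agree_setr => //; apply: agree_refl.
move=> {}t' s' [j [ej hj hjm htt ag]].
have em' : ar s' qm = m by rewrite (proj1 ag).
split.
- by ssimp; rewrite em'; repeat split; lia.
- by ssimp; lia.
- ssimp; rewrite ej em' => hge.
  apply: (hQ _ _ j) => //; first by lia.
  by move: hge; case: ltnP => //; lia.
ssimp; rewrite ej em' => hlt; have {}hlt : 2 ^ j < 2 * m + 1 by move: hlt; case: ltnP.
have m0 : 0 < m by have := expn_gt0 2 j; lia.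
have hjL : j <= L + 1.
  case: (j) hlt => [|j']; first lia.
  rewrite expnS => hlt; have hj' : 2 ^ j' <= m by lia.
  by have := trunc_log_max (isT : 1 < 2) hj'; rewrite -/L; lia.
apply: (wp_set hW hW100) => //.
- by ssimp; rewrite ej; repeat split; lia.
- by side.
ssimp; rewrite ej -expnS; exists j.+1; ssimp; split=> //; try lia.
  by rewrite expnS; lia.
by apply: agree_setr.
Qed.

Definition Ys : pred nat :=
  fun y => has (fun i => (y == rc R i) || (y == rd R i)) (iota 1 m).

(** Position [0] belongs to ordinate [0], where the lowest region starts; a proper rectangle has no
    side at this ordinate, since [ra R i < rc R i]. *)
Definition good_pos (pos : nat -> nat) : Prop :=
  [/\ forall y, Ys y -> 0 < pos y <= 2 * m,
      forall y y', Ys y -> Ys y' -> y < y' -> pos y < pos y'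
    & pos 0 = 0].

Definition positions_cost h := sort_cost h (2 * m) + 100 * m.+1.

Lemma ykeys_Ys s y : ykeys s ->
  Ys y <-> exists2 i, 0 < i <= 2 * m & aa s aY i = y.
Proof.
clear hW hW100 hWn hIpb hmA hinput hproper.
move=> [_ hy]; split.
  case/hasP => i; rewrite mem_iota => hi /orP[]/eqP->.
    by exists i; [lia|case: (hy i) => //; lia].
  by exists (m + i); [lia|case: (hy i) => //; lia].
case=> i hi <-; apply/hasP.
case: (leqP i m) => him.
  by exists i; [rewrite mem_iota; lia|case: (hy i) => [|-> _]; rewrite ?eqxx //; lia].
exists (i - m); first by rewrite mem_iota; lia.
by case: (hy (i - m)) => [|_]; first lia; rewrite subnKC ?(ltnW him) // => ->; rewrite eqxx orbT.
Qed.

Lemma wp_make_positions h s t (Q : nat -> ast -> Prop) :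
  ar s qm = m -> ar s rN = 2 ^ h -> 2 * m < 2 ^ h -> 2 ^ h <= 4 * m + 1 ->
  ykeys s -> (forall y, aa s aPOS y = 0) -> (forall p, aa s aT p = 0) ->
  positions_cost h <= t ->
  (forall r s', t - positions_cost h <= r ->
     agree sregs [:: aT; aORD; aPOS] s s' ->
     (forall p, 0 < p < 2 ^ h.+1 -> aa s' aT p = 0) ->
     good_pos (aa s' aPOS) -> Q r s') ->
  wp w W make_positions s t Q.
Proof.
clear hIpb hmA hinput.
move=> em eN h2m hN yk hpos0 hT ht hQ.
have e2 : 2 ^ h.+1 = 2 * 2 ^ h by rewrite expnS.
have hyk := yk; case: hyk => Y0 hYi.
have YV i : 0 < i <= 2 * m -> 0 < aa s aY i <= n.
  move=> hi; have [/(_ _)/= ] := ykeys_Ys (aa s aY i) yk.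
  move=> _ /(_ (ex_intro2 _ _ i hi erefl)) /hasP[j]; rewrite mem_iota => hj.
  by have := @hproper j; rewrite /proper_rect => /(_ _) hp /orP[]/eqP->; move: hp; lia.
pose le : rel nat := fun x y => aa s aY x <= aa s aY y.
have Yag s' rs : agree rs [:: aT; aORD; aPOS] s s' -> forall i, aa s' aY i = aa s aY i.
  by move=> [_ a] i; rewrite a.
have sub : {subset sarrs <= [:: aT; aORD; aPOS]}.
  by move=> x; rewrite !inE => /orP[]->; rewrite ?orbT.
apply: wp_seq; apply: (@wp_sort w W hW hW100 le h _ _ (2 * m)) => //.
- by move=> x y; apply: leq_total.
- by move=> x y z; apply: leq_trans.
- by move=> i hi; rewrite /le Y0; have := YV i hi; lia.
- move=> s' a; rewrite /better_y; split; first by ssimp.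
  ssimp; rewrite !(proj2 a) // /le -ltnNge; by case: ltnP.
- by move=> s' a; ssimp; rewrite (proj1 a) // em; repeat split; lia.
- by rewrite e2; lia.
- by rewrite /positions_cost in ht; lia.
move=> r s1 o hr ag1 hT1 po pw hord.
have ag1' : agree sregs [:: aT; aORD; aPOS] s s1 by apply: agree_sub ag1.
have so : size o = 2 * m by rewrite (perm_size po) size_iota.
have oin j : j < 2 * m -> 0 < nth 0 o j <= 2 * m.
  move=> hj; have : nth 0 o j \in iota 1 (2 * m) by rewrite -(perm_mem po) mem_nth ?so.
  by rewrite mem_iota; lia.
have htr : t - positions_cost h + 100 * m.+1 <= r by rewrite /positions_cost in ht *; lia.
apply: wp_seq; apply: (wp_set hW hW100) => //; first by side.
ssimp.
(* The last conjunct ties a stored rank to an entry of the sorted list with this ordinate; the order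
   of ranks follows from it even if ordinates repeat. *)
pose J t' s' := exists j, [/\ ar s' rj = j, j <= 2 * m,
   t - positions_cost h + 50 * (2 * m - j) + 20 <= t',
   agree sregs [:: aT; aORD; aPOS] s s' &
   [/\ forall p, 0 < p < 2 ^ h.+1 -> aa s' aT p = 0,
       forall i, i < 2 * m -> aa s' aORD i = nth 0 o i,
       forall i, i < j -> 0 < aa s' aPOS (aa s aY (nth 0 o i)) <= j
     & forall y, 0 < aa s' aPOS y ->
         aa s' aPOS y <= j /\ aa s aY (nth 0 o (aa s' aPOS y).-1) = y]].
apply: (wp_while hW hW100 (I := J)); last first.
  exists 0; ssimp; split=> //.
  - by lia.
  - by apply: agree_setr.
  by split=> // y; rewrite (proj2 ag1) // hpos0.
move=> {}t' s' [j [ej hj htt ag [hT' ho hp1 hp2]]].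
have em' : ar s' qm = m by rewrite (proj1 ag).
split.
- by ssimp; rewrite em'; repeat split; lia.
- by ssimp; lia.
- ssimp; rewrite ej em' => hge.
  have {hge} ej' : j = 2 * m by move: hge; case: ltnP => //; lia.
  subst j.
  have inY y : Ys y -> exists2 i, i < 2 * m & aa s aY (nth 0 o i) = y.
    case/(ykeys_Ys y yk) => i hi <-.
    have io : i \in o by rewrite (perm_mem po) mem_iota; lia.
    exists (index i o); last by rewrite nth_index.
    by rewrite -so index_mem.
  have hpos y : Ys y -> 0 < aa s' aPOS y <= 2 * m.
    by case/inY => i hi <-; have := hp1 i; rewrite ej' => /(_ hi).
  apply: hQ => //; first by lia.
  split=> //.
    move=> y y' hy hy' lt; have h1 := hpos _ hy; have h2 := hpos _ hy'.
    have [_ b1] := hp2 y (proj1 (andP h1)); have [_ b2] := hp2 y' (proj1 (andP h2)).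
    case: ltnP => // hle.
    have hle' : (aa s' 9 y').-1 <= (aa s' 9 y).-1 by lia.
    have : le (nth 0 o (aa s' 9 y').-1) (nth 0 o (aa s' 9 y).-1).
      move: hle'; rewrite leq_eqVlt => /orP[/eqP->|hlt]; first by rewrite /le.
      have /(pairwiseP 0) := pw; apply=> //; rewrite inE so; lia.
    by rewrite /le b1 b2; lia.
  case: (posnP (aa s' 9 0)) => // h0; have [h1 h2] := hp2 _ h0.
  have := oin (aa s' 9 0).-1; move=> /(_ _) hb.
  have := YV (nth 0 o (aa s' 9 0).-1); rewrite h2.
  by move=> /(_ _) H; have : 0 < 0 <= n by apply: H; apply: hb; lia.
ssimp; rewrite ej em' => hlt; have {}hlt : j < 2 * m by move: hlt; case: ltnP.
apply: wp_seq; apply: (wp_sto hW hW100) => //.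
- by ssimp; rewrite ej; repeat split; lia.
- by side.
ssimp; rewrite ej ho // (Yag _ _ ag).
apply: (wp_set hW hW100) => //.
- by ssimp; rewrite ej; repeat split; lia.
- by side.
ssimp; rewrite ej addn1; exists j.+1; ssimp; split=> //.
- by lia.
- by lia.
- by apply: agree_setr => //; apply: agree_seta.
split=> //.
- move=> i hi; case: eqP => [_|ne]; first by lia.
  have ij : i < j.
    by rewrite ltn_neqAle -ltnS hi andbT; apply/eqP => e; case: ne; rewrite e.
  by have := hp1 i ij; lia.
- move=> y; case: eqP => [->|_]; first by rewrite addn1.
  by move=> h0; have [h1 h2] := hp2 y h0; split=> //; lia.
Qed.

Definition rlex_le := lex_le (ra R) (rb R) (rc R) (rd R).

Lemma keys_agree rs js s s' : agree rs js s s' ->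
  [&& qm \notin rs, qn \notin rs & all (fun j => j \notin js) [:: aKA; aKB; aKC; aKD; aCOL]] ->
  keys s -> keys s'.
Proof.
move=> [a1 a2] /and3P[h1 h2 /and5P[b1 b2 b3 b4 /andP[b5 _]]] [k1 k2 [k3 k4] k5].
split; rewrite ?a1 ?a2 // => i /k5[c1 c2 c3 c4 c5].
by split; rewrite a2.
Qed.

Lemma wp_sort_rects h s t (Q : nat -> ast -> Prop) :
  keys s -> ar s rN = 2 ^ h -> 2 * m < 2 ^ h -> 2 ^ h <= 4 * m + 1 ->
  (forall p, 0 < p < 2 ^ h.+1 -> aa s aT p = 0) ->
  sort_cost h m <= t ->
  (forall r s' o, t - sort_cost h m <= r -> agree sregs sarrs s s' ->
     (forall p, 0 < p < 2 ^ h.+1 -> aa s' aT p = 0) ->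
     perm_eq o (iota 1 m) -> pairwise rlex_le o ->
     (forall j, j < m -> aa s' aORD j = nth 0 o j) -> Q r s') ->
  wp w W (sort_items better_x (AR qm)) s t Q.
Proof.
clear hIpb hmA hinput.
move=> ks eN h2m hN hT ht hQ.
have e2 : 2 ^ h.+1 = 2 * 2 ^ h by rewrite expnS.
have [em en [k0 k0'] kr] := ks.
pose le := lex_le (aa s aKA) (aa s aKB) (aa s aKC) (aa s aKD).
apply: (@wp_sort w W hW hW100 le h _ _ m) => //.
- exact: lex_le_total.
- exact: lex_le_trans.
- move=> i hi; rewrite /le /lex_le k0 k0'.
  have [-> -> _ _ _] := kr i hi; have := hproper hi; rewrite /proper_rect; lia.
- move=> s' a; rewrite /better_x; split.
    ssimp; repeat split=> //; apply: leq_ltn_trans hW100.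
    all: repeat match goal with |- context [nat_of_bool ?b] =>
      match b with context [aa] => generalize b end end.
    - by do 2!case.
    - by do 3!case.
    - by do 4!case.
    - by do 5!case.
  ssimp; rewrite lex_value !(proj2 a) // /le /lex_le.
  move: (ar s' 6) (ar s' 7) => x y.
  rewrite negb_or negb_and negb_or negb_and -!leqNgt -ltnNge.
  by case: (ltngtP (aa s 2 x) (aa s 2 y)) => // _; case: (ltngtP (aa s 3 x) (aa s 3 y)).
- by move=> s' a; ssimp; rewrite (proj1 a).
- by lia.
- by rewrite e2; lia.
move=> r s' o hr a hT' po pw ho; apply: (hQ _ _ o) => //.
have ao : all (fun i => 0 < i <= m) o.
  by apply/allP => i; rewrite (perm_mem po) mem_iota; lia.
move: ao pw; elim: (o) => //= i o' IH /andP[hi ao] /andP[h1 h2].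
rewrite IH // andbT; apply/allP => j jo; have := allP h1 _ jo.
have hj := allP ao _ jo.
rewrite /le /rlex_le /lex_le.
have [-> -> -> -> _] := kr i hi; by have [-> -> -> -> _] := kr j hj.
Qed.

End Program.

(** * Code for inserting and removing items *)

Definition better_max : aexpr := AR rx <^ AR ry.

(** The test on [rd] gives the same answer as at the insertion, because the vertical ends of the
    home region have not changed. The start of the home region is rewritten last, since it may
    coincide with the ordinate [rc] just erased. *)
Definition pop_item : acmd :=
  ASet qu (AA aST (AR qsp)) ;;
  ASet qv (AA aSZ (AR qu)) ;;
  up better_max (AA aPOS (AA aKC (AR qu))) (AK 0) ;;
  AIf (AA aKD (AR qu) <^ AA aY1 (AR qv))
    (up better_max (AA aPOS (AA aKD (AR qu))) (AK 0)) ASkip ;;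
  up better_max (AA aPOS (AA aY0 (AR qv))) (AA aY0 (AR qv)) ;;
  ASto aAT (AA aY0 (AR qv)) (AR qv) ;;
  ASet qsp (AR qsp -^ AK 1).

Definition load_item : acmd :=
  ASet qi (AA aORD (AR qk)) ;;
  ASet qa (AA aKA (AR qi)) ;;
  ASet qb (AA aKB (AR qi)) ;;
  ASet qc (AA aKC (AR qi)) ;;
  ASet qd (AA aKD (AR qi)).

Definition set_region (j : nat) (ex0 ex1 ey0 ey1 ecol : aexpr) : acmd :=
  ASto aX0 (AR qg +^ AK j) ex0 ;;
  ASto aX1 (AR qg +^ AK j) ex1 ;;
  ASto aY0 (AR qg +^ AK j) ey0 ;;
  ASto aY1 (AR qg +^ AK j) ey1 ;;
  ASto aRC (AR qg +^ AK j) ecol.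

Definition split_region : acmd :=
  ASet qz (AA aAT (AR rs)) ;;
  ASet qe (AA aY1 (AR qz)) ;;
  ASet qg (AK 4 *^ AR qk) ;;
  set_region 1 (AA aX0 (AR qz)) (AR qa) (AR rs) (AR qe) (AA aRC (AR qz)) ;;
  set_region 2 (AR qa) (AR qb) (AR rs) (AR qc) (AA aRC (AR qz)) ;;
  set_region 3 (AR qa) (AR qb) (AR qc) (AR qd) (AA aCOL (AR qi)) ;;
  set_region 4 (AR qa) (AR qb) (AR qd) (AR qe) (AA aRC (AR qz)) ;;
  ASto aX0 (AR qz) (AR qb).

Definition push_item : acmd :=
  ASto aAT (AR rs) (AR qg +^ AK 2) ;;
  ASto aAT (AR qc) (AR qg +^ AK 3) ;;
  up better_max (AA aPOS (AR qc)) (AR qc) ;;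
  AIf (AR qd <^ AR qe)
    (ASto aAT (AR qd) (AR qg +^ AK 4) ;;
     up better_max (AA aPOS (AR qd)) (AR qd))
    ASkip ;;
  ASto aSZ (AR qi) (AR qz) ;;
  ASet qsp (AR qsp +^ AK 1) ;;
  ASto aST (AR qsp) (AR qi) ;;
  ASet qk (AR qk +^ AK 1).

Definition process_items : acmd :=
  AWhile (AR qk <^ AR qm)
    (load_item ;;
     AWhile (AA aKB (AA aST (AR qsp)) <^ AR qa +^ AK 1) pop_item ;;
     query (AA aPOS (AR qc)) ;;
     split_region ;;
     push_item).

(** * The tree leaves as an image of the sweep line *)

Section Line.
Variables (n m N : nat) (R : rects) (pos : nat -> nat).
Hypothesis hpos : good_pos m R pos.
Hypothesis hN : 2 * m < N.
Notation Ys := (Ys m R).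

(** A leaf stores its ordinate as value, so the prefix maximum is the largest active ordinate.
    Ordinate [0] needs no entry of its own, as an empty leaf also reads [0]. *)
Record line (T : nat -> nat) (F : sweep) : Prop := Line {
  line_leaf : forall q, q < N ->
    T q = 0 \/ [/\ Ys (T q), pos (T q) = q & F (T q)];
  line_active : forall y, Ys y -> F y -> T (pos y) = y }.

Lemma pos_inj y y' : Ys y -> Ys y' -> pos y = pos y' -> y = y'.
Proof.
case: hpos => _ mono _ hy hy' e.
by case: (ltngtP y y') => // /mono h; have := h ltac:(done) ltac:(done); rewrite e ltnn.
Qed.

Lemma pos_neq0 y : Ys y -> pos y != 0.
Proof. by clear hN; case: hpos => h _ _ /h; lia. Qed.

(** By the gap property, the restored line has no start strictly inside the home region. So the
    erased ordinates [rc] and [rd] are inactive again, except when [rc] is the start of the home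
    region, which is written back. *)
Lemma line_pop T T' k rg F F' st t j i z : line T F -> swept n R Ys k rg F' st t ->
  F =1 insert_item R F' j i (y0 rg z) (y1 rg z) -> F' (y0 rg z) = Some z ->
  y0 rg z <= rc R i -> rd R i <= y1 rg z -> rc R i < rd R i ->
  Ys (rc R i) -> Ys (rd R i) ->
  (forall q, q < N -> T' q =
    if q == pos (y0 rg z) then y0 rg z
    else if (rd R i < y1 rg z) && (q == pos (rd R i)) then 0
    else if q == pos (rc R i) then 0 else T q) ->
  line T' F'.
Proof.
move=> [h1 h2] [hy _ hg _] hF hz hc hd hcd Yc Yd hT.
set s := y0 rg z in hF hz hc hT; set e := y1 rg z in hF hd hT.
have Ys0 : (s == 0) || Ys s by have [_ _ _ _] := hy _ _ hz.
have [pb _ p0] := hpos.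
split.
- move=> q hq; rewrite hT //; case: eqP => [eq|nq].
    case/orP: Ys0 => [/eqP->|Yss]; [by left|right].
    by rewrite hz.
  case: ifP => [_|nd]; first by left.
  case: eqP => [_|nc]; first by left.
  case: (h1 q hq) => [->|[Yv pv Fv]]; [by left|right; split=> //].
  move: Fv; rewrite hF /insert_item.
  case: ifP => [/andP[/eqP ev de]|_].
    by move: nd; rewrite de -ev pv eqxx.
  case: eqP => [ev|_]; first by case: nc; rewrite -ev pv.
  by case: eqP => [ev|//]; case: nq; rewrite -ev pv.
- move=> y hYy Fy; have hpy := pb _ hYy; rewrite hT; last by lia.
  case: eqP => [e1|ne].
    case/orP: Ys0 => [/eqP s0|Yss]; last by apply/esym; apply: pos_inj.
    by have := pos_neq0 hYy; rewrite e1 s0 p0.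
  have ys : y != s by apply/eqP => e1; case: ne; rewrite e1.
  case Ey : (F' y) Fy => [u|//] _.
  have yc : y != rc R i.
    apply/eqP => e1; have sl : s < y by rewrite ltn_neqAle eq_sym ys e1.
    by have := hg _ _ _ _ hz Ey sl; lia.
  have yd : rd R i < e -> y != rd R i.
    move=> de; apply/eqP => e1; have sl : s < y by lia.
    by have := hg _ _ _ _ hz Ey sl; rewrite -/e; lia.
  case: ifP => [/andP[de /eqP pe]|_].
    by have := pos_inj hYy Yd pe; move/eqP: (yd de).
  case: eqP => [pe|_]; first by have := pos_inj hYy Yc pe; move/eqP: yc.
  apply: h2 => //; rewrite hF /insert_item (negbTE yc) (negbTE ys) Ey.
  by case: ifP.
Qed.

Lemma line_push T T' F k i z s e : line T F -> F s = Some z ->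
  rc R i < rd R i -> Ys (rc R i) -> Ys (rd R i) ->
  (forall q, q < N -> T' q =
    if (rd R i < e) && (q == pos (rd R i)) then rd R i
    else if q == pos (rc R i) then rc R i else T q) ->
  line T' (insert_item R F k i s e).
Proof.
move=> [h1 h2] hs hcd Yc Yd hT; have [pb _ p0] := hpos.
split.
- move=> q hq; rewrite hT //; case: ifP => [/andP[de /eqP eq]|nd].
    by right; rewrite /insert_item eqxx de.
  case: eqP => [eq|nc].
    by right; rewrite /insert_item eqxx; case: ifP.
  case: (h1 q hq) => [->|[Yv pv Fv]]; [by left|right; split=> //].
  by rewrite /insert_item; repeat (case: ifP => // _).
- move=> y hYy Fy; have hpy := pb _ hYy; rewrite hT; last by lia.
  case: ifP => [/andP[de /eqP pe]|nd]; first by rewrite (pos_inj hYy Yd pe).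
  case: eqP => [pe|nc]; first by rewrite (pos_inj hYy Yc pe).
  apply: h2 => //; move: Fy; rewrite /insert_item.
  case: ifP => [/andP[/eqP ey de]|_]; first by move: nd; rewrite de ey eqxx.
  case: eqP => [ey|_]; first by case: nc; rewrite ey.
  by case: eqP => [->|//]; rewrite hs.
Qed.

End Line.

(** * Correctness and cost of a single insertion or removal *)

Section Process.
Variables (w W : nat).
Hypothesis hW : num_arrays * W <= 2 ^ w.
Hypothesis hW100 : 100 < W.
Variables (n m h : nat) (R : rects) (pos : nat -> nat) (o : seq nat).
Hypothesis hWn : 20 * n + 40 * m + 80 <= W.
Hypothesis hproper : forall i, 0 < i <= m -> proper_rect n R i.
Hypothesis hpos : good_pos m R pos.
Hypothesis h2m : 2 * m < 2 ^ h.
Hypothesis hN : 2 ^ h <= 4 * m + 1.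
Notation Ys := (Ys m R).

(** Snapshots exist only in the specification; memory keeps the item and its home region. Cell [0]
    of the stack holds the sentinel item [0]. *)
Fixpoint stack_rel s (st : seq frame) : Prop :=
  if st is f :: st' then
    [/\ aa s aST (size st) = item f, aa s aSZ (item f) = home f
      & stack_rel s st']
  else aa s aST 0 = 0.

Definition region_rel s rg : Prop := forall g,
  [/\ aa s aX0 g = x0 rg g, aa s aX1 g = x1 rg g, aa s aY0 g = y0 rg g,
      aa s aY1 g = y1 rg g & aa s aRC g = rcol rg g].

(** Field [main_at] constrains [aAT] at active ordinates only, so entries left behind by removed
    items are harmless. *)
Record main_rel s k (st : seq frame) (F : sweep) rg : Prop := MainRel {
  main_k : ar s qk = k;
  main_sp : ar s qsp = size st;
  main_N : ar s rN = 2 ^ h;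
  main_keys : keys n m R s;
  main_ord : forall j, j < m -> aa s aORD j = nth 0 o j;
  main_pos : forall y, aa s aPOS y = pos y;
  main_tour : tourney geq (2 ^ h) (aa s aT);
  main_line : line m (2 ^ h) R pos (fun q => aa s aT (2 ^ h + q)) F;
  main_at : forall y z, F y = Some z -> aa s aAT y = z;
  main_rg : region_rel s rg;
  main_st : stack_rel s st }.

Definition items (st : seq frame) := [seq item f | f <- st].

Lemma item_Ys i : 0 < i <= m -> Ys (rc R i) /\ Ys (rd R i).
Proof.
move=> hi; split; apply/hasP; exists i; rewrite ?mem_iota ?eqxx ?orbT //; lia.
Qed.

Lemma stack_rel_agree rs js s s' st : agree rs js s s' ->
  (aST \notin js) && (aSZ \notin js) -> stack_rel s st -> stack_rel s' st.
Proof.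
move=> [_ a] /andP[h1 h2]; elim: st => [|f st IH] /=; first by rewrite a.
by case=> b1 b2 /IH b3; split; rewrite ?a.
Qed.

Lemma max_better s : safe W s better_max /\
  (ev s better_max != 0) = ~~ geq (ar s rx) (ar s ry).
Proof. by rewrite /better_max; ssimp; split=> //; rewrite /geq /= -ltnNge; case: ltnP. Qed.

Lemma hNW : 2 ^ h.+1 + 1 < W.
Proof. by rewrite expnS; lia. Qed.

(* The value [v] is stored at position [p]. *)
Lemma wp_up_max pe ve v s t (Q : nat -> ast -> Prop) :
  safe W s pe -> acost pe <= 20 -> ev s pe < 2 ^ h ->
  (forall s', agree [:: rp] [::] s s' -> safe W s' ve /\ ev s' ve = v) ->
  acost ve <= 20 -> ar s rN = 2 ^ h -> tourney geq (2 ^ h) (aa s aT) ->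
  up_cost h <= t ->
  (forall r s', t - up_cost h <= r -> agree [:: rp; rx; ry] [:: aT] s s' ->
     tourney geq (2 ^ h) (aa s' aT) ->
     (forall q, q < 2 ^ h -> aa s' aT (2 ^ h + q) =
        if q == ev s pe then v else aa s aT (2 ^ h + q)) -> Q r s') ->
  wp w W (up better_max pe ve) s t Q.
Proof.
have := hNW => hNW' h1 h2 h3 h4 h5 h6 h7 h8 hQ.
apply: (@wp_up w W hW hW100 geq h better_max pe ve s v) => //.
- by move=> s' _; apply: max_better.
- by lia.
Qed.

Lemma pos_lt y : Ys y || (y == 0) -> pos y < 2 ^ h.
Proof.
have [pb _ p0] := hpos; case/orP => [/pb|/eqP->]; first lia.
by rewrite p0 expn_gt0.
Qed.

Definition pop_regs := [:: rp; rx; ry; qu; qv; qsp].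
Definition pop_arrs := [:: aT; aAT].
Definition pop_cost := 3 * up_cost h + 100.

Lemma wp_pop s k f st F rg a t (Q : nat -> ast -> Prop) :
  main_rel s k (f :: st) F rg -> stacked n R Ys k rg F (f :: st) a ->
  0 < item f <= m -> pop_cost <= t ->
  (forall r s', t - pop_cost <= r -> agree pop_regs pop_arrs s s' ->
     main_rel s' k st (before f) rg -> Q r s') ->
  wp w W pop_item s t Q.
Proof.
move=> [rk rsp rNN rkeys rord rpos rtour rline rat rrg rst].
move=> [hsw [hF hbef [hyc hyd] hend hstk]] hi ht hQ.
have [km kn _ kr] := rkeys; have [_ _ kC kD _] := kr _ hi.
have {}hsw := stacked_swept hstk.
have [Yc Yd] := item_Ys hi.
have [pr1 pr2 pr3 pr4] := and4P (hproper hi).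
case: (rst) => eST eSZ rst'.
have eC : pop_cost = 3 * up_cost h + 100 by [].
set U := up_cost h in ht hQ eC *.
have Y0z : aa s aY0 (home f) = y0 rg (home f) by have [] := rrg (home f).
have Y1z : aa s aY1 (home f) = y1 rg (home f) by have [] := rrg (home f).
have Ysz : Ys (y0 rg (home f)) || (y0 rg (home f) == 0).
  by have [_ _ _ _] := swept_y hsw hbef; rewrite orbC.
apply: wp_seq; apply: (wp_set hW hW100) => //; first by side.
ssimp; rewrite rsp eST.
apply: wp_seq; apply: (wp_set hW hW100) => //; first by side.
ssimp; rewrite eSZ; set s1 := setr _ qv _.
have a1 : agree pop_regs pop_arrs s s1 by do 2!apply: agree_setr => //; apply: agree_refl.
have sub x : x \in [:: rp; rx; ry] -> x \in pop_regs.
  by rewrite !inE => /or3P[]->; rewrite ?orbT.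
have subj x : x \in [:: aT] -> x \in pop_arrs by rewrite !inE => ->.
have epc : ev s1 (AA aPOS (AA aKC (AR qu))) = pos (rc R (item f)).
  by rewrite /s1; ssimp; rewrite kC rpos.
apply: wp_seq; apply: (@wp_up_max _ _ 0) => //.
- by rewrite epc; apply: pos_lt; rewrite Yc.
- by rewrite -/U; ssimp; lia.
move=> r1 s2 hr1 b2 tour2; rewrite epc => leaf2.
have a2 : agree pop_regs pop_arrs s s2.
  by apply: agree_trans a1 _; apply: agree_sub b2.
have u2 : ar s2 qu = item f by rewrite (proj1 b2).
have v2 : ar s2 qv = home f by rewrite (proj1 b2).
(* The state in which both branches of the test on [rd] meet. *)
pose mid r s3 := [/\ t - pop_cost + U + 50 <= r, agree pop_regs pop_arrs s s3,
  tourney geq (2 ^ h) (aa s3 aT), ar s3 qu = item f /\ ar s3 qv = home f &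
  [/\ ar s3 qsp = size (f :: st), forall j, aa s3 aAT j = aa s aAT j & forall q, q < 2 ^ h -> aa s3 aT (2 ^ h + q) =
  if (rd R (item f) < y1 rg (home f)) && (q == pos (rd R (item f))) then 0
    else if q == pos (rc R (item f)) then 0 else aa s aT (2 ^ h + q)]].
have fin r s3 : mid r s3 -> wp w W
  (up better_max (AA aPOS (AA aY0 (AR qv))) (AA aY0 (AR qv)) ;;
   ASto aAT (AA aY0 (AR qv)) (AR qv) ;;
   ASet qsp (AR qsp -^ AK 1)) s3 r Q.
  move=> [hr a3 tour3 [u3 v3] [sp3 at3 leaf3]].
  have y3 : aa s3 aY0 (home f) = y0 rg (home f) by rewrite (proj2 a3).
  have ep : ev s3 (AA aPOS (AA aY0 (AR qv))) = pos (y0 rg (home f)).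
    by ssimp; rewrite v3 y3 (proj2 a3).
  apply: wp_seq; apply: (@wp_up_max _ _ (y0 rg (home f))) => //.
  - by rewrite ep; apply: pos_lt.
  - by move=> s' a'; ssimp; rewrite (proj1 a') // v3 (proj2 a').
  - by rewrite (proj1 a3).
  - by rewrite -/U; lia.
  rewrite ep -/U => r4 s4 hr4 b4 tour4 leaf4.
  have a4 : agree pop_regs pop_arrs s s4.
    by apply: agree_trans a3 _; apply: agree_sub b4.
  have v4 : ar s4 qv = home f by rewrite (proj1 b4).
  have y4 : aa s4 aY0 (home f) = y0 rg (home f) by rewrite (proj2 b4).
  apply: wp_seq; apply: (wp_sto hW hW100) => //; first by side.
  ssimp; rewrite v4 y4.
  apply: (wp_set hW hW100) => //; first by side.
  ssimp; rewrite (proj1 b4) // sp3; set s5 := setr _ _ _.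
  have a5 : agree pop_regs pop_arrs s s5 by apply: agree_setr => //; apply: agree_seta.
  apply: hQ => //; first by lia.
  split.
  - by rewrite (proj1 a5).
  - by rewrite /s5; ssimp; rewrite /= subn1.
  - by rewrite (proj1 a5).
  - exact: keys_agree a5 _ rkeys.
  - by move=> j hj; rewrite (proj2 a5) ?rord.
  - by move=> y; rewrite (proj2 a5).
  - by rewrite /s5; ssimp.
  - apply: (line_pop hpos (z := home f) (i := item f) h2m rline hsw) => //.
    by move=> q hq; rewrite /s5; ssimp; rewrite leaf4 // leaf3.
  - move=> y z hz; rewrite /s5; ssimp.
    case: eqP => [ey|ny]; first by move: hz; rewrite ey hbef => -[].
    rewrite (proj2 b4) // at3; apply: rat; rewrite hF /insert_item.
    have hg := swept_gap hsw.
    case: ifP => [/andP[/eqP ed de]|_].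
      have sl : y0 rg (home f) < y by lia.
      by have := hg _ _ _ _ hbef hz sl; lia.
    case: eqP => [ec|_].
      have sl : y0 rg (home f) < y by lia.
      by have := hg _ _ _ _ hbef hz sl; lia.
    by move/eqP: ny => /negbTE->.
  - by move=> g; rewrite !(proj2 a5).
  - by apply: stack_rel_agree a5 _ rst'.
have epd : ev s2 (AA aPOS (AA aKD (AR qu))) = pos (rd R (item f)).
  by ssimp; rewrite u2 !(proj2 b2) //; rewrite /s1; ssimp; rewrite kD rpos.
apply: wp_seq; apply: (wp_if hW hW100) => //.
- by ssimp; lia.
- ssimp; rewrite u2 v2 !(proj2 b2) // /s1; ssimp; rewrite kD Y1z => lt.
  have {}lt : rd R (item f) < y1 rg (home f) by move: lt; case: ltnP.
  apply: (@wp_up_max _ _ 0) => //.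
  + by rewrite epd; apply: pos_lt; rewrite Yd.
  + by rewrite (proj1 a2).
  + by rewrite -/U; ssimp; lia.
  rewrite epd -/U => r3 s3 hr3 b3 tour3 leaf3.
  have a3 : agree pop_regs pop_arrs s s3.
    by apply: agree_trans a2 _; apply: agree_sub b3.
  apply: fin; split=> //; first by move: hr3; ssimp; lia.
    by rewrite !(proj1 b3).
  split.
  + by rewrite (proj1 b3) // (proj1 b2).
  + by move=> j; rewrite (proj2 b3) // (proj2 b2).
  + by move=> q hq; rewrite leaf3 // lt leaf2.
ssimp; rewrite u2 v2 !(proj2 b2) // /s1; ssimp; rewrite kD Y1z => lt.
have {}lt : (rd R (item f) < y1 rg (home f)) = false by move: lt; case: ltnP.
apply: wp_skip; first by lia.
apply: fin; split=> //; first by lia.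
split.
- by rewrite (proj1 b2).
- by move=> j; rewrite (proj2 b2).
- by move=> q hq; rewrite lt leaf2.
Qed.

Definition put_region s g v0 v1 v2 v3 v4 : ast :=
  seta (seta (seta (seta (seta s aX0 g v0) aX1 g v1) aY0 g v2) aY1 g v3) aRC g v4.

Lemma wp_set_region j ex0 r1 r2 r3 jc r4 s t (Q : nat -> ast -> Prop) :
  ar s qg + j < W -> j <= 100 -> safe W s ex0 -> acost ex0 <= 10 ->
  [&& r1 != 3, r2 != 3, r3 != 3 & r4 != 3] ->
  (jc < num_arrays) && (jc \notin [:: aX0; aX1; aY0; aY1]) -> 100 <= t ->
  (forall r, t - 100 <= r ->
     Q r (put_region s (ar s qg + j) (ev s ex0) (ar s r1) (ar s r2) (ar s r3)
            (aa s jc (ar s r4)))) ->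
  wp w W (set_region j ex0 (AR r1) (AR r2) (AR r3) (AA jc (AR r4))) s t Q.
Proof.
move=> hg hj h0 c0 /and4P[n1 n2 n3 n4] /andP[hjc njc] ht hQ.
apply: wp_seq; apply: (wp_sto hW hW100) => //; first by side.
do 3!(apply: wp_seq; apply: (wp_sto hW hW100) => //; first by side).
apply: (wp_sto hW hW100) => //; first by side.
have {hQ} := hQ (t - (3 + acost ex0 + 5 + 27 + 14)); rewrite /put_region; ssimp.
move: njc; rewrite !inE !negb_or => /and4P[m1 m2 m3 m4].
do 4!(case: nat_eqbP => [e|_]; first by move: m1 m2 m3 m4; rewrite e).
move=> hQ; have : t - 100 <= t - (3 + acost ex0 + 5 + 27 + 14) by lia.
move/hQ; rewrite /put_region.
by have -> : t - (3 + acost ex0 + 5) - 9 - 9 - 9 - (3 + (5 + 1) + 5)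
  = t - (3 + acost ex0 + 5 + 27 + 14) by lia.
Qed.

Definition split_regs := [:: qz; qe; qg].
Definition split_arrs := [:: aX0; aX1; aY0; aY1; aRC].

Lemma wp_split_region s k st F rg i z t (Q : nat -> ast -> Prop) :
  main_rel s k st F rg -> k < m -> 0 < i <= m ->
  [/\ ar s qi = i, ar s qa = ra R i, ar s qb = rb R i, ar s qc = rc R i
    & ar s qd = rd R i] ->
  ar s rs = y0 rg z -> F (y0 rg z) = Some z -> z <= 4 * k -> 500 <= t ->
  (forall r s', t - 500 <= r -> agree split_regs split_arrs s s' ->
     [/\ ar s' qz = z, ar s' qe = y1 rg z & ar s' qg = 4 * k] ->
     region_rel s' (split_at R k i z rg) -> Q r s') ->
  wp w W split_region s t Q.
Proof.
move=> mr hk hi [eqi eqa eqb eqc eqd] ers hF hz ht hQ.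
have [rk _ _ rkeys _ _ _ _ rat rrg _] := mr.
have [_ _ _ kr] := rkeys; have [_ _ _ _ kcol] := kr _ hi.
have hrg := rrg z; case: hrg => Z0 Z1 Z2 Z3 Z4.
apply: wp_seq; apply: (wp_set hW hW100) => //; first by side.
ssimp; rewrite ers (rat _ _ hF).
apply: wp_seq; apply: (wp_set hW hW100) => //; first by side.
ssimp; rewrite Z3.
apply: wp_seq; apply: (wp_set hW hW100) => //.
- by ssimp; rewrite rk; repeat split; lia.
- by side.
ssimp; rewrite rk; set s1 := setr _ qg _.
have ar_put s' g v0 v1 v2 v3 v4 : ar (put_region s' g v0 v1 v2 v3 v4) = ar s' by [].
have rc_put s' g v0 v1 v2 v3 v4 : z != g -> aa (put_region s' g v0 v1 v2 v3 v4) 18 z = aa s' 18 z.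
  by move=> /negbTE ne; rewrite /put_region; ssimp; rewrite ne.
have col_put s' g v0 v1 v2 v3 v4 u : aa (put_region s' g v0 v1 v2 v3 v4) 6 u = aa s' 6 u by [].
have e1 : ar s1 qg = 4 * k by [].
have e2 : ar s1 qz = z by [].
have e3 : ar s1 qa = ra R i by [].
have e4 : ar s1 qb = rb R i by [].
have e5 : ar s1 qc = rc R i by [].
have e6 : ar s1 qd = rd R i by [].
have e7 : ar s1 qe = y1 rg z by [].
have e8 : ar s1 rs = y0 rg z by [].
have e9 : ar s1 qi = i by [].
have e10 : aa s1 18 z = rcol rg z by [].
have e11 : aa s1 6 i = icol R i by [].
have e12 : ev s1 (AA aX0 (AR qz)) = x0 rg z by [].
have htt : t - 30 <= t - (5 + 1).+1 - (5 + 1).+1 - (1 + 1).+2 by lia.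
(* The new numbers exceed [4 * k], hence [z]: writing the new regions leaves the colour of [z]
   readable. *)
have ne j : 0 < j -> z != 4 * k + j by move=> hj; apply/eqP; lia.
apply: wp_seq; apply: wp_set_region => //; [by rewrite e1; lia|by ssimp; lia|].
rewrite e1 e2 e3 e7 e8 e10 e12 => r1 hr1.
apply: wp_seq; apply: wp_set_region => //; [by rewrite ar_put e1; lia|by move: hr1; ssimp; lia|].
rewrite !ar_put e1 e2 [ev _ _]e3 e4 e5 e8 rc_put ?ne // e10 => r2 hr2.
apply: wp_seq; apply: wp_set_region => //; [by rewrite !ar_put e1; lia|by move: hr1; ssimp; lia|].
rewrite !ar_put e1 [ev _ _]e3 e4 e5 e6 e9 !col_put e11 => r3 hr3.
apply: wp_seq; apply: wp_set_region => //; [by rewrite !ar_put e1; lia|by move: hr1; ssimp; lia|].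
rewrite !ar_put e1 e2 [ev _ _]e3 e4 e6 e7 !rc_put ?ne // e10 => r4 hr4.
apply: (wp_sto hW hW100) => //; first by move: hr1; ssimp; lia.
ssimp; rewrite !ar_put e2 e4; set s5 := seta _ _ _ _.
apply: hQ.
- by move: hr1; ssimp; lia.
- rewrite /s5 /put_region /s1.
  by repeat first [apply: agree_setr => // | apply: agree_seta => //].
- by [].
move=> g; have [G0 G1 G2 G3 G4] := rrg g.
rewrite /s5 /put_region /s1; ssimp.
by rewrite G0 G1 G2 G3 G4 /split_at /setn /= addn1 addn2 addn3 addn4.
Qed.

(** Home regions are stored by item, and [i] is not on the stack, so recording its home region
    destroys no older entry. *)
Lemma stack_rel_push s s' st i : stack_rel s st -> i \notin items st ->
  (forall j, j <= size st -> aa s' aST j = aa s aST j) ->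
  (forall j, j != i -> aa s' aSZ j = aa s aSZ j) -> stack_rel s' st.
Proof.
elim: st => [|f st IH] /=; first by move=> h0 _ h1 _; rewrite h1.
rewrite inE negb_or eq_sym => -[h1 h2 h3] /andP[fi hi] b1 b2; split.
- by rewrite b1.
- by rewrite b2.
- by apply: IH => // j hj; apply: b1; apply: leq_trans hj _.
Qed.

Definition push_regs := [:: rp; rx; ry; qsp; qk].
Definition push_arrs := [:: aT; aAT; aST; aSZ].
Definition push_cost := 2 * up_cost h + 200.

Lemma wp_push s k st F rg i z S e t (Q : nat -> ast -> Prop) :
  main_rel s k st F rg -> k < m -> size st <= k -> 0 < i <= m ->
  i \notin items st ->
  [/\ ar s qi = i, ar s qc = rc R i & ar s qd = rd R i] ->
  [/\ ar s rs = S, ar s qz = z, ar s qe = e & ar s qg = 4 * k] ->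
  F S = Some z -> push_cost <= t ->
  (forall r s', t - push_cost <= r -> agree push_regs push_arrs s s' ->
     main_rel s' k.+1 (Frame i k z F :: st) (insert_item R F k i S e) rg -> Q r s') ->
  wp w W push_item s t Q.
Proof.
move=> [rk rsp rNN rkeys rord rpos rtour rline rat rrg rst] hk hst hi his.
move=> [eqi eqc eqd] [ers eqz eqe eqg] hF ht hQ.
have [Yc Yd] := item_Ys hi.
have [pr1 pr2 pr3 pr4] := and4P (hproper hi).
have eC : push_cost = 2 * up_cost h + 200 by [].
set U := up_cost h in ht hQ eC *.
have sub x : x \in [:: rp; rx; ry] -> x \in push_regs.
  by rewrite !inE => /or3P[]->; rewrite ?orbT.
have subj x : x \in [:: aT] -> x \in push_arrs by rewrite !inE => ->.
apply: wp_seq; apply: (wp_sto hW hW100) => //.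
- by ssimp; rewrite eqg; repeat split; lia.
- by side.
apply: wp_seq; apply: (wp_sto hW hW100) => //.
- by ssimp; rewrite eqg; repeat split; lia.
- by side.
ssimp; rewrite ers eqg eqc; set s1 := seta _ _ _ _.
have a1 : agree push_regs push_arrs s s1 by do 2!apply: agree_seta => //; apply: agree_refl.
have epc : ev s1 (AA aPOS (AR qc)) = pos (rc R i).
  by rewrite /s1; ssimp; rewrite eqc rpos.
apply: wp_seq; apply: (@wp_up_max _ _ (rc R i)) => //.
- by rewrite epc; apply: pos_lt; rewrite Yc.
- by move=> s' a'; ssimp; rewrite (proj1 a').
- by rewrite -/U; ssimp; lia.
rewrite epc -/U => r2 s2 hr2 b2 tour2 leaf2.
have a2 : agree push_regs push_arrs s s2.
  by apply: agree_trans a1 _; apply: agree_sub b2.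
pose mid r s3 := [/\ t - push_cost + 60 <= r, agree push_regs push_arrs s s3,
  tourney geq (2 ^ h) (aa s3 aT), ar s3 qsp = size st /\ ar s3 qk = k &
  [/\ forall j, aa s3 aST j = aa s aST j, forall j, aa s3 aSZ j = aa s aSZ j,
     forall y, aa s3 aAT y = if (rd R i < e) && (y == rd R i) then 4 * k + 4
       else if y == rc R i then 4 * k + 3 else if y == S then 4 * k + 2 else aa s aAT y
   & forall q, q < 2 ^ h -> aa s3 aT (2 ^ h + q) =
     if (rd R i < e) && (q == pos (rd R i)) then rd R i
     else if q == pos (rc R i) then rc R i else aa s aT (2 ^ h + q)]].
have fin r s3 : mid r s3 -> wp w W
  (ASto aSZ (AR qi) (AR qz) ;;
  ASet qsp (AR qsp +^ AK 1) ;;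
  ASto aST (AR qsp) (AR qi) ;;
  ASet qk (AR qk +^ AK 1)) s3 r Q.
  move=> [hr a3 tour3 [sp3 k3] [st3 sz3 at3 leaf3]].
  apply: wp_seq; apply: (wp_sto hW hW100) => //; first by side.
  apply: wp_seq; apply: (wp_set hW hW100) => //.
  - by ssimp; rewrite sp3; repeat split; lia.
  - by side.
  apply: wp_seq; apply: (wp_sto hW hW100) => //; first by side.
  apply: (wp_set hW hW100) => //.
  - by ssimp; rewrite k3; repeat split; lia.
  - by side.
  have i3 : ar s3 qi = i by rewrite (proj1 a3).
  have z3 : ar s3 qz = z by rewrite (proj1 a3).
  ssimp; rewrite k3 sp3 i3 z3; set s4 := setr _ _ _.
  have a4 : agree push_regs push_arrs s s4.
    rewrite /s4; repeat first [apply: agree_setr => // | apply: agree_seta => //].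
  apply: hQ => //; first by lia.
  split.
  - by rewrite /s4; ssimp; rewrite addn1.
  - by rewrite /s4; ssimp; rewrite addn1.
  - by rewrite (proj1 a4).
  - exact: keys_agree a4 _ rkeys.
  - by move=> j hj; rewrite (proj2 a4) ?rord.
  - by move=> y; rewrite (proj2 a4).
  - by rewrite /s4; ssimp.
  - exact: (line_push hpos h2m k rline hF).
  - move=> y u; rewrite /s4 /insert_item; ssimp; rewrite at3 andbC.
    rewrite !addnS addn0; case: ifP => [_ [] //|_].
    case: eqP => [_ [] //|_]; case: eqP => [_ [] //|_]; exact: rat.
  - by move=> g; rewrite !(proj2 a4).
  - rewrite /=; split.
    + by rewrite /s4; ssimp; rewrite addn1 eqxx.
    + by rewrite /s4; ssimp; rewrite eqxx.
    apply: stack_rel_push rst his _ _ => j hj; rewrite /s4; ssimp.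
      by rewrite st3; case: eqP => // ej; lia.
    by rewrite (negbTE hj) sz3.
have at2 y : aa s2 aAT y = if y == rc R i then 4 * k + 3 else if y == S then 4 * k + 2 else aa s aAT y.
  by rewrite (proj2 b2).
have d2 : ar s2 qd = rd R i by rewrite (proj1 a2).
have e2 : ar s2 qe = e by rewrite (proj1 a2).
have g2 : ar s2 qg = 4 * k by rewrite (proj1 a2).
apply: wp_seq; apply: (wp_if hW hW100) => //.
- by move: hr2; ssimp; lia.
- ssimp; rewrite d2 e2 => lt.
  have {}lt : rd R i < e by move: lt; case: ltnP.
  apply: wp_seq; apply: (wp_sto hW hW100) => //.
  + by ssimp; rewrite g2; repeat split; lia.
  + by move: hr2; ssimp; lia.
  ssimp; rewrite d2 g2; set s3 := seta _ _ _ _.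
  have a3 : agree push_regs push_arrs s s3 by apply: agree_seta.
  have epd : ev s3 (AA aPOS (AR qd)) = pos (rd R i).
    by rewrite /s3; ssimp; rewrite d2 (proj2 a2) // rpos.
  apply: (@wp_up_max _ _ (rd R i)) => //.
  + by rewrite epd; apply: pos_lt; rewrite Yd.
  + by move=> s' a'; ssimp; rewrite (proj1 a').
  + by rewrite (proj1 a3).
  + by rewrite -/U; move: hr2; ssimp; lia.
  rewrite epd -/U => r4 s4 hr4 b4 tour4 leaf4.
  have a4 : agree push_regs push_arrs s s4.
    by apply: agree_trans a3 _; apply: agree_sub b4.
  apply: fin; split=> //.
  + by move: hr2 hr4; ssimp; lia.
  + by rewrite !(proj1 b4) // /s3; ssimp; rewrite !(proj1 b2).
  split.
  + by move=> j; rewrite (proj2 b4) // /s3; ssimp; rewrite (proj2 b2).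
  + by move=> j; rewrite (proj2 b4) // /s3; ssimp; rewrite (proj2 b2).
  + by move=> y; rewrite (proj2 b4) // /s3; ssimp; rewrite lt at2.
  + by move=> q hq; rewrite leaf4 // lt /s3; ssimp; rewrite leaf2.
ssimp; rewrite d2 e2 => lt.
have {}lt : (rd R i < e) = false by move: lt; case: ltnP.
apply: wp_skip; first by move: hr2; ssimp; lia.
apply: fin; split=> //.
- by move: hr2; ssimp; lia.
- by rewrite !(proj1 b2).
split.
- by move=> j; rewrite (proj2 b2).
- by move=> j; rewrite (proj2 b2).
- by move=> y; rewrite lt at2.
- by move=> q hq; rewrite lt leaf2.
Qed.

End Process.

(** * Output of the coloured regions *)

Definition write_output : acmd :=
  ASet qcnt (AK 0) ;;
  ASet ri (AK 1) ;;
  AWhile (AR ri <^ AK 4 *^ AR qm +^ AK 1)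
    (AIf ((AK 0 <^ AA aRC (AR ri)) *^
          ((AA aX0 (AR ri) <^ AA aX1 (AR ri)) *^
           (AA aY0 (AR ri) <^ AA aY1 (AR ri))))
       (ASto aOUT (AK 4 *^ AR qcnt +^ AK 0) (AA aX0 (AR ri)) ;;
        ASto aOUT (AK 4 *^ AR qcnt +^ AK 1) (AA aX1 (AR ri) -^ AK 1) ;;
        ASto aOUT (AK 4 *^ AR qcnt +^ AK 2) (AA aY0 (AR ri)) ;;
        ASto aOUT (AK 4 *^ AR qcnt +^ AK 3) (AA aY1 (AR ri) -^ AK 1) ;;
        ASet qcnt (AR qcnt +^ AK 1))
       ASkip ;;
     ASet ri (AR ri +^ AK 1)).

Definition sweep_program : acmd :=
  load_rects ;; make_size ;; make_positions ;;
  sort_items better_x (AR qm) ;;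
  ASet qk (AK 0) ;; ASet qsp (AK 0) ;;
  process_items ;; write_output.

Definition emitted (rg : regions) (g : nat) : bool :=
  [&& 0 < rcol rg g, x0 rg g < x1 rg g & y0 rg g < y1 rg g].

(** The output format wants inclusive ranks; truncation does no harm, as emitted regions are
    nonempty. *)
Definition out_record rg g : seq nat :=
  [:: x0 rg g; x1 rg g - 1; y0 rg g; y1 rg g - 1].

(** The scan starts at [1] because region [0] has colour [0]; this leaves at most [4 * m]
    bicliques. *)
Definition output_is s m rg : Prop :=
  let gs := [seq g <- iota 1 (4 * m) | emitted rg g] in
  ar s qcnt = size gs /\
  forall j i, j < size gs -> i < 4 ->
    aa s aOUT (4 * j + i) = nth 0 (out_record rg (nth 0 gs j)) i.

Section Run.
Variables (w W : nat).
Hypothesis hW : num_arrays * W <= 2 ^ w.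
Hypothesis hW100 : 100 < W.
Variables (n m : nat) (R : rects).
Hypothesis hWn : 20 * n + 40 * m + 80 <= W.
Hypothesis hproper : forall i, 0 < i <= m -> proper_rect n R i.
Hypothesis hn : 0 < n.

Lemma wp_write_output s rg t (Q : nat -> ast -> Prop) :
  ar s qm = m -> region_rel s rg -> 1000 * m.+1 <= t ->
  (forall r s', t - 1000 * m.+1 <= r -> agree [:: qcnt; ri] [:: aOUT] s s' ->
     output_is s' m rg -> Q r s') ->
  wp w W write_output s t Q.
Proof.
clear hproper hn.
move=> em rrg ht hQ.
do 2!(apply: wp_seq; apply: (wp_set hW hW100) => //; first by side).
ssimp.
pose gsi i := [seq g <- iota 1 i | emitted rg g].
have gsz i : size (gsi i) <= i by rewrite size_filter -[X in _ <= X](size_iota 1 i) count_size.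
have gsS i : gsi i.+1 = if emitted rg i.+1 then rcons (gsi i) i.+1 else gsi i.
  by rewrite /gsi -[X in iota 1 X]addn1 iotaD filter_cat /= add1n; case: ifP; rewrite ?cats1 ?cats0.
pose J t' s' := exists i,
  [/\ ar s' ri = i.+1, i <= 4 * m, t - 1000 * m.+1 + 220 * (4 * m - i) + 50 <= t',
      agree [:: qcnt; ri] [:: aOUT] s s' &
      ar s' qcnt = size (gsi i) /\
      forall j k, j < size (gsi i) -> k < 4 ->
        aa s' aOUT (4 * j + k) = nth 0 (out_record rg (nth 0 (gsi i) j)) k].
apply: (wp_while hW hW100 (I := J)); last first.
  exists 0; ssimp; split=> //; first by lia.
  by do 2!apply: agree_setr => //; apply: agree_refl.
move=> {}t' s' [i [ei hi htt ag [ec hout]]].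
have em' : ar s' qm = m by rewrite (proj1 ag).
split.
- by ssimp; rewrite em'; repeat split; lia.
- by ssimp; lia.
- ssimp; rewrite ei em' => hge.
  have ei' : i = 4 * m by move: hge; case: ltnP => //; lia.
  by rewrite ei' in ec hout *; apply: hQ => //; lia.
ssimp; rewrite ei em' => hlt; have {}hlt : i < 4 * m by move: hlt; case: ltnP => //; lia.
have [G0 G1 G2 G3 G4] := rrg i.+1.
have A0 : aa s' aX0 i.+1 = x0 rg i.+1 by rewrite (proj2 ag).
have A1 : aa s' aX1 i.+1 = x1 rg i.+1 by rewrite (proj2 ag).
have A2 : aa s' aY0 i.+1 = y0 rg i.+1 by rewrite (proj2 ag).
have A3 : aa s' aY1 i.+1 = y1 rg i.+1 by rewrite (proj2 ag).
have A4 : aa s' aRC i.+1 = rcol rg i.+1 by rewrite (proj2 ag).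
have fin r s2 : agree [:: qcnt; ri] [:: aOUT] s s2 -> ar s2 ri = i.+1 ->
    t - 1000 * m.+1 + 220 * (4 * m - i.+1) + 60 <= r ->
    ar s2 qcnt = size (gsi i.+1) ->
    (forall j k, j < size (gsi i.+1) -> k < 4 ->
        aa s2 aOUT (4 * j + k) = nth 0 (out_record rg (nth 0 (gsi i.+1) j)) k) ->
    wp w W (ASet ri (AR ri +^ AK 1)) s2 r J.
  move=> ag2 e2 hr c2 o2; apply: (wp_set hW hW100) => //.
  - by ssimp; rewrite e2; repeat split; lia.
  - by ssimp; lia.
  ssimp; rewrite e2; exists i.+1; ssimp; split=> //; try lia.
  by apply: agree_setr.
have hcz := gsz i.
have hemit : (0 < rcol rg i.+1) * ((x0 rg i.+1 < x1 rg i.+1) * (y0 rg i.+1 < y1 rg i.+1))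
   = emitted rg i.+1.
  by rewrite /emitted; do 3!case: (_ < _).
apply: wp_seq; apply: (wp_if hW hW100) => //.
- ssimp; repeat split=> //; apply: leq_ltn_trans hW100.
    all: repeat match goal with |- context [nat_of_bool ?b] =>
      match b with context [aa] => generalize b end end.
  + by do 2!case.
  + by do 3!case.
- by ssimp; lia.
- ssimp; rewrite ei A0 A1 A2 A3 A4 hemit => he.
  have {}he : emitted rg i.+1 by move: he; case: (emitted _ _).
  apply: wp_seq; apply: (wp_sto hW hW100) => //.
  + by ssimp; rewrite ec; repeat split; lia.
  + by ssimp; lia.
  apply: wp_seq; apply: (wp_sto hW hW100) => //.
  + by ssimp; rewrite ec; repeat split; lia.
  + by ssimp; lia.
  apply: wp_seq; apply: (wp_sto hW hW100) => //.
  + by ssimp; rewrite ec; repeat split; lia.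
  + by ssimp; lia.
  apply: wp_seq; apply: (wp_sto hW hW100) => //.
  + by ssimp; rewrite ec; repeat split; lia.
  + by ssimp; lia.
  apply: (wp_set hW hW100) => //.
  + by ssimp; rewrite ec; repeat split; lia.
  + by ssimp; lia.
  ssimp; rewrite ec ei A0 A1 A2 A3; apply: fin.
  + by repeat first [apply: agree_setr => // | apply: agree_seta => //].
  + by ssimp.
  + by ssimp; lia.
  + by ssimp; rewrite gsS he size_rcons addn1.
  rewrite gsS he size_rcons => j k hj hk; ssimp.
  rewrite nth_rcons.
  have [->|nj] := eqVneq j (size (gsi i)).
    rewrite ltnn !eqn_add2l.
    by case: k hk => [|[|[|[|//]]]].
  have hj' : j < size (gsi i) by lia.
  rewrite hj' -hout //.
  by do 4!(case: eqP => [?|_]; first lia).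
ssimp; rewrite ei A0 A1 A2 A3 A4 hemit => he.
have {}he : emitted rg i.+1 = false by move: he; case: (emitted _ _).
apply: wp_skip; first by lia.
by apply: fin; rewrite ?gsS ?he //; lia.
Qed.

(** * The sweep over all items, with amortized cost *)

Section Items.
Variables (h : nat) (pos : nat -> nat) (o : seq nat).
Hypothesis hpos : good_pos m R pos.
Hypothesis h2m : 2 * m < 2 ^ h.
Hypothesis hN : 2 ^ h <= 4 * m + 1.
Hypothesis ho : perm_eq o (iota 1 m).
Hypothesis hsorted : pairwise (nested_or_apart R) o.
Notation Ys := (Ys m R).

Definition item_cost := pop_cost h + push_cost h + up_cost h + 1000.
Definition items_cost := m * item_cost + 50.

Lemma size_o : size o = m.
Proof. by rewrite (perm_size ho) size_iota. Qed.

Lemma o_range i : i \in o -> 0 < i <= m.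
Proof. by rewrite (perm_mem ho) mem_iota; lia. Qed.

Lemma uniq_o : uniq o.
Proof. by rewrite (perm_uniq ho) iota_uniq. Qed.

Lemma nth_o_range k : k < m -> 0 < nth 0 o k <= m.
Proof. by move=> hk; apply: o_range; rewrite mem_nth ?size_o. Qed.

Lemma o_before r k : k < m -> r \in take k o -> nested_or_apart R r (nth 0 o k).
Proof.
move=> hk; have hs : k < size o by rewrite size_o.
move: hsorted; rewrite -{1}(cat_take_drop k o) (drop_nth 0 hs).
by rewrite pairwise_cat => /and3P[/allrelP h1 _ _] hr; apply: h1 => //; rewrite inE eqxx.
Qed.

Lemma o_mono j k : j <= k -> k < m -> ra R (nth 0 o j) <= ra R (nth 0 o k).
Proof.
rewrite leq_eqVlt => /orP[/eqP->//|hjk] hk.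
have hj : nth 0 o j \in take k o.
  by rewrite -(nth_take 0 hjk); apply: mem_nth; rewrite size_takel ?size_o // ltnW.
have := o_before hk hj; have := hproper (nth_o_range (ltn_trans hjk hk)).
by rewrite /nested_or_apart /proper_rect; lia.
Qed.

Lemma wp_process_items s t (Q : nat -> ast -> Prop) :
  main_rel n m h R pos o s 0 [::] root_sweep (root_regions n) -> items_cost <= t ->
  (forall r s' rg, t - items_cost <= r -> ar s' qm = m ->
     (forall i, aa s' aIN i = aa s aIN i) ->
     region_rel s' rg -> tiles n R m o rg -> Q r s') ->
  wp w W process_items s t Q.
Proof.
move=> mr0 ht hQ.
set IC := item_cost; set PC := pop_cost h + 20.
have eIC : IC = PC + push_cost h + up_cost h + 980 by rewrite /IC /item_cost /PC; lia.
have eC : items_cost = m * IC + 50 by [].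
(* Besides the budget of the items to come, the invariant holds [PC] in reserve for every item on
   the stack: the cost of its removal and of one evaluation of the inner guard. *)
pose J t' s' := exists k st F rg a,
  [/\ k <= m, main_rel n m h R pos o s' k st F rg,
      stacked n R Ys k rg F st a, tiles n R k (take k o) rg &
  [/\ {subset items st <= take k o}, size st <= k,
      forall j, k <= j < m -> a <= ra R (nth 0 o j),
      forall i, aa s' aIN i = aa s aIN i
    & t - items_cost + ((m - k) * IC + size st * PC + 40) <= t']].
apply: (wp_while hW hW100 (I := J)); last first.
  exists 0, [::], root_sweep, (root_regions n), 0; split=> //.
  - exact: stacked_root.
  - by rewrite take0; apply: tiles_root.
  by split=> //; rewrite /= subn0; lia.
move=> {}t' s' [k [st [F [rg [a [hk mr hst htl [hit hsz ha hin htt]]]]]]].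
have [km kn [k0 k0'] kr] := main_keys mr; have ek := main_k mr.
have htt0 : 40 <= t' by lia.
split.
- by [].
- by ssimp; lia.
- ssimp; rewrite ek km => hge.
  have ekm : k = m by move: hge; case: ltnP => //; lia.
  apply: (hQ _ _ rg) => //; first by lia.
    exact: main_rg mr.
  by move: htl; rewrite ekm take_oversize ?size_o.
ssimp; rewrite ek km => hlt; have {hlt} {}hk : k < m by move: hlt; case: ltnP.
set i := nth 0 o k.
have hi : 0 < i <= m by apply: nth_o_range.
have hpr := hproper hi; have [pr1 pr2 pr3 pr4] := and4P hpr.
have [Yc Yd] := item_Ys R hi.
set M := (m - k.+1) * IC.
have {}htt : t - items_cost + (M + IC + size st * PC + 40) <= t'.
  by move: htt; rewrite (_ : m - k = (m - k.+1).+1) ?mulSn -/M; lia.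
have [kA kB kC kD kcol] := kr _ hi.
have ord := main_ord mr hk.
set SP := size st * PC in htt.
apply: wp_seq; rewrite /load_item.
do 4!(apply: wp_seq; apply: (wp_set hW hW100) => //; first by side).
apply: (wp_set hW hW100) => //; first by side.
ssimp; rewrite ek ord -/i kA kB kC kD; set s1 := setr _ qd _.
have {}htt : t - items_cost + (M + PC + push_cost h + up_cost h + 800 + SP) <= 
  t' - (1 + 1).+2 - (5 + 1).+1 - (5 + 1).+1 - (5 + 1).+1 - (5 + 1).+1 - (5 + 1).+1 by lia.
move: (t' - _ - _ - _ - _ - _ - _) htt => t1 htt; rewrite {}/SP in htt.
have ra_le : a <= ra R i by apply: ha; rewrite leqnn.
have b1 : agree [:: qi; qa; qb; qc; qd] [::] s' s1.
  by do 5!apply: agree_setr => //; apply: agree_refl.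
have mr1 : main_rel n m h R pos o s1 k st F rg.
  case: mr => r1 r2 r3 r4 r5 r6 r7 r8 r9 r10 r11; split=> //.
  exact: stack_rel_agree b1 _ r11.
pose J1 t'' s'' := exists st F,
  [/\ main_rel n m h R pos o s'' k st F rg,
      stacked n R Ys k rg F st (ra R i), {subset items st <= take k o},
      size st <= k &
   agree pop_regs pop_arrs s1 s'' /\
   t - items_cost + (M + PC + push_cost h + up_cost h + 780 + size st * PC) <= t''].
apply: wp_seq; apply: (wp_while hW hW100 (I := J1)); last first.
  exists st, F; split=> //; first exact: stacked_leq hst.
  by split=> //; lia.
move=> {mr hst hit hsz htt F st a ha ra_le mr1} t2 s2 [st [F [mr hst hit hsz [b2 htt]]]].
have eqa : ar s2 qa = ra R i by rewrite (proj1 b2).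
have htop : aa s2 aKB (aa s2 aST (ar s2 qsp)) = stack_end n R st.
  rewrite (main_sp mr); have := main_st mr; have [_ _ [_ q0] qr] := main_keys mr.
  case: (st) hit => [|f st'] hit /=; first by move=> ->.
  case=> -> _ _; have [|_ -> _ _ _] := qr (item f); last by [].
  by apply: o_range; apply: (@mem_take k); apply: hit; rewrite inE eqxx.
have ht2 : 700 <= t2.
  by set X := size st * PC in htt; lia.
split.
- by ssimp; rewrite eqa; repeat split=> //; lia.
- by ssimp; lia.
- ssimp; rewrite htop eqa => hge.
  have {}hge : ra R i < stack_end n R st by move: hge; case: ltnP => //; lia.
  have hlin := main_line mr; have hsw := stacked_swept hst.
  have [pb pmono p0] := hpos.
  have epc : ev s2 (AA aPOS (AR qc)) = pos (rc R i).
    by ssimp; rewrite (proj1 b2) // (main_pos mr).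
  have [eU hNW'] : 200 <= up_cost h /\ 2 ^ h.+1 < W.
    by rewrite /up_cost expnS; lia.
  set SP := size st * PC in htt.
  apply: wp_seq; apply: (@wp_query w W hW hW100 h) => //.
  + by rewrite epc; have := pb _ Yc; lia.
  + exact: main_N mr.
  + exact: main_tour mr.
  + by ssimp; lia.
  rewrite epc => r3 s3 hr3 b3 hmax [q hq eS].
  set S := ar s3 rs in hmax eS *.
  (* The answer [0] may come from an empty leaf, but ordinate [0] is always active: the region
     covering it starts there. *)
  have hF : exists z, F S = Some z.
    have [e0|[_ _]] := line_leaf hlin (q := q) ltac:(have := pb _ Yc; lia).
      rewrite -/(aa s2 8 _) -eS in e0.
      have [y' [z [hz hy' _]]] := swept_cover hsw hn.
      by exists z; rewrite e0 -(_ : y' = 0) //; lia.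
    by rewrite -eS; case: (F S) => // z _; exists z.
  case: hF => z hF.
  have hSc : S <= rc R i.
    have [e0|[YS pS _]] := line_leaf hlin (q := q) ltac:(have := pb _ Yc; lia).
      by rewrite eS e0.
    rewrite -/(aa s2 8 _) -eS in YS pS.
    by case: leqP => // lt; have := pmono _ _ Yc YS lt; lia.
  have hSmax y z' : F y = Some z' -> y <= rc R i -> y <= S.
    move=> hy hyc; have [_ _ _ _ /orP[/eqP->//|Yy]] := swept_y hsw hy.
    have hpy : pos y <= pos (rc R i).
      move: hyc; rewrite leq_eqVlt => /orP[/eqP->//|lt].
      by apply: ltnW; apply: pmono.
    have := hmax _ hpy.
    by have := line_active hlin Yy; rewrite hy => /(_ isT) ->.
  have hnest f : f \in [seq item f | f <- st] ->
      proper_rect n R f && nested_or_apart R f i.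
    move=> hf; have hf' := hit _ hf.
    by rewrite hproper ?o_before //; apply: o_range; apply: (@mem_take k).
  have hYs : Ys (rc R i) && Ys (rd R i) by rewrite Yc Yd.
  have [hz hx0 hx1 hy0 hy1] :=
    push_inside hst (leqnn _) hpr hge hnest hYs hSc hF hSmax.
  have hstk := stacked_push hst (leqnn _) hpr hge hnest hYs hSc hF hSmax.
  have htl' := tiles_split htl hpr hz hx0 hx1 hy0 hy1.
  have ez : y0 rg z = S by have [] := swept_y hsw hF.
  have b13 : agree [:: rp; rx; ry; qu; qv; qsp; rs] pop_arrs s1 s3.
    apply: (@agree_trans _ _ _ s2).
      by apply: agree_sub b2; apply/allP.
    by apply: agree_sub b3; apply/allP.
  have mr3 : main_rel n m h R pos o s3 k st F rg.
    have a3 j u : aa s3 j u = aa s2 j u by rewrite (proj2 b3).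
    case: mr => r1 r2 r3' r4 r5 r6 r7 r8 r9 r10 r11; split.
    * by rewrite (proj1 b3).
    * by rewrite (proj1 b3).
    * by rewrite (proj1 b3).
    * exact: keys_agree b3 _ r4.
    * by move=> j hj; rewrite a3 r5.
    * by move=> y; rewrite a3.
    * by move=> p hp; rewrite !a3; apply: r7.
    * case: r8 => l1 l2; split=> [q' hq'|y hy hFy]; rewrite /= ?a3; [exact: l1|exact: l2].
    * by move=> y u hu; rewrite a3; apply: r9.
    * by move=> g; rewrite !a3.
    * exact: stack_rel_agree b3 _ r11.
  apply: wp_seq; apply: (wp_split_region hW hW100 hWn h2m hN (i := i) (z := z) mr3) => //.
  + by split; rewrite (proj1 b13).
  + by rewrite ez.
  + by move: hr3; ssimp; lia.
  move=> r4 s4 hr4 b4 [eqz eqe eqg] rrg4.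
  have mr4 : main_rel n m h R pos o s4 k st F (split_at R k i z rg).
    case: mr3 => r1 r2 r3' r4' r5 r6 r7 r8 r9 r10 r11; split.
    * by rewrite (proj1 b4).
    * by rewrite (proj1 b4).
    * by rewrite (proj1 b4).
    * exact: keys_agree b4 _ r4'.
    * by move=> j hj; rewrite (proj2 b4) // r5.
    * by move=> y; rewrite (proj2 b4).
    * by move=> p hp; rewrite !(proj2 b4) //; apply: r7.
    * case: r8 => l1 l2; split=> [q' hq'|y hy hFy]; rewrite /= ?(proj2 b4) //; [exact: l1|exact: l2].
    * by move=> y u hu; rewrite (proj2 b4) //; apply: r9.
    * by [].
    * exact: stack_rel_agree b4 _ r11.
  have hi_st : i \notin items st.
    apply/negP => /hit hik; have := uniq_o.
    rewrite -(cat_take_drop k o) (drop_nth 0) ?size_o // cat_uniq.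
    by case/and3P=> _ /hasPn /(_ i); rewrite inE eqxx /= hik => /(_ isT).
  apply: (wp_push hW hW100 hWn hproper hpos h2m hN (i := i) (z := z) (S := S) (e := y1 rg z) mr4) => //.
  + by split; rewrite (proj1 b4) // (proj1 b13).
  + by split=> //; rewrite (proj1 b4).
  + by move: hr3 hr4; ssimp; lia.
  move=> r5 s5 hr5 b5 mr5.
  exists k.+1, (Frame i k z F :: st), (insert_item R F k i S (y1 rg z)), (split_at R k i z rg), (ra R i).
  have tk : take k.+1 o = rcons (take k o) i by rewrite (take_nth 0) ?size_o.
  split=> //; first by rewrite tk.
  split.
  + move=> x; rewrite tk mem_rcons !inE => /orP[->//|/hit->]; by rewrite orbT.
  + by rewrite /=; lia.
  + by move=> j hj; apply: o_mono; lia.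
  + by move=> j; rewrite (proj2 b5) // (proj2 b4) // (proj2 b13) // hin.
  + by rewrite -/M /= mulSn -/SP; move: hr3 hr4 hr5; ssimp; lia.
ssimp; rewrite htop eqa => hlt.
case: st mr hst hit hsz htop hlt htt => [|f st] mr hst hit hsz htop hlt htt.
  by move: hlt; rewrite /=; case: ltnP => //; lia.
have {}hlt : rb R (item f) <= ra R i by move: hlt; rewrite /=; case: ltnP => //; lia.
have hf : 0 < item f <= m.
  by apply: o_range; apply: (@mem_take k); apply: hit; rewrite inE eqxx.
rewrite [size (f :: st)]/= mulSn in htt; set SP := size st * PC in htt.
apply: (wp_pop hW hW100 hWn hproper hpos h2m hN mr hst hf).
  by rewrite /PC in htt; lia.
move=> r s3 hr b3 mr3; exists st, (before f); split=> //.
- exact: stacked_pop hst hlt.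
- by move=> x hx; apply: hit; rewrite inE hx orbT.
- by move: hsz => /=; lia.
split; first exact: agree_trans b2 b3.
by rewrite -/SP; rewrite {1}/PC in htt; lia.
Qed.

End Items.

End Run.

(** * The array program as a whole *)

Definition time_bound m := 4000 * (m.+1 * (trunc_log 2 m + 5)).

Definition is_sweep_order R m o : bool :=
  perm_eq o (iota 1 m) && pairwise (rlex_le R) o.

Section Whole.
Variables (w W : nat).
Hypothesis hW : num_arrays * W <= 2 ^ w.
Hypothesis hW100 : 100 < W.
Variables (n m mA nn : nat) (I : nat -> nat) (R : rects).
Hypothesis hWn : 20 * n + 40 * m + 80 <= W.
Hypothesis hIpb : 4 + n + 5 * nn + 2 * m < W.
Hypothesis hmA : mA <= m.
Hypothesis hinput : forall i, 0 < i <= m -> input_rect W n mA nn I R i.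
Hypothesis hproper : forall i, 0 < i <= m -> proper_rect n R i.
Hypothesis hn : 0 < n.
Hypothesis hlex : forall i j, 0 < i <= m -> 0 < j <= m -> i != j ->
  rlex_le R i j -> nested_or_apart R i j.

Definition init_ast : ast := ASt (fun=> 0) (fun j i => if j == 0 then I i else 0).

Lemma sweep_order_nested o : is_sweep_order R m o -> pairwise (nested_or_apart R) o.
Proof.
clear hW hW100 hWn hIpb hmA hinput hproper hn.
case/andP=> po; have uo : uniq o by rewrite (perm_uniq po) iota_uniq.
have : all (fun i => 0 < i <= m) o.
  by apply/allP => i; rewrite (perm_mem po) mem_iota; lia.
elim: (o) uo => //= i o' IH /andP[hi uo'] /andP[ri ro'] /andP[li lo'].
rewrite IH // andbT; apply/allP => j jo; apply: hlex => //.
- exact: (allP ro').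
- by apply: contraNneq hi => ->.
- exact: (allP li).
Qed.

Lemma time_bound_total h : h <= trunc_log 2 m + 2 ->
  load_cost m + 40 * (trunc_log 2 m + 4) + positions_cost m h + sort_cost h m + 10
  + items_cost m h + 1000 * m.+1 <= time_bound m.
Proof.
clear; set L := trunc_log 2 m => hh.
rewrite /load_cost /positions_cost /sort_cost /items_cost /item_cost /pop_cost /push_cost /time_bound.
have : up_cost h <= 200 * (L + 4) by rewrite /up_cost; lia.
by move: (up_cost h) => U hU; nia.
Qed.

Lemma wp_sweep_program t (Q : nat -> ast -> Prop) :
  [/\ I 0 = n, I 1 = nn, I 2 = mA & I 3 = m - mA] ->
  time_bound m <= t ->
  (forall r s rg o, (forall i, aa s aIN i = I i) -> is_sweep_order R m o ->
     tiles n R m o rg -> output_is s m rg -> Q r s) ->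
  wp w W sweep_program init_ast t Q.
Proof.
move=> hI ht hQ; set L := trunc_log 2 m.
have htot := time_bound_total.
(* The exponent [h] is unknown before [make_size] has run; to bound the cost of the initial phases,
   [0] will do. *)
have htL : load_cost m + 40 * (L + 4) <= t.
  by apply: leq_trans ht; have := htot 0 isT; rewrite /L; lia.
apply: wp_seq; apply: (wp_load_rects hW hW100 hWn hIpb hmA hinput hproper) => //.
  by lia.
move=> r1 s1 hr1 a1 ks1 yk1 X1 Y1.
apply: wp_seq; apply: (wp_make_size hW hW100 hWn) => //.
- exact: keys_m ks1.
- by rewrite -/L; lia.
rewrite -/L => r2 s2 h hr2 a2 eN hh h2m hN.
have {}htot := leq_trans (htot h hh) ht; rewrite -/L in htot.
have ks2 : keys n m R s2 by apply: keys_agree a2 _ ks1.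
apply: wp_seq; apply: (wp_make_positions hW hW100 hWn hproper (h := h)) => //.
- exact: keys_m ks2.
- case: yk1 => y1 y2; split; first by rewrite (proj2 a2).
  by move=> i hi; rewrite !(proj2 a2) //; apply: y2.
- by move=> y; rewrite (proj2 a2) // (proj2 a1).
- by move=> y; rewrite (proj2 a2) // (proj2 a1).
- by lia.
move=> r3 s3 hr3 a3 hT3 hpos.
have ks3 : keys n m R s3 by apply: keys_agree a3 _ ks2.
have eN3 : ar s3 rN = 2 ^ h by rewrite (proj1 a3).
apply: wp_seq; apply: (wp_sort_rects hW hW100 hWn hproper (h := h)) => //.
  by lia.
move=> r4 s4 o hr4 a4 hT4 po pw hord.
have so : is_sweep_order R m o by rewrite /is_sweep_order po.
have ks4 : keys n m R s4 by apply: keys_agree a4 _ ks3.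
do 2!(apply: wp_seq; apply: (wp_set hW hW100) => //; first by ssimp; lia).
ssimp; set s5 := setr _ _ _.
have a5 : agree [:: qk; qsp] [::] s4 s5 by do 2!apply: agree_setr => //; apply: agree_refl.
(* Memory after the input is initially [0], and none of these arrays has been written yet. *)
have zero j y : j \notin [:: aIN; aT; aORD; aPOS] ++ larrs -> aa s5 j y = 0.
  rewrite mem_cat negb_or => /andP[hj1 hj2].
  move: hj1; rewrite !inE !negb_or => /and4P[n1 n2 n3 n4].
  rewrite (proj2 a5) // (proj2 a4) ?inE ?negb_or ?n2 ?n3 //.
  rewrite (proj2 a3) ?inE ?negb_or ?n2 ?n3 //= ?n4 //.
  by rewrite (proj2 a2) // (proj2 a1) //= (negbTE n1).
have inp i : aa s5 aIN i = I i.
  by rewrite (proj2 a5) // (proj2 a4) // (proj2 a3) // (proj2 a2) // (proj2 a1).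
have X15 g : aa s5 aX1 g = if g == 0 then n else 0.
  by rewrite (proj2 a5) // (proj2 a4) // (proj2 a3) // (proj2 a2) // X1.
have Y15 g : aa s5 aY1 g = if g == 0 then n else 0.
  by rewrite (proj2 a5) // (proj2 a4) // (proj2 a3) // (proj2 a2) // Y1.
have e2 : 2 ^ h.+1 = 2 * 2 ^ h by rewrite expnS.
have mr : main_rel n m h R (aa s3 aPOS) o s5 0 [::] root_sweep (root_regions n).
  split.
  - by [].
  - by [].
  - by rewrite (proj1 a5) // (proj1 a4).
  - exact: keys_agree a5 _ ks4.
  - by move=> j hj; rewrite (proj2 a5) // hord.
  - by move=> y; rewrite (proj2 a5) // (proj2 a4).
  - by move=> p hp; rewrite !(proj2 a5) // !hT4 ?e2 ?if_same //; lia.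
  - split=> [q hq|y hy]; first by left; rewrite (proj2 a5) // hT4 // e2; lia.
    rewrite /root_sweep; case: eqP hy => // -> /(pos_neq0 hpos).
    by case: hpos => _ _ ->.
  - by move=> y z; rewrite /root_sweep; case: eqP => // -> [<-]; apply: zero.
  - by move=> g; split; rewrite ?X15 ?Y15 //; apply: zero.
  - by rewrite /=; apply: zero.
apply: wp_seq; apply: (wp_process_items hW hW100 hWn hproper hn hpos h2m hN po
  (sweep_order_nested so) mr).
  by ssimp; lia.
move=> r6 s6 rg hr6 em6 hin6 rrg tl.
apply: (wp_write_output hW hW100 hWn em6 rrg).
  by move: hr6; ssimp; lia.
move=> r7 s7 hr7 a7 out7; apply: (hQ _ _ rg o) => //.
by move=> i; rewrite (proj2 a7) // hin6.
Qed.

End Whole.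

(** * The program on the word RAM *)

Definition size_expr : expr :=
  Bin Add (Bin Add (Const 4) (Fetch (Const 0)))
    (Bin Add (Bin Mul (Const 5) (Fetch (Const 1)))
             (Bin Mul (Const 2) (Bin Add (Fetch (Const 2)) (Fetch (Const 3))))).

(** The width [W] is computed from the header of the input. Register 0 receives [4], as the leaf
    sequence within the input already is the list of vertices in increasing order; register 2
    receives [W], the address of array [1], which holds the output. *)
Definition program : cmd :=
  Seq (Assign 3 (Bin Mul (Const 20) size_expr))
  (Seq (ccmd sweep_program)
  (Seq (Assign 0 (Const 4)) (Assign 2 (Reg 3)))).

Lemma exec_program w (inp : seq nat) n m mA nn (R : rects) :
  let W := 20 * size inp in
  let I := nth 0 inp in
  num_arrays * W <= 2 ^ w -> 0 < n -> 0 < nn -> mA <= m ->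
  size inp = 4 + n + 5 * nn + 2 * m ->
  [/\ I 0 = n, I 1 = nn, I 2 = mA & I 3 = m - mA] ->
  (forall i, I i <= size inp) ->
  (forall i, 0 < i <= m -> input_rect W n mA nn I R i) ->
  (forall i, 0 < i <= m -> proper_rect n R i) ->
  (forall i j, 0 < i <= m -> 0 < j <= m -> i != j ->
     rlex_le R i j -> nested_or_apart R i j) ->
  exists t s rg o,
    [/\ exec w program (init_state inp) t s, t <= time_bound m + 100,
        is_sweep_order R m o, tiles n R m o rg &
    let gs := [seq g <- iota 1 (4 * m) | emitted rg g] in
    [/\ reg s 1 = size gs,
        forall i, i < n -> Defs.mem s (reg s 0 + i) = I (4 + i)
      & forall j i, j < size gs -> i < 4 ->
          Defs.mem s (reg s 2 + 4 * j + i) = nth 0 (out_record rg (nth 0 gs j)) i]].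
Proof.
move=> W I hW hn hnn hmA hsz hI hIb hin hpr hlex.
have hD : 10 <= size inp by lia.
have W100 : 100 < W by rewrite /W; lia.
have h2w : W < 2 ^ w by move: hW W100; rewrite /num_arrays; lia.
have hWn : 20 * n + 40 * m + 80 <= W by rewrite /W; lia.
have hIpb : 4 + n + 5 * nn + 2 * m < W by rewrite /W; lia.
case: (hI) => I0 I1 I2 I3.
set st1 := State (upd (reg (init_state inp)) 3 W) (Defs.mem (init_state inp)).
have ex1 : exec w (Assign 3 (Bin Mul (Const 20) size_expr)) (init_state inp)
    (ecost (Bin Mul (Const 20) size_expr)).+1 st1.
  have e : eval w (init_state inp) (Bin Mul (Const 20) size_expr) = W.
    have mods x : x <= W -> x %% 2 ^ w = x by move=> hx; apply: modn_small; lia.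
    rewrite /size_expr /= (mods 0) ?(mods 1) ?(mods 2) ?(mods 3) ?(mods 4) ?(mods 5) ?(mods 20) ?(mods 2); try lia.
    rewrite -/I I0 I1 I2 I3.
    have -> : mA + (m - mA) = m by lia.
    rewrite (mods m) ?(mods (5 * nn)) ?(mods (2 * m)) ?(mods (4 + n)); try lia.
    rewrite (mods (5 * nn + 2 * m)); last by lia.
    rewrite addnA -hsz !mods /W; lia.
  by rewrite /st1 -e; apply: ExecAssign.
(* Array [0] is the input in place; all other arrays start at or after address [W], past its end,
   where memory is [0]. *)
have rep : represents W st1 (init_ast I).
  split=> //=.
  - by move=> r hr; rewrite /upd (negbTE hr).
  - move=> j i hj hi; case: eqP => [->|j0]; first by rewrite mul0n.
    apply: nth_default; apply: leq_trans (leq_addr _ _).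
    by rewrite /W; nia.
  - by lia.
  - move=> j i _ _; case: eqP => _; last by lia.
    by have := hIb i; rewrite /W; lia.
pose Q (r : nat) s := exists rg o, [/\ forall i, aa s aIN i = I i, is_sweep_order R m o,
  tiles n R m o rg & output_is s m rg].
have [|t2 [st2 [r2 [s2 [ex2 ht2 rep2 [rg [o [hin2 so tl out2]]]]]]]] :=
  @wp_sweep_program w W hW W100 n m mA nn I R hWn hIpb hmA hin hpr hn hlex (time_bound m) Q hI (leqnn _) _ _ rep.
  by move=> r s rg o *; exists rg, o.
case: rep2 => g3 gr gm _ _.
set st3 := State (upd (reg st2) 0 4) (Defs.mem st2).
set st4 := State (upd (reg st3) 2 W) (Defs.mem st2).
have ex3 : exec w (Assign 0 (Const 4)) st2 2 st3.
  have := ExecAssign w st2 0 (Const 4); rewrite /= modn_small //; lia.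
have ex4 : exec w (Assign 2 (Reg 3)) st3 2 st4.
  have e : reg st3 3 = W by rewrite /st3 /= /upd /= g3.
  by rewrite /st4 -[X in upd _ _ X]e; apply: (ExecAssign w st3 2 (Reg 3)).
exists ((ecost (Bin Mul (Const 20) size_expr)).+1 + (t2 + (2 + 2))), st4, rg, o.
split=> //.
- apply: ExecSeq ex1 _; apply: ExecSeq ex2 _; exact: ExecSeq ex3 ex4.
- by rewrite /=; lia.
case: out2 => ec hout; rewrite /=; split.
- by rewrite /upd /= gr // ec.
- move=> i hi; rewrite /upd /= -hin2 -gm ?mul0n //; rewrite /W; lia.
- move=> j i hj hi; rewrite /upd /= -hout // -gm ?mul1n ?addnA //.
  have : size [seq g <- iota 1 (4 * m) | emitted rg g] <= 4 * m.
    by rewrite size_filter -[X in _ <= X](size_iota 1 (4 * m)) count_size.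
  by lia.
Qed.

(** * The rectangles of a signed tree model *)

Lemma set2_eq (K : finType) (a b u v : K) : u != v -> [set a; b] = [set u; v] ->
  (a = u /\ b = v) \/ (a = v /\ b = u).
Proof.
move=> uv e.
have hu : u \in [set a; b] by rewrite e set21.
have hv : v \in [set a; b] by rewrite e set22.
have ha : a \in [set u; v] by rewrite -e set21.
have hb : b \in [set u; v] by rewrite -e set22.
move: hu hv ha hb; rewrite !inE => hu hv /orP[]/eqP ea /orP[]/eqP eb; subst a b.
- by move: hv; rewrite orbb eq_sym (negbTE uv).
- by left.
- by right.
- by move: hu; rewrite orbb (negbTE uv).
Qed.

Section Model.
Variables (n : nat) (T : bintree 'I_n) (A B : {set {set node T}}).
Variables (sA sB : seq (node T * node T)).
Hypothesis hmodel : signed_tree_model A B.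
Hypothesis huniq : uniq (leaves T).
Hypothesis hall : forall x, x \in leaves T.
Hypotheses (hsA : lists_pairs sA A) (hsB : lists_pairs sB B).
Implicit Types (u v : node T) (e : node T * node T).

Definition lo u : nat := start T (val u).
Definition hi u : nat := stop T (val u).

Definition orient e : node T * node T := if hi e.1 <= lo e.2 then e else (e.2, e.1).

Definition root_node : node T := SeqSub (nil_nodes T).
Definition pairs := sA ++ sB.
(** Items are numbered from [1], as [0] is the sentinel; the first [size sA] of them come from
    [A]. *)
Definition nth_pair i := nth (root_node, root_node) pairs i.-1.
Definition left_node i := (orient (nth_pair i)).1.
Definition right_node i := (orient (nth_pair i)).2.
Definition pair_set i : {set node T} := [set left_node i; right_node i].

Definition model_rects : rects :=
  Rects (fun i => lo (left_node i)) (fun i => hi (left_node i))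
        (fun i => lo (right_node i)) (fun i => hi (right_node i))
        (fun i => size sA < i).

Notation R := model_rects.
Notation m := (size pairs).
Notation S := (A :|: B).

Lemma node_mem u : val u \in nodes T. Proof. exact: valP. Qed.

Lemma lo_lt_hi u : lo u < hi u. Proof. exact: start_lt_stop. Qed.

Lemma size_leaves : size (leaves T) = n.
Proof.
have /perm_size -> : perm_eq (leaves T) (enum 'I_n).
  by apply: uniq_perm => // [|x]; rewrite ?enum_uniq // hall mem_enum.
by rewrite size_enum_ord.
Qed.

Lemma hi_le u : hi u <= n.
Proof. by rewrite -size_leaves; apply: stop_le. Qed.

Lemma anc_sub u v : anc u v -> lo u <= lo v /\ hi v <= hi u.
Proof. by apply: start_stop_sub; apply: node_mem. Qed.

Lemma anc_proper u v : anc u v -> u != v -> hi v - lo v < hi u - lo u.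
Proof. by move=> h ne; apply: start_stop_proper => //; apply: node_mem. Qed.

Lemma anc_disjoint u v : ~~ anc u v -> ~~ anc v u -> hi u <= lo v \/ hi v <= lo u.
Proof. by apply: start_stop_disjoint; apply: node_mem. Qed.

Lemma size_pairs : m = #|A| + #|B|.
Proof.
rewrite size_cat !cardE; congr (_ + _).
  by rewrite -(perm_size hsA) size_map.
by rewrite -(perm_size hsB) size_map.
Qed.

Lemma size_sA : size sA = #|A|.
Proof. by rewrite cardE -(perm_size hsA) size_map. Qed.

Lemma pair_set_nth i : pair_set i = [set (nth_pair i).1; (nth_pair i).2].
Proof.
rewrite /pair_set /left_node /right_node /orient; case: ifP => _ //=.
by rewrite setUC.
Qed.

Lemma pair_set_map i : 0 < i <= m ->
  pair_set i = nth set0 ([seq [set e.1; e.2] | e <- pairs]) i.-1.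
Proof.
move=> hi; rewrite pair_set_nth (nth_map (root_node, root_node)) //; lia.
Qed.

Lemma pair_set_AB i : 0 < i <= m ->
  if size sA < i then pair_set i \in B else pair_set i \in A.
Proof.
move=> hi; rewrite pair_set_map // map_cat nth_cat size_map.
case: (ltnP (size sA) i) => h.
  have -> : (i.-1 < size sA) = false by apply/negbTE; lia.
  rewrite -mem_enum -(perm_mem hsB); apply: mem_nth.
  by rewrite size_map; move: hi; rewrite size_cat; lia.
have -> : i.-1 < size sA by lia.
by rewrite -mem_enum -(perm_mem hsA); apply: mem_nth; rewrite size_map; lia.
Qed.

Lemma pair_set_S i : 0 < i <= m -> pair_set i \in S.
Proof.
by move=> /pair_set_AB; rewrite inE; case: ifP => _ ->; rewrite ?orbT.
Qed.

Lemma pair_set_B i : 0 < i <= m -> (pair_set i \in B) = (size sA < i).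
Proof.
move=> /pair_set_AB; case: ifP => // _ hA; apply/negbTE.
by have [/pred0P hd _ _] := hmodel; have := hd (pair_set i); rewrite /= hA /= => ->.
Qed.

Lemma pair_set_inj i j : 0 < i <= m -> 0 < j <= m ->
  pair_set i = pair_set j -> i = j.
Proof.
move=> hi hj e.
have u : uniq ([seq [set e.1; e.2] | e <- pairs]).
  rewrite map_cat cat_uniq (perm_uniq hsA) (perm_uniq hsB) !enum_uniq andbT /=.
  apply/hasPn => P; rewrite (perm_mem hsB) (perm_mem hsA) !mem_enum => PB.
  by have [/pred0P hd _ _] := hmodel; have := hd P; rewrite /= PB andbT => ->.
have : i.-1 = j.-1.
  apply/eqP; rewrite -(nth_uniq set0 _ _ u) ?size_map; try lia.
  by rewrite -!pair_set_map // e.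
by lia.
Qed.

Lemma pair_set_surj P : P \in S -> exists2 i, 0 < i <= m & P = pair_set i.
Proof.
move=> hP.
have : P \in [seq [set e.1; e.2] | e <- pairs].
  rewrite map_cat mem_cat (perm_mem hsA) (perm_mem hsB) !mem_enum.
  by rewrite inE in hP.
move=> /(nthP set0) [i]; rewrite size_map => hi' <-.
by exists i.+1; rewrite // pair_set_map.
Qed.

Lemma pair_incomparable i : 0 < i <= m ->
  ~~ anc (left_node i) (right_node i) /\ ~~ anc (right_node i) (left_node i).
Proof.
move=> hi; have [_ htr _] := hmodel.
have [u [v [e uv n1 n2]]] := htr _ (pair_set_S hi).
by case: (set2_eq uv e) => -[-> ->].
Qed.

Lemma orient_le i : 0 < i <= m -> hi (left_node i) <= lo (right_node i).
Proof.
move=> /pair_incomparable [] /anc_disjoint h /h.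
rewrite /left_node /right_node /orient; case: ifP => //= h1.
have := lo_lt_hi (nth_pair i).1; have := lo_lt_hi (nth_pair i).2; lia.
Qed.

Lemma model_proper i : 0 < i <= m -> proper_rect n R i.
Proof.
move=> h; rewrite /proper_rect /= lo_lt_hi lo_lt_hi orient_le //=.
exact: hi_le.
Qed.

(** Incomparable nodes have disjoint intervals, and a proper ancestor has a longer one; this leaves
    only [anc u v]. *)
Lemma nested_anc u v : lo u <= lo v -> hi v <= hi u -> anc u v.
Proof.
move=> h1 h2; apply: contraT => nuv.
have [vu|nvu] := boolP (anc v u).
  have ne : v != u by apply: contra nuv => /eqP->; apply: prefix_refl.
  by have := anc_proper vu ne; lia.
have := anc_disjoint nuv nvu; have := lo_lt_hi u; have := lo_lt_hi v; lia.
Qed.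

Lemma anc_anti u v : anc u v -> anc v u -> u = v.
Proof.
move=> h1 h2; apply/eqP; apply: contraT => ne.
by have := anc_proper h1 ne; rewrite eq_sym in ne; have := anc_proper h2 ne; lia.
Qed.

(** Incomparable left nodes give disjoint intervals; comparable ones occur with the ancestor first,
    by the first two keys. Suppose [vj] is a proper ancestor of [vi]: if [ui != uj] the pairs cross,
    and if [ui = uj] the third key is violated. *)
Lemma model_lex i j : 0 < i <= m -> 0 < j <= m -> i != j ->
  rlex_le R i j -> nested_or_apart R i j.
Proof.
move=> hi hj ij; rewrite /rlex_le /lex_le /nested_or_apart /=.
set ui := left_node i; set uj := left_node j.
set vi := right_node i; set vj := right_node j => hlex.
have [_ _ hcross] := hmodel.
have hui := lo_lt_hi ui; have huj := lo_lt_hi uj.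
have hvi := lo_lt_hi vi; have hvj := lo_lt_hi vj.
have [uij|nuij] := boolP (anc ui uj); last first.
  have [uji|nuji] := boolP (anc uj ui); last first.
    by have := anc_disjoint nuij nuji; lia.
  have ne : uj != ui by apply: contra nuij => /eqP->; apply: prefix_refl.
  by have := anc_proper uji ne; have := anc_sub uji; lia.
have [h1 h2] := anc_sub uij.
have [vij|nvij] := boolP (anc vi vj); first by have := anc_sub vij; lia.
have [vji|nvji] := boolP (anc vj vi); last first.
  by have := anc_disjoint nvij nvji; lia.
have ne : vj != vi by apply: contra nvij => /eqP->; apply: prefix_refl.
have [eu|neu] := eqVneq ui uj.
  by have := anc_proper vji ne; rewrite eu in hlex *; lia.
case: (hcross _ _ (pair_set_S hi) (pair_set_S hj)); split.
  by exists ui; [apply: set21|exists uj; [apply: set21|rewrite /sanc neu]].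
by exists vj; [apply: set22|exists vi; [apply: set22|rewrite /sanc ne]].
Qed.

Lemma last_colP (o : seq nat) x y :
  (last_col R o x y = 0 /\ forall i, i \in o -> ~~ in_rect R i x y) \/
  exists o1 i o2, [/\ o = o1 ++ i :: o2, in_rect R i x y,
    last_col R o x y = icol R i & forall j, j \in o2 -> ~~ in_rect R j x y].
Proof.
elim/last_ind: o => [|o i IH]; first by left.
have e : last_col R (rcons o i) x y =
    if in_rect R i x y then icol R i else last_col R o x y.
  by rewrite /last_col -cats1 foldl_cat.
case: (boolP (in_rect R i x y)) => hin; rewrite hin /= in e || rewrite (negbTE hin) in e.
  by right; exists o, i, [::]; rewrite cats1.
case: IH => [[h0 hno]|[o1 [j [o2 [eo hj hc h2]]]]].
  left; rewrite e; split=> // j; rewrite mem_rcons inE => /orP[/eqP->//|]; exact: hno.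
right; exists o1, j, (rcons o2 i); split=> //.
- by rewrite eo rcons_cat.
- by rewrite e.
- by move=> k; rewrite mem_rcons inE => /orP[/eqP->//|]; apply: h2.
Qed.

Section Adjacency.
Variables (o : seq nat) (x y : 'I_n) (u v : node T).
Hypothesis ho : is_sweep_order R m o.
Hypotheses (hu : is_leaf u x) (hv : is_leaf v y).
Let rx0 := index x (leaves T).
Let ry0 := index y (leaves T).
Hypothesis hxy : rx0 < ry0.

Lemma leaf_lo : lo u = rx0 /\ hi u = rx0.+1.
Proof.
have [h1 h2] := leaf_interval huniq (node_mem u) hu.
by rewrite /lo /hi h2 h1.
Qed.

Lemma leaf_lo' : lo v = ry0 /\ hi v = ry0.+1.
Proof.
have [h1 h2] := leaf_interval huniq (node_mem v) hv.
by rewrite /lo /hi h2 h1.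
Qed.

Lemma in_rect_anc i : in_rect R i rx0 ry0 = anc (left_node i) u && anc (right_node i) v.
Proof.
have [l1 l2] := leaf_lo; have [l3 l4] := leaf_lo'.
apply/idP/andP => [/andP[h1 h2]|[/anc_sub h1 /anc_sub h2]].
  split; [apply: (prefix_leaf _ _ hu); try exact: node_mem
         |apply: (prefix_leaf _ _ hv); try exact: node_mem].
    by rewrite -/(lo _) -/(lo _) l1.
  by rewrite -/(lo _) -/(lo _) l3.
by rewrite /in_rect /=; lia.
Qed.

(** The set does not tell its ends apart, but the leaf below [a] precedes the leaf below [b], so [a]
    is the left end. *)
Lemma pair_above a b : [set a; b] \in S -> anc a u -> anc b v ->
  exists i, [/\ 0 < i <= m, left_node i = a, right_node i = b & in_rect R i rx0 ry0].
Proof.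
move=> hS hau hbv; have [i hi e] := pair_set_surj hS.
have [_ htr _] := hmodel; have [a' [b' [e' ab' n1 n2]]] := htr _ hS.
have hlt := orient_le hi.
have ab : a != b.
  by case: (set2_eq ab' e') => -[-> ->] //; rewrite eq_sym.
have [l1 l2] := leaf_lo; have [l3 l4] := leaf_lo'.
have sa := anc_sub hau; have sb := anc_sub hbv.
have [[e1 e2]|[e1 e2]] := set2_eq ab (esym e); last first.
  by move: hlt; rewrite e1 e2; lia.
by exists i; rewrite in_rect_anc e1 e2 hau hbv.
Qed.

Lemma in_order i : (i \in o) = (0 < i <= m).
Proof. by case/andP: ho => /perm_mem ->; rewrite mem_iota; lia. Qed.

(** Any other rectangle that contains the point was inserted earlier. Two rectangles with a common
    point are not apart, so the earlier one contains the later one. *)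
Lemma below_last o1 i o2 j : o = o1 ++ i :: o2 -> in_rect R i rx0 ry0 ->
  (forall k, k \in o2 -> ~~ in_rect R k rx0 ry0) ->
  0 < j <= m -> in_rect R j rx0 ry0 ->
  anc (left_node j) (left_node i) && anc (right_node j) (right_node i).
Proof.
move=> eo hi hlast hj hin.
have [->|ij] := eqVneq j i; first by rewrite /anc !prefix_refl.
have jo1 : j \in o1.
  have : j \in o by rewrite in_order.
  rewrite eo mem_cat inE (negbTE ij) /= => /orP[//|/hlast].
  by rewrite hin.
have : nested_or_apart R j i.
  have := sweep_order_nested model_lex ho; rewrite eo pairwise_cat.
  by case/and3P=> /allrelP h1 _ _; apply: h1 => //; rewrite inE eqxx.
move: hi hin; rewrite /nested_or_apart /in_rect /= => hi hin hn.
by apply/andP; split; apply: nested_anc; lia.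
Qed.

(** The last rectangle containing the point lies below all others in both coordinates, so its pair
    covers the two leaves and no other pair does. *)
Lemma adj_last_col :
  (exists2 P, P \in B & covers S P u v) <-> 0 < last_col R o rx0 ry0.
Proof.
split.
  case=> P PB [PS [a [b [eP hau hbv hno]]]].
  rewrite eP in PB PS.
  have [j [hj ej1 ej2 hin]] := pair_above PS hau hbv.
  case: (last_colP o rx0 ry0) => [[_ hn]|[o1 [i [o2 [eo hi hc hlast]]]]].
    by have := hn j; rewrite in_order hj hin => /(_ isT).
  have him : 0 < i <= m by rewrite -in_order eo mem_cat inE eqxx orbT.
  have /andP[b1 b2] := below_last eo hi hlast hj hin.
  have [ij|ij] := eqVneq i j.
    rewrite hc ij /= -pair_set_B //.
    by rewrite /pair_set ej1 ej2 PB.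
  case: hno; exists (left_node i), (right_node i).
  have := hi; rewrite in_rect_anc => /andP[b3 b4].
  rewrite ej1 in b1; rewrite ej2 in b2.
  rewrite b1 b2 b3 b4; split=> //; first exact: (pair_set_S him).
  move=> e; move/eqP: ij; apply; apply: pair_set_inj => //.
  by rewrite [RHS]/pair_set ej1 ej2 -eP -e.
case: (last_colP o rx0 ry0) => [[-> //]|[o1 [i [o2 [eo hi hc hlast]]]]].
have him : 0 < i <= m by rewrite -in_order eo mem_cat inE eqxx orbT.
rewrite hc /= => hcol; exists (pair_set i).
  by rewrite pair_set_B //; move: hcol; case: (size sA < i).
split; first exact: pair_set_S.
have := hi; rewrite in_rect_anc => /andP[b3 b4].
exists (left_node i), (right_node i); split=> //.
case=> a [b [hS hne /andP[c1 c2] /andP[c3 c4]]].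
have [j [hj ej1 ej2 hin]] := pair_above hS c2 c4.
have /andP[d1 d2] := below_last eo hi hlast hj hin.
apply: hne; rewrite /pair_set -ej1 -ej2; congr [set _; _].
  by apply: anc_anti => //; rewrite ej1.
by apply: anc_anti => //; rewrite ej2.
Qed.

End Adjacency.

End Model.

(** * The interval biclique partition *)

Section Partition.
Variables (n : nat) (adj : rel 'I_n) (T : bintree 'I_n) (A B : {set {set node T}}).
Variables (sA sB : seq (node T * node T)).
Hypothesis hsimple : simple_graph adj.
Hypothesis hmodel : signed_tree_model_of A B adj.
Hypotheses (hsA : lists_pairs sA A) (hsB : lists_pairs sB B).
Variables (o : seq nat) (rg : regions).
Notation R := (model_rects sA sB).
Notation m := (size (pairs sA sB)).
Hypothesis ho : is_sweep_order R m o.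
Hypothesis htiles : tiles n R m o rg.

Let lv := leaves T.
Let rank x := index x lv.
Let gs := [seq g <- iota 1 (4 * m) | emitted rg g].

Definition region_biclique (lv : seq 'I_n) g : {set {set 'I_n}} :=
  biclique (rank_interval lv (x0 rg g) (x1 rg g - 1))
           (rank_interval lv (y0 rg g) (y1 rg g - 1)).

Let bic := region_biclique lv.

Lemma rank_lt x : rank x < n.
Proof.
have [_ hu hl _] := hmodel.
by rewrite -[n in _ < n](size_leaves hu hl) index_mem.
Qed.

Lemma rank_inj : injective rank.
Proof.
have [_ _ hl _] := hmodel; move=> x y e.
by rewrite -(nth_index x (hl x)) -/(rank x) e nth_index.
Qed.

Lemma rank_surj i : i < n -> exists x, rank x = i.
Proof.
have [_ hu hl _] := hmodel; move=> hi.
by exists (nth (Ordinal hi) lv i); rewrite /rank index_uniq // (size_leaves hu hl).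
Qed.

Lemma adj_rank x y : rank x < rank y ->
  adj x y = (0 < last_col R o (rank x) (rank y)).
Proof.
have [hm hu hl hadj] := hmodel; move=> hxy.
have [p hp ep] := leaf_node (hl x); have [q hq eq] := leaf_node (hl y).
pose u : node T := SeqSub hp; pose v : node T := SeqSub hq.
have h1 := adj_last_col hm hu hsA hsB ho (ep : is_leaf u x) (eq : is_leaf v y) hxy.
have h2 := hadj u v x y ep eq.
by apply/idP/idP => [/h2/h1|/h1/h2].
Qed.

(** Coloured points lie above the diagonal because every rectangle does. *)
Lemma last_col_lt x y : 0 < last_col R o x y -> x < y.
Proof.
have [hm hu hl _] := hmodel.
case: (last_colP sA sB o x y) => [[-> //]|[o1 [i [o2 [eo hi _ _]]]] _].
have him : 0 < i <= m.
  have : i \in o by rewrite eo mem_cat inE eqxx orbT.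
  by case/andP: ho => /perm_mem -> _; rewrite mem_iota; lia.
have := model_proper hm hu hl hsA hsB him; move: hi.
by rewrite /in_rect /proper_rect; lia.
Qed.

Lemma gsP g : g \in gs -> g <= 4 * m /\ emitted rg g.
Proof. by rewrite mem_filter mem_iota => /andP[-> h]; split=> //; lia. Qed.

(** The colour is constant on a region, so an emitted region consists of edges only and lies above
    the diagonal as a whole. *)
Lemma in_sides g x y : g \in gs ->
  x \in rank_interval lv (x0 rg g) (x1 rg g - 1) ->
  y \in rank_interval lv (y0 rg g) (y1 rg g - 1) ->
  [/\ in_region rg g (rank x) (rank y), rank x < rank y & adj x y].
Proof.
move=> /gsP[hg /and3P[hc hx hy]]; rewrite !inE -/(rank x) -/(rank y) => rx1 ry1.
have hin : in_region rg g (rank x) (rank y) by rewrite /in_region; lia.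
have [htl _ _] := htiles.
have [g0 [hg0 _ hcol huniq]] := htl _ _ (rank_lt x) (rank_lt y).
have eg := huniq _ hg hin; rewrite -eg in hcol; rewrite hcol in hc.
have lt := last_col_lt hc; split=> //.
by rewrite adj_rank.
Qed.

Lemma bicP g e : g \in gs -> reflect
  (exists x y, [/\ e = [set x; y], rank x < rank y, adj x y
                 & in_region rg g (rank x) (rank y)]) (e \in bic g).
Proof.
move=> hg; apply: (iffP imset2P) => [[x y hx hy ->]|[x [y [-> lt hadj hin]]]].
  by have [h1 h2 h3] := in_sides hg hx hy; exists x, y.
by exists x y => //; rewrite inE -/(rank _); move: hin; rewrite /in_region; lia.
Qed.

(** Used twice: blocks of a partition are nonempty, and distinct regions yield distinct
    bicliques. *)
Lemma bic_neq0 g : g \in gs -> exists e, e \in bic g.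
Proof.
move=> hg; have [hg4 /and3P[_ hx hy]] := gsP hg; have [_ hb _] := htiles.
have [hb1 hb2] := hb _ hg4.
have [|x ex] := @rank_surj (x0 rg g); first by lia.
have [|y ey] := @rank_surj (y0 rg g); first by lia.
exists [set x; y]; apply: imset2_f; rewrite inE -/(rank _) ?ex ?ey; lia.
Qed.

(** An edge is a single point above the diagonal, and this point lies in a single region. *)
Lemma bic_disjoint g g' e : g \in gs -> g' \in gs -> e \in bic g -> e \in bic g' -> g = g'.
Proof.
move=> hg hg' /(bicP _ hg) [x [y [-> lt _ hin]]] /(bicP _ hg') [x' [y' [e' lt' _ hin']]].
have xy : x' != y' by apply: contraTneq lt' => ->; rewrite ltnn.
have [[ex ey]|[ex ey]] := set2_eq xy e'; subst; last by lia.
have [hg4 _] := gsP hg; have [hg4' _] := gsP hg'.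
have [htl _ _] := htiles; have [g0 [_ _ _ hu]] := htl _ _ (rank_lt x') (rank_lt y').
by rewrite (hu _ hg4 hin) (hu _ hg4' hin').
Qed.

Lemma uniq_bic : uniq [seq bic g | g <- gs].
Proof.
rewrite map_inj_in_uniq ?filter_uniq ?iota_uniq // => g g' hg hg' e.
by have [f hf] := bic_neq0 hg; apply: (bic_disjoint hg hg' hf); rewrite -e.
Qed.

Definition biclique_set := [set b in [seq bic g | g <- gs]].

Definition rank_lt_rel : rel 'I_n := fun x y => rank x < rank y.

Lemma perm_biclique_set : perm_eq [seq bic g | g <- gs] (enum biclique_set).
Proof.
apply: uniq_perm => [||b]; rewrite ?uniq_bic ?enum_uniq //.
by rewrite mem_enum inE.
Qed.

Lemma card_biclique_set : #|biclique_set| <= 4 * (#|A| + #|B|).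
Proof.
rewrite cardE -(perm_size perm_biclique_set) size_map size_filter.
by rewrite -(size_pairs hsA hsB) -[X in _ <= X](size_iota 1) count_size.
Qed.

Lemma rank_interval_interval a b : interval rank_lt_rel (rank_interval lv a b).
Proof.
by move=> x y z; rewrite !inE /rank_lt_rel -!/(rank _) => /andP[? ?] /andP[? ?] *; lia.
Qed.

Lemma biclique_partition : interval_biclique_partition adj rank_lt_rel biclique_set.
Proof.
have [hsym hirr] := hsimple; have [htl hb h0] := htiles.
split.
- split=> [x|y x z|x y]; rewrite /rank_lt_rel.
  + exact: ltnn.
  + exact: ltn_trans.
  + by rewrite -neq_ltn => ne; apply: contra ne => /eqP/rank_inj/eqP.
- apply/and3P; split.
  + apply/eqP/setP => e; apply/bigcupP/idP.
      case=> b; rewrite inE => /mapP[g hg ->] /(bicP _ hg) [x [y [-> _ hadj _]]].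
      by rewrite inE; apply/existsP; exists x; apply/existsP; exists y; rewrite hadj eqxx.
    rewrite inE => /existsP[x /existsP[y /andP[hadj /eqP->]]].
    wlog lt : x y hadj / rank x < rank y.
      move=> wl; case: (ltngtP (rank x) (rank y)) => [lt|lt|exy].
      * exact: wl.
      * by rewrite setUC; apply: wl => //; rewrite hsym.
      * by move: hadj; rewrite (rank_inj exy) hirr.
    have := hadj; rewrite adj_rank // => hc.
    have [g [hg hin hcol _]] := htl _ _ (rank_lt x) (rank_lt y).
    have hgs : g \in gs.
      rewrite mem_filter mem_iota /emitted hcol hc /=.
      (* Region [0] has colour [0], so the region of an edge is among those scanned. *)
      have g0 : g != 0 by apply: contraTneq hc => g0; rewrite -hcol g0 h0.
      case/andP: hin => /andP[a1 a2] /andP[a3 a4].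
      by rewrite (leq_ltn_trans a1 a2) (leq_ltn_trans a3 a4) lt0n g0 add1n ltnS.
    exists (bic g); first by rewrite inE map_f.
    by apply/bicP => //; exists x, y.
  + apply/trivIsetP => b b'; rewrite !inE => /mapP[g hg ->] /mapP[g' hg' ->] ne.
    rewrite -setI_eq0; apply: contraT => /set0Pn[e]; rewrite inE => /andP[h1 h2].
    by move: ne; rewrite (bic_disjoint hg hg' h1 h2) eqxx.
  + rewrite inE; apply/mapP => -[g hg e]; have [f] := bic_neq0 hg.
    by rewrite -e inE.
- move=> b; rewrite inE => /mapP[g hg ->].
  exists (rank_interval lv (x0 rg g) (x1 rg g - 1)).
  exists (rank_interval lv (y0 rg g) (y1 rg g - 1)); split=> //; try exact: rank_interval_interval.
  rewrite -setI_eq0; apply: contraT => /set0Pn[x]; rewrite inE => /andP[h1 h2].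
  by have [_] := in_sides hg h1 h2; rewrite ltnn.
Qed.

End Partition.

(** * Decoding the input *)

Lemma size_flatten_const (K : Type) k (ss : seq (seq K)) :
  (forall i, i < size ss -> size (nth [::] ss i) = k) -> size (flatten ss) = k * size ss.
Proof.
elim: ss => [|s ss IH] h /=; first by rewrite muln0.
rewrite size_cat IH ?mulnS ?(h 0) //.
by move=> i hi; apply: (h i.+1).
Qed.

Lemma nth_flatten_const (K : Type) d k (ss : seq (seq K)) i j :
  (forall i, i < size ss -> size (nth [::] ss i) = k) -> i < size ss -> j < k ->
  nth d (flatten ss) (k * i + j) = nth d (nth [::] ss i) j.
Proof.
elim: ss i => [|s ss IH] i // h; rewrite /= nth_cat.
have -> : size s = k by apply: (h 0).
case: i => [|i] hi hj; first by rewrite muln0 add0n hj.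
rewrite (_ : _ < k = false); last by apply/negbTE; rewrite mulnS; lia.
rewrite -IH //; first by congr nth; rewrite mulnS; lia.
by move=> i' hi'; apply: (h i'.+1).
Qed.

Section Decode.
Variables (n : nat) (T : bintree 'I_n) (A B : {set {set node T}}).
Variables (ns : seq (seq bool)) (sA sB : seq (node T * node T)) (inp : seq nat).
Hypothesis hmodel : signed_tree_model A B.
Hypothesis huniq : uniq (leaves T).
Hypothesis hall : forall x, x \in leaves T.
Hypotheses (hsA : lists_pairs sA A) (hsB : lists_pairs sB B).
Hypothesis hns : perm_eq ns (nodes T).
Hypothesis hinp : inp = [:: n; size ns; size sA; size sB]
  ++ [seq val x | x <- leaves T]
  ++ flatten [seq node_record T ns p | p <- ns]
  ++ flatten [seq pair_record ns e | e <- sA]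
  ++ flatten [seq pair_record ns e | e <- sB].
Notation I := (nth 0 inp).
Notation m := (size (pairs sA sB)).
Notation nn := (size ns).

Let recs := flatten [seq node_record T ns p | p <- ns].
Let prs := flatten [seq pair_record ns e | e <- pairs sA sB].

Lemma inp_cat : inp = [:: n; nn; size sA; size sB] ++ [seq val x | x <- leaves T] ++ recs ++ prs.
Proof. by rewrite hinp /prs /pairs map_cat flatten_cat. Qed.

Lemma size_recs : size recs = 5 * nn.
Proof.
rewrite (@size_flatten_const _ 5) ?size_map // => i hi.
by rewrite (nth_map [::]).
Qed.

Lemma size_prs : size prs = 2 * m.
Proof.
rewrite (@size_flatten_const _ 2) ?size_map // => i hi.
by rewrite (nth_map (root_node T, root_node T)).
Qed.

Lemma size_inp : size inp = 4 + n + 5 * nn + 2 * m.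
Proof.
clear hns.
rewrite inp_cat 3!size_cat size_map (size_leaves huniq hall) size_recs size_prs /=.
by lia.
Qed.

Lemma nth_cat_size (K : Type) (d : K) s t i : nth d (s ++ t) (size s + i) = nth d t i.
Proof. by rewrite nth_cat ltnNge leq_addr addKn. Qed.

Lemma inp_4 j : I (4 + j) = nth 0 ([seq val x | x <- leaves T] ++ recs ++ prs) j.
Proof. by rewrite inp_cat; apply: (nth_cat_size 0 [:: n; nn; size sA; size sB]). Qed.

Lemma inp_4n j : I (4 + n + j) = nth 0 (recs ++ prs) j.
Proof.
rewrite -addnA inp_4 -[n in n + j](size_leaves huniq hall) -(size_map val).
exact: nth_cat_size.
Qed.

Lemma inp_leaf (x : 'I_n) i : i < n -> I (4 + i) = nth x (leaves T) i.
Proof.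
move=> hi; rewrite inp_4 nth_cat size_map (size_leaves huniq hall) hi.
by rewrite (nth_map x) ?(size_leaves huniq hall).
Qed.

Lemma inp_node p c : p \in nodes T -> c < 5 ->
  I (4 + n + 5 * index p ns + c) = nth 0 (node_record T ns p) c.
Proof.
move=> hp hc; have pn : p \in ns by rewrite (perm_mem hns).
have hi : index p ns < nn by rewrite index_mem.
rewrite -addnA inp_4n nth_cat size_recs (_ : _ < _); last by lia.
rewrite (@nth_flatten_const _ 0 5) ?size_map //.
  by rewrite (nth_map [::]) // nth_index.
by move=> i hi'; rewrite (nth_map [::]).
Qed.

Lemma inp_pair i c : i < m -> c < 2 ->
  I (4 + n + 5 * nn + 2 * i + c) =
  nth 0 (pair_record ns (nth (root_node T, root_node T) (pairs sA sB) i)) c.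
Proof.
clear hns.
move=> hi hc.
have -> : 4 + n + 5 * nn + 2 * i + c = 4 + n + (size recs + (2 * i + c)).
  by rewrite size_recs; lia.
rewrite inp_4n nth_cat_size.
rewrite (@nth_flatten_const _ 0 2) ?size_map //.
  by rewrite (nth_map (root_node T, root_node T)).
by move=> j hj; rewrite (nth_map (root_node T, root_node T)).
Qed.

(** The memory invariant demands that all values in the input lie below [W]. *)
Lemma inp_bound i : I i <= size inp.
Proof.
clear hns.
suff h : all (fun x => x <= size inp) inp.
  case: (ltnP i (size inp)) => hi; last by rewrite nth_default.
  exact: (allP h _ (mem_nth 0 hi)).
have hs := size_inp.
have q1 : n <= size inp by rewrite hs; lia.
have q2 : nn <= size inp by rewrite hs; lia.
have q : m <= size inp by rewrite hs; lia.
have q3 : size sA <= size inp by apply: leq_trans q; rewrite size_cat leq_addr.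
have q4 : size sB <= size inp by apply: leq_trans q; rewrite size_cat leq_addl.
have hix (p : seq bool) : index p ns <= size inp.
  have h : index p ns <= nn := index_size p ns.
  by apply: leq_trans h _; rewrite hs; lia.
have hil (x : 'I_n) : index x (leaves T) <= size inp.
  have h : index x (leaves T) <= size (leaves T) := index_size x (leaves T).
  by apply: leq_trans h _; rewrite hs (size_leaves huniq hall); lia.
rewrite {2}inp_cat !all_cat; apply/and4P; split.
- by rewrite /= q1 q2 q3 q4.
- by apply/allP => k /mapP[x _ ->]; apply: leq_trans q1; exact: ltnW (ltn_ord x).
- apply/allP => k /flattenP[s /mapP[p _ ->]]; rewrite !inE.
  by case/or4P=> [| | |/orP[]] /eqP->.
- apply/allP => k /flattenP[s /mapP[p _ ->]]; rewrite !inE.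
  by case/orP=> /eqP->.
Qed.

Lemma inp_bounds (u : node T) : let p := index (val u) ns in
  I (4 + n + 5 * p + 3) = lo u /\ (I (4 + n + 5 * p + 4)).+1 = hi u.
Proof.
rewrite /= !inp_node ?node_mem //=; split.
  by rewrite index_start // node_mem.
by rewrite index_stop // node_mem.
Qed.

Lemma model_input W i : 20 * size inp <= W -> 0 < i <= m ->
  input_rect W n (size sA) nn I (model_rects sA sB) i.
Proof.
move=> hW him; have hs := size_inp.
pose e := nth (root_node T, root_node T) (pairs sA sB) i.-1.
have hi1 : i - 1 < m by lia.
have P0 := @inp_pair (i - 1) 0 hi1 isT; have P1 := @inp_pair (i - 1) 1 hi1 isT.
rewrite addn0 [in RHS]subn1 -/e /= in P0; rewrite [in RHS]subn1 -/e /= in P1.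
rewrite /input_rect.
have [L1 H1] := inp_bounds e.1; have [L2 H2] := inp_bounds e.2.
rewrite /= -P0 in L1 H1; rewrite /= -P1 in L2 H2.
have b1 : I (4 + n + 5 * nn + 2 * (i - 1)) < nn.
  by rewrite P0 index_mem (perm_mem hns); apply: node_mem.
have b2 : I (4 + n + 5 * nn + 2 * (i - 1) + 1) < nn.
  by rewrite P1 index_mem (perm_mem hns); apply: node_mem.
move: (I (_ + _ * (i - 1))) (I (_ + _ * (i - 1) + 1)) L1 H1 L2 H2 b1 b2 {P0 P1}.
move=> p q L1 H1 L2 H2 b1 b2.
have hlt : (I (4 + n + 5 * p + 4) < I (4 + n + 5 * q + 3)) = (hi e.1 <= lo e.2).
  by rewrite L2 -H1.
rewrite hlt /rect_is /leaf_bounds L1 H1 L2 H2.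
split=> //; try by apply: leq_trans hW; rewrite hs; lia.
- by rewrite /= /left_node /right_node /orient /nth_pair -/e => ->.
- by rewrite /= /left_node /right_node /orient /nth_pair -/e => /negbTE->.
Qed.

End Decode.

(** * The constant and the final assembly *)

Definition constant := 4100 * 10.

(** The factor [10] is attained at [m = 1], where the logarithm vanishes; the excess of [4100] over
    the factor [4000] of [time_bound] absorbs the additional [100]. *)
Lemma time_bound_log m : time_bound m + 100 <= constant * (m * trunc_log 2 m).+1.
Proof.
have h : m.+1 * (trunc_log 2 m + 5) <= 10 * (m * trunc_log 2 m).+1.
  case: m => [|[|m]]; rewrite ?trunc_log0 ?trunc_log1 //.
  have : 0 < trunc_log 2 m.+2 by rewrite trunc_log_gt0.
  by move: (trunc_log 2 m.+2) => L hL; nia.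
rewrite /time_bound /constant; move: h.
by move: (m.+1 * _) (m * _) => X Y; lia.
Qed.

Lemma lists_pairs_exists n (T : bintree 'I_n) (A : {set {set node T}}) :
  (forall P, P \in A -> Defs.transversal P) -> exists s, lists_pairs s A.
Proof.
move=> hA; suff [s es] : exists s, [seq [set e.1; e.2] | e <- s] = enum A.
  by exists s; rewrite /lists_pairs es.
have : forall P, P \in enum A -> Defs.transversal P by move=> P; rewrite mem_enum; apply: hA.
elim: (enum A) => [|P l IH] h; first by exists [::].
have [|s es] := IH; first by move=> Q hQ; apply: h; rewrite inE hQ orbT.
have [u [v [-> _ _ _]]] := h P (mem_head _ _).
by exists ((u, v) :: s); rewrite /= es.
Qed.

Lemma program_correct n (adj : rel 'I_n) (T : bintree 'I_n)
    (A B : {set {set node T}}) (inp : seq nat) (w : nat) :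
  simple_graph adj -> signed_tree_model_of A B adj -> encodes_model A B inp ->
  constant * size inp <= 2 ^ w ->
  exists (t : nat) (s : state),
    [/\ exec w program (init_state inp) t s,
        t <= constant * ((#|A| + #|B|) * trunc_log 2 (#|A| + #|B|)).+1
      & exists (lt : rel 'I_n) (BB : {set {set {set 'I_n}}}),
          [/\ interval_biclique_partition adj lt BB,
              #|BB| <= constant * (#|A| + #|B|)
            & encodes_partition s lt BB]].
Proof.
move=> hsimple hmodel [ns [sA [sB [hns hsA hsB hinp]]]] hw.
have [hm hu hl _] := hmodel.
have hn : 0 < n by rewrite -(size_leaves hu hl) leaves_gt0.
have hnn : 0 < size ns by rewrite (perm_size hns); case: (T).
have hmA : size sA <= size (pairs sA sB) by rewrite size_cat leq_addr.
(* Twenty arrays, each of twenty times the input size, require a factor of [400] only. *)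
have hW : num_arrays * (20 * size inp) <= 2 ^ w.
  by apply: leq_trans hw; rewrite /num_arrays /constant; lia.
have hI : [/\ nth 0 inp 0 = n, nth 0 inp 1 = size ns, nth 0 inp 2 = size sA
            & nth 0 inp 3 = size (pairs sA sB) - size sA].
  by rewrite hinp /= size_cat addKn.
have [t [s [rg [o [hex ht ho htl [hk hlv hout]]]]]] :=
  exec_program hW hn hnn hmA (size_inp hu hl hinp) hI (inp_bound hu hl hinp)
    (fun i => model_input hu hl hns hinp (leqnn _))
    (@model_proper _ _ _ _ _ _ hm hu hl hsA hsB)
    (@model_lex _ _ _ _ _ _ hm hu hsA hsB).
exists t, s; split=> //.
  by apply: leq_trans ht _; rewrite -(size_pairs hsA hsB); apply: time_bound_log.
exists (rank_lt_rel T), (biclique_set sA sB rg); split.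
- exact: (biclique_partition hsimple hmodel hsA hsB ho htl).
- apply: leq_trans (card_biclique_set hmodel hsA hsB ho htl) _.
  by rewrite leq_mul2r /constant orbC.
exists (leaves T); split.
- by apply: uniq_perm => // [|x]; rewrite ?enum_uniq // hl mem_enum.
- apply: (@eq_from_nth _ 0); rewrite ?size_map ?size_iota ?(size_leaves hu hl) // => i hi.
  rewrite (nth_map 0) ?size_iota // nth_iota // add0n hlv //.
  rewrite (inp_leaf hu hl hinp (Ordinal hn)) //.
  by rewrite (nth_map (Ordinal hn)) ?(size_leaves hu hl).
- by [].
apply: perm_trans (perm_biclique_set hmodel hsA hsB ho htl).
rewrite hk; set gs := [seq _ <- _ | _].
rewrite (_ : [seq _ | j <- _] = [seq region_biclique rg (leaves T) g | g <- gs]) //.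
apply: (@eq_from_nth _ set0); rewrite ?size_map ?size_iota // => i hi.
rewrite (nth_map 0) ?size_iota // (nth_map 0) // nth_iota // add0n.
by rewrite !hout.
Qed.

Theorem lemma3p3 :
  (exists C : nat,
     forall (n : nat) (adj : rel 'I_n) (T : bintree 'I_n)
            (A B : {set {set node T}}),
       simple_graph adj -> signed_tree_model_of A B adj ->
       exists (lt : rel 'I_n) (BB : {set {set {set 'I_n}}}),
         interval_biclique_partition adj lt BB /\
         #|BB| <= C * (#|A| + #|B|))
  /\
  (exists (C : nat) (prog : cmd),
     forall (n : nat) (adj : rel 'I_n) (T : bintree 'I_n)
            (A B : {set {set node T}}),
       simple_graph adj -> signed_tree_model_of A B adj ->
       forall (inp : seq nat) (w : nat),
         encodes_model A B inp -> C * size inp <= 2 ^ w ->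
         exists (t : nat) (s : state),
           [/\ exec w prog (init_state inp) t s,
               t <= C * ((#|A| + #|B|) * trunc_log 2 (#|A| + #|B|)).+1
             & exists (lt : rel 'I_n) (BB : {set {set {set 'I_n}}}),
                 [/\ interval_biclique_partition adj lt BB,
                     #|BB| <= C * (#|A| + #|B|)
                   & encodes_partition s lt BB]]).
Proof.
split; last by exists constant, program => n adj T A B hs hm inp w; apply: program_correct.
exists constant => n adj T A B hsimple hmodel; have [[_ htr _] _ _ _] := hmodel.
have [|sA hsA] := @lists_pairs_exists n T A; first by move=> P hP; apply: htr; rewrite inE hP.
have [|sB hsB] := @lists_pairs_exists n T B.
  by move=> P hP; apply: htr; rewrite inE hP orbT.
set inp := [:: n; size (nodes T); size sA; size sB] ++ [seq val x | x <- leaves T]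
  ++ flatten [seq node_record T (nodes T) p | p <- nodes T]
  ++ flatten [seq pair_record (nodes T) e | e <- sA]
  ++ flatten [seq pair_record (nodes T) e | e <- sB].
have henc : encodes_model A B inp by exists (nodes T), sA, sB.
(* The partition is the one that the program computes; since [k < 2 ^ k], words of
   [constant * size inp] bits are long enough. *)
have [t [s [_ _ [lt [BB [h1 h2 _]]]]]] :=
  program_correct hsimple hmodel henc (ltnW (ltn_expl (constant * size inp) (isT : 1 < 2))).
by exists lt, BB.
Qed.
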